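(* Let $P\subset\mathbb{R}^m$ be a Delzant polytope and let $f\in C_0^\infty(\mathbb{R}^m)$. Then there exist differential operators $\mathcal{E}_j$ ($j\ge 2$) such that, as $N\to\infty$, $$\sum_{\alpha\in NP\cap\mathbb{Z}^m}f\Big(\frac{\alpha}{N}\Big)\sim N^m\int_Pf(x)\,dx+\frac{N^{m-1}}{2}\int_{\partial P}f(x)\,d\sigma+N^{m-2}\int_P\mathcal{E}_2f(x)\,dx+\cdots,$$ where $\sigma$ is the Leray measure on $\partial P$ corresponding to the affine defining functions $\ell_r$ of the boundary facets; that is, on the $r$th facet of $\partial P$, $d\ell_r\wedge d\sigma=dx$.
   Context: A Delzant polytope is a convex polytope $P=\{x\in\mathbb{R}^m:\langle x,v_r\rangle\ge\lambda_r,\ r=1,\dots,d\}$ with vertices in $\mathbb{Z}^m$, where $v_r$ is the primitive lattice inward-pointing normal to the $r$th facet, such that each vertex lies on exactly $m$ facets and the normals to the $m$ facets at each vertex form a $\mathbb{Z}$-basis of the lattice. The affine defining functions are $\ell_r(x)=\langle x,v_r\rangle-\lambda_r$ (so $d\ell_r=\langle dx,v_r\rangle$). The Leray measure $\sigma$ is the positive measure on $\partial P$ determined on each facet by $d\ell_r\wedge d\sigma=dx$ (up to sign), $dx$ being Lebesgue measure. The expansion is a complete asymptotic expansion in descending powers of $N$, the term of order $N^{m-j}$, $j\ge2$, being $N^{m-j}\int_P\mathcal{E}_jf(x)\,dx$; $\sim$ means that for each $K$ the difference between the left side and the terms through $N^{m-K}$ is $O(N^{m-K-1})$. *)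

(* Defs.v *)
From HB Require Import structures.
From mathcomp Require Import all_boot all_order all_algebra.
From mathcomp Require Import all_classical all_reals all_analysis.
From mathcomp Require Import measurable_realfun.

Set Implicit Arguments.
Unset Strict Implicit.
Unset Printing Implicit Defensive.

Import Order.TTheory GRing.Theory Num.Theory.
Import numFieldNormedType.Exports.

Local Open Scope classical_set_scope.
Local Open Scope ring_scope.

(* R^n is 'rV[R]_n, with the product sigma-algebra (generated by the
   coordinate maps), as in the library's instance for tuples. *)
Section measurable_rV.
Context {d} {T : measurableType d} (n : nat).

Let coord : 'I_n -> 'rV[T]_n -> T := fun i x => x ord0 i.

Let rV_set0 : g_sigma_preimage coord set0.
Proof. exact: sigma_algebra0. Qed.

Let rV_setC A : g_sigma_preimage coord A -> g_sigma_preimage coord (~` A).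
Proof. exact: sigma_algebraC. Qed.

Let rV_bigcup (F : (set 'rV[T]_n)^nat) :
  (forall i, g_sigma_preimage coord (F i)) ->
  g_sigma_preimage coord (\bigcup_i (F i)).
Proof. exact: sigma_algebra_bigcup. Qed.

HB.instance Definition _ := @isMeasurable.Build (measure_tuple_display d)
  'rV[T]_n (g_sigma_preimage coord) rV_set0 rV_setC rV_bigcup.

End measurable_rV.

Section measurable_rV_theory.
Context d {T : measurableType d}.

Lemma measurable_coord n (i : 'I_n) :
  measurable_fun [set: 'rV[T]_n] (fun x : 'rV[T]_n => x ord0 i).
Proof.
move=> _ Y mY; rewrite setTI; apply: sub_sigma_algebra => /=.
rewrite -bigcup_seq/=; exists i => /=; first by rewrite mem_index_enum.
by exists Y => //; rewrite setTI.
Qed.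

Lemma measurable_fun_rVP d1 (T1 : measurableType d1) n (f : T1 -> 'rV[T]_n) :
  (forall i, measurable_fun [set: T1] (fun x => f x ord0 i)) ->
  measurable_fun [set: T1] f.
Proof.
move=> mf _ A mA; rewrite setTI.
have sF : sigma_algebra [set: 'rV[T]_n]
    (image_set_system [set: T1] f measurable).
  by apply: sigma_algebra_image; exact: sigma_algebra_measurable.
suff : image_set_system [set: T1] f measurable A.
  by rewrite /image_set_system /= setTI.
apply: mA; split => // B /=; rewrite -bigcup_seq => -[i /= _ [Y mY <-]].
rewrite /image_set_system /= !setTI.
by have := mf i measurableT Y mY; rewrite setTI.
Qed.

End measurable_rV_theory.

(* The row vector whose i-th entry is a, the others being those of y. *)
Definition rV_insert {T : Type} {n : nat} (i : 'I_n) (a : T) (y : 'rV[T]_n.-1)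
    : 'rV[T]_n :=
  \row_k (if unlift i k is Some j then y ord0 j else a).

Section lebesgue_rV.
Context {R : realType}.

Lemma measurable_rV_insert d1 (T1 : measurableType d1) n (i : 'I_n)
    (a : T1 -> R) (y : T1 -> 'rV[R]_n.-1) :
  measurable_fun setT a -> measurable_fun setT y ->
  measurable_fun setT (fun t => rV_insert i (a t) (y t)).
Proof.
move=> ma my; apply: measurable_fun_rVP => k.
case: (unliftP i k) => [j|] ->.
  rewrite (_ : (fun x => _) = (fun x => x ord0 j) \o y).
    exact: (measurableT_comp (measurable_coord j) my).
  by apply/funext => t /=; rewrite mxE liftK.
rewrite (_ : (fun x => _) = a)//.
by apply/funext => t /=; rewrite mxE unlift_none.
Qed.

Definition rV_cons {n} (p : R * 'rV[R]_n) : 'rV[R]_n.+1 :=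
  @rV_insert R n.+1 ord0 p.1 p.2.

Lemma measurable_rV_cons n : measurable_fun [set: R * 'rV[R]_n] rV_cons.
Proof. exact: (@measurable_rV_insert _ _ n.+1). Qed.

(* Lebesgue measure on R^n, restricted to the Borel sets. *)
Fixpoint lebesgue_rV (n : nat) : set 'rV[R]_n -> \bar R :=
  match n with
  | 0 => \d_(0 : 'rV[R]_0)
  | n'.+1 => pushforward (lebesgue_measure \x @lebesgue_rV n')%E rV_cons
  end.

Section lebesgue_rV_succ.
Variables (n : nat) (mu : {sigma_finite_measure set 'rV[R]_n -> \bar R}).

Definition lebesgue_rV_succ : set 'rV[R]_n.+1 -> \bar R :=
  pushforward (lebesgue_measure \x mu)%E rV_cons.

Let succ_measure : {measure set 'rV[R]_n.+1 -> \bar R} :=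
  measure_function_pushforward__canonical__measure_function_Measure
    (lebesgue_measure \x mu)%E (@measurable_rV_cons n).

HB.instance Definition _ := isMeasure.Build _ _ _ lebesgue_rV_succ
  (measure0 succ_measure) (measure_ge0 succ_measure)
  (@measure_semi_sigma_additive _ _ _ succ_measure).

Let succ_sigma_finite : sigma_finite setT lebesgue_rV_succ.
Proof.
have /sigma_finiteP[F [TF ndF Foo]] := sigma_finiteT (@lebesgue_measure R).
have /sigma_finiteP[G [TG ndG Goo]] := sigma_finiteT mu.
pose uncons (x : 'rV[R]_n.+1) : R * 'rV[R]_n :=
  (x ord0 ord0, \row_j x ord0 (lift ord0 j)).
have consK : cancel rV_cons uncons.
  move=> [a y]; congr pair; first by rewrite mxE unlift_none.
  by apply/rowP => j; rewrite !mxE liftK.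
have muncons : measurable_fun setT uncons.
  apply/measurable_fun_pairP; split; first exact: measurable_coord.
  apply: measurable_fun_rVP => i /=.
  under eq_fun do rewrite mxE.
  exact: measurable_coord.
exists (fun k => uncons @^-1` (F k `*` G k)).
  rewrite -preimage_bigcup (_ : \bigcup_k _ = setT) ?preimage_setT//.
  rewrite -subTset => -[a y] _.
  have [i _ Fi] : (\bigcup_i F i) a by rewrite -TF.
  have [j _ Gj] : (\bigcup_j G j) y by rewrite -TG.
  exists (maxn i j) => //; split => /=.
    by move: a Fi; exact/subsetPset/ndF/leq_maxl.
  by move: y Gj; exact/subsetPset/ndG/leq_maxr.
move=> k; have [mF Fkoo] := Foo k; have [mG Gkoo] := Goo k; split.
  rewrite -[X in measurable X]setTI; apply: muncons => //.
  exact: measurableX.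
rewrite /lebesgue_rV_succ /pushforward -comp_preimage.
rewrite (_ : uncons \o rV_cons = id); last first.
  exact/funext.
by rewrite product_measure1E// lte_mul_pinfty// ge0_fin_numE.
Qed.

HB.instance Definition _ := Measure_isSigmaFinite.Build _ _ _ lebesgue_rV_succ
  succ_sigma_finite.

End lebesgue_rV_succ.

Let lebesgue_rV_ex n :
  exists mu : {sigma_finite_measure set 'rV[R]_n -> \bar R},
    @lebesgue_rV n = mu.
Proof.
elim: n => [|n [mu muE]]; first by exists \d_(0 : 'rV[R]_0).
by exists (lebesgue_rV_succ mu); rewrite /= muE.
Qed.

Section lebesgue_rV_instances.
Variable n : nat.

Let leb0 : @lebesgue_rV n set0 = 0.
Proof. by have [mu ->] := lebesgue_rV_ex n; exact: measure0. Qed.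

Let leb_ge0 A : (0 <= @lebesgue_rV n A)%E.
Proof. by have [mu ->] := lebesgue_rV_ex n; exact: measure_ge0. Qed.

Let leb_additive : semi_sigma_additive (@lebesgue_rV n).
Proof.
by have [mu ->] := lebesgue_rV_ex n; exact: measure_semi_sigma_additive.
Qed.

HB.instance Definition _ := isMeasure.Build _ _ _ (@lebesgue_rV n)
  leb0 leb_ge0 leb_additive.

Let leb_sigma_finite : sigma_finite setT (@lebesgue_rV n).
Proof. by have [mu ->] := lebesgue_rV_ex n; exact: sigma_finiteT. Qed.

HB.instance Definition _ := Measure_isSigmaFinite.Build _ _ _ (@lebesgue_rV n)
  leb_sigma_finite.

End lebesgue_rV_instances.

End lebesgue_rV.
Arguments lebesgue_rV : clear implicits.
Arguments lebesgue_rV {R} n.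

Lemma lebesgue_rV_box {R : realType} n (A : 'I_n -> set R) :
  (forall i, measurable (A i)) ->
  lebesgue_rV n [set x : 'rV[R]_n | forall i, A i (x ord0 i)] =
  (\prod_(i < n) lebesgue_measure (A i))%E.
Proof.
elim: n A => [|n IH] A mA.
  by rewrite big_ord0 /= diracE mem_set//; case.
rewrite big_ord_recl /= /pushforward.
rewrite (_ : _ @^-1` _ = A ord0 `*`
    [set y : 'rV[R]_n | forall i, A (lift ord0 i) (y ord0 i)]).
  rewrite product_measure1E//; last first.
    rewrite (_ : [set _ | _] = \bigcap_(i in [set: 'I_n])
        ((fun y : 'rV[R]_n => y ord0 i) @^-1` A (lift ord0 i))).
      apply: fin_bigcap_measurable => // i _.
      by rewrite -[X in measurable X]setTI; exact: measurable_coord.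
    by apply/seteqP; split => y /= H i; [move=> _|]; exact: H.
    exact: mA.
  by congr (_ * _)%E; apply: (IH (fun i => A (lift ord0 i))) => i; exact: mA.
apply/seteqP; split => -[a y] /=.
  move=> H; split; first by have := H ord0; rewrite mxE unlift_none.
  by move=> i; have := H (lift ord0 i); rewrite mxE liftK.
move=> [H0 H] i; rewrite mxE; case: unliftP => [j ->|->]//; exact: H.
Qed.

Section delzant.
Context {R : realType} {m : nat}.
Implicit Types (x : 'rV[R]_m) (u : 'rV[int]_m) (P : set 'rV[R]_m).

Definition pairing x u : R := \sum_i x ord0 i * (u ord0 i)%:~R.

Lemma measurable_pairing u : measurable_fun [set: 'rV[R]_m] (pairing ^~ u).
Proof.
apply: measurable_sum => i; apply: measurable_funM => //.
exact: measurable_coord.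
Qed.

Definition vertex P x :=
  P x /\ forall y z (t : R), P y -> P z -> 0 < t < 1 ->
    x = t *: y + (1 - t) *: z -> y = x /\ z = x.

(* F contains k + 1 affinely independent points. *)
Definition affine_dim_ge (k : nat) (F : set 'rV[R]_m) :=
  exists (x0 : 'rV[R]_m) (M : 'M[R]_(k, m)),
    [/\ F x0, row_free M & forall i, F (x0 + row i M)].

Definition primitive u := \big[gcdn/0%N]_(i < m) `|u ord0 i|%N = 1%N.

(* The rows of M form a Z-basis of Z^m. *)
Definition int_basis k (M : 'M[int]_(k, m)) :=
  forall z : 'rV[int]_m, exists! c : 'rV[int]_k, c *m M = z.

Variables (d : nat) (v : 'I_d -> 'rV[int]_m) (lambda : 'I_d -> R).

Definition polytope : set 'rV[R]_m :=
  [set x | forall r, lambda r <= pairing x (v r)].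

Definition facet (r : 'I_d) : set 'rV[R]_m :=
  [set x | polytope x /\ pairing x (v r) = lambda r].

Definition active x : pred 'I_d := fun r => pairing x (v r) == lambda r.

Definition active_normals x : 'M[int]_(#|active x|, m) :=
  \matrix_(k < #|active x|) v (enum_val k).

Record delzant : Prop := {
  delzant_bounded : bounded_set polytope;
  delzant_full_dim : polytope^° !=set0;
  (* each inequality cuts out a face of dimension m - 1, and distinct
     inequalities cut out distinct ones, so r enumerates the facets *)
  delzant_facet : forall r, affine_dim_ge m.-1 (facet r);
  delzant_facet_inj : injective facet;
  delzant_primitive : forall r, primitive (v r);
  delzant_lattice : forall x, vertex polytope x ->
    exists z : 'rV[int]_m, x = map_mx intr z;
  delzant_simple : forall x, vertex polytope x -> #|active x| = m;
  delzant_smooth : forall x, vertex polytope x -> int_basis (active_normals x)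
}.

(* The hyperplane <x, u> = l parametrized by the coordinates other than the
   i-th, when the i-th entry of u is nonzero. *)
Definition chart u (l : R) (i : 'I_m) (y : 'rV[R]_m.-1) : 'rV[R]_m :=
  rV_insert i ((l - \sum_j y ord0 j * (u ord0 (lift i j))%:~R)
               / (u ord0 i)%:~R) y.

Lemma pairing_chart u l i y : u ord0 i != 0 -> pairing (chart u l i y) u = l.
Proof.
move=> ui; rewrite /pairing (bigD1_ord i)//= mxE unlift_none.
rewrite divfK ?intr_eq0//.
under eq_bigr do rewrite mxE liftK.
by rewrite subrK.
Qed.

Lemma measurable_chart u l i : measurable_fun setT (chart u l i).
Proof.
apply: measurable_rV_insert => //; apply: measurable_funM => //.
apply: measurable_funB => //; apply: measurable_sum => j.
by apply: measurable_funM => //; exact: measurable_coord.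
Qed.

Lemma measurable_facet r : measurable (facet r).
Proof.
have mp s : measurable (pairing ^~ (v s) @^-1` `[lambda s, +oo[).
  by rewrite -[X in measurable X]setTI; exact: measurable_pairing.
rewrite (_ : facet r = \bigcap_(s in [set: 'I_d])
    (pairing ^~ (v s) @^-1` `[lambda s, +oo[) `&`
    (pairing ^~ (v r) @^-1` [set lambda r])).
  apply: measurableI; first exact: fin_bigcap_measurable.
  by rewrite -[X in measurable X]setTI; exact: measurable_pairing.
apply/seteqP; split => x /= [Px xr]; split=> // s.
  by move=> _; rewrite /= in_itv/= andbT.
by have := Px s I; rewrite /= in_itv/= andbT.
Qed.

Definition chart_lebesgue u l i : set 'rV[R]_m -> \bar R :=
  pushforward (lebesgue_rV m.-1) (chart u l i).

HB.instance Definition _ u l i := Measure.copy (chart_lebesgue u l i)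
  (measure_function_pushforward__canonical__measure_function_Measure
    (lebesgue_rV m.-1) (measurable_chart u l i)).

(* In the coordinates y of the chart that solves l_r(x) = <x, v_r> - lambda_r
   = 0 for x_i, the equation dl_r /\ d(sigma) = dx (up to sign) says that
   d(sigma) = dy / |v_r i|: this is chart_leray below.  A nonzero entry i
   exists because v_r is primitive, and its choice does not matter. *)
Definition leray_facet (r : 'I_d) : {measure set 'rV[R]_m -> \bar R} :=
  if [pick i | v r ord0 i != 0] is Some i then
    mscale (`|(v r ord0 i)%:~R|^-1)%:nng
      (mrestr (chart_lebesgue (v r) (lambda r) i) (measurable_facet r))
  else mzero.

Definition leray (A : set 'rV[R]_m) : \bar R :=
  (\sum_(r < d) leray_facet r A)%E.

Let lerayE : leray = msum (fun k => oapp leray_facet mzero (insub k)) d.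
Proof.
apply/funext => A; apply: eq_bigr => r _.
by rewrite valK.
Qed.

Let leray0 : leray set0 = 0.
Proof. by rewrite lerayE measure0. Qed.

Let leray_ge0 A : (0 <= leray A)%E.
Proof. by rewrite lerayE; exact: measure_ge0. Qed.

Let leray_additive : semi_sigma_additive leray.
Proof. by rewrite lerayE; exact: measure_semi_sigma_additive. Qed.

HB.instance Definition _ := isMeasure.Build _ _ _ leray
  leray0 leray_ge0 leray_additive.

(* (dl /\ |u_i|^-1 dy)(w, t_1, ..., t_(m-1)) = dx(w, t_1, ..., t_(m-1)) up to
   sign, for l = <., u>, every vector w, and t_j the j-th tangent vector of
   the chart (the image of the j-th basis vector under its linear part). *)
Lemma chart_leray u i (w : 'rV[R]_m) : u ord0 i != 0 ->
  `|pairing w u| * `|(u ord0 i)%:~R|^-1 =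
  `|\det (\matrix_k (if unlift i k is Some j then chart u 0 i (delta_mx 0 j)
                     else w))|.
Proof.
move=> ui; set B := \matrix_k _.
have ui0 : (u ord0 i)%:~R != 0 :> R by rewrite intr_eq0.
pose C : 'M[R]_m :=
  \matrix_(j, k) (if k == i then (u ord0 j)%:~R else (j == k)%:R).
have mulC (x : 'rV[R]_m) k :
    (x *m C) ord0 k = if k == i then pairing x u else x ord0 k.
  rewrite mxE; case: eqP => [->|/eqP ki].
    by apply: eq_bigr => j _; rewrite mxE eqxx.
  rewrite (bigD1 k)//= mxE (negbTE ki) eqxx mulr1 big1 ?addr0// => j jk.
  by rewrite mxE (negbTE ki) (negbTE jk) mulr0.
have BCE j k : (B *m C) j k = (row j B *m C) ord0 k.
  by rewrite -row_mul [RHS]mxE.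
have detC : \det C = (u ord0 i)%:~R.
  rewrite (expand_det_row _ i) (bigD1 i)//= big1 ?addr0; last first.
    by move=> k ki; rewrite mxE (negbTE ki) eq_sym (negbTE ki) mul0r.
  rewrite mxE eqxx /cofactor addnn -signr_odd odd_double expr0 mul1r.
  rewrite (_ : row' i (col' i C) = 1%:M) ?det1 ?mulr1//.
  apply/matrixP => a b; rewrite !mxE eq_sym (negbTE (neq_lift _ _)).
  by rewrite (inj_eq lift_inj).
have detBC : \det (B *m C) = pairing w u.
  rewrite (expand_det_col _ i) (bigD1 i)//= big1 ?addr0; last first.
    move=> k; case: (unliftP i k) => [j ->|->]; last by rewrite eqxx.
    by move=> _; rewrite BCE mulC eqxx rowK liftK pairing_chart// mul0r.
  rewrite BCE mulC eqxx rowK unlift_none.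
  rewrite /cofactor addnn -signr_odd odd_double expr0 mul1r.
  rewrite (_ : row' i (col' i _) = 1%:M) ?det1 ?mulr1//.
  apply/matrixP => a b; rewrite [LHS]mxE [LHS]mxE.
  rewrite [LHS](BCE (lift i a) (lift i b)) mulC.
  by rewrite eq_sym (negbTE (neq_lift _ _)) rowK liftK !mxE liftK mxE eqxx
             eq_sym.
by rewrite -detBC det_mulmx detC normrM mulfK// normr_eq0.
Qed.

End delzant.

Section smooth.
Context {R : realType} {m : nat}.
Implicit Types f : 'rV[R]_m -> R.

Definition partial (i : 'I_m) f : 'rV[R]_m -> R :=
  fun x => 'D_(delta_mx ord0 i) f x.

Definition smooth f := forall s : seq 'I_m,
  continuous (foldr partial f s) /\
  forall i x, derivable (foldr partial f s) x (delta_mx ord0 i).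

Definition compactly_supported f := compact (closure [set x | f x != 0]).

(* The partial derivative with multi-index b. *)
Definition mpartial (b : 'I_m -> nat) f : 'rV[R]_m -> R :=
  foldr (fun i => iter (b i) (partial i)) f (enum 'I_m).

(* Linear differential operators of finite order with coefficients in
   C^oo(R^m); multi-indices of weight at most k have entries in 'I_k.+1. *)
Definition differential_operator (D : ('rV[R]_m -> R) -> 'rV[R]_m -> R) :=
  exists (k : nat) (a : {ffun 'I_m -> 'I_k.+1} -> 'rV[R]_m -> R),
    (forall b, smooth (a b)) /\
    forall f, smooth f -> forall x,
      D f x = \sum_(b : {ffun 'I_m -> 'I_k.+1} | (\sum_i b i <= k)%N)
                a b x * mpartial (fun i => b i) f x.

End smooth.

Section expansion.
Context {R : realType}.

(* S(N) ~ \sum_(j >= 0) c_j N^(m - j); the exponents are integers. *)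
Definition asymptotic_expansion (m : nat) (S : nat -> R) (c : nat -> R) :=
  forall K : nat,
    (fun N : nat => S N - \sum_(j < K.+1) c j * N%:R ^ (m%:Z - j%:Z)) =O_\oo
    (fun N : nat => N%:R ^ (m%:Z - K%:Z - 1) : R).

Definition dilated_lattice_points {m} (P : set 'rV[R]_m) (N : nat) :
    set 'rV[int]_m :=
  [set a | [set N%:R *: x | x in P] (map_mx intr a)].

(* A finite sum when P is bounded. *)
Definition riemann_sum {m} (P : set 'rV[R]_m) (f : 'rV[R]_m -> R) (N : nat) :=
  \sum_(a \in dilated_lattice_points P N) f (N%:R^-1 *: map_mx intr a).

End expansion.

(* Main.v *)
Require Import Defs.
From HB Require Import structures.
From mathcomp Require Import all_boot all_order all_algebra.
From mathcomp Require Import all_classical all_reals all_analysis.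
From mathcomp Require Import fingroup perm measurable_realfun.
From mathcomp Require Import ring lra.

(** The lattice sum is localized at the vertices of P, where a Delzant polytope
    is an orthant up to an affine unimodular map, and on an orthant the
    Euler-Maclaurin formula applies one coordinate at a time.

    Unimodular coordinates.  Let A be the set of the facets through a vertex x.
    Since the m normals v_r, r in A, form a basis of the lattice, there are
    integral vectors w_i with <w_i, v_r> = 1 when r is the i-th element of A
    and 0 for its other elements.  The map sending u to x + u_1 w_1 + ... +
    u_m w_m permutes the lattice points, preserves Lebesgue measure, and
    carries the orthant of the u with nonnegative entries to the cone cut out
    by the inequalities of A.  This is a frame ([frame], [vertex_frame]).

    Localization.  The product of the functions exp(-1/l_r) over the r outside A,
    each continued by 0 to the half-space where l_r is not positive, is smooth
    and vanishes wherever an inequality outside A fails.  The facets through a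
    given point of P all pass through a common vertex ([vertex_above]), so that
    the sum of these products over the vertices is positive on P.  Normalizing
    gives smooth functions [cutoff A] with sum 1 on P ([sum_cutoff]).  If f has
    compact support, then g_A = [cutoff A] * f is smooth with compact support
    and vanishes at the points of the cone of A that are outside P.  Hence the
    sum of g_A over the points of P with coordinates in (1/N)Z is, in the
    coordinates u, a sum over all such points of a cube [0, L)^m with L large
    ([riemann_sum_frame]), and integrals over P of g_A and of its derivatives
    are integrals over that cube ([frame_integral]).

    Expansion.  In one variable, the mean (1/N) sum_(k < LN) G(k/N) is
    asymptotic to the sum over a of c_a N^-a times the integral of the a-th
    derivative of G over [0, L], where the generating function of the c_a is
    t/(e^t - 1) ([em_interval]): the boundary terms are kept as integrals of
    derivatives, and this is why all the terms of the expansion are integrals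
    over P.  Iterating over the m directions ([euler_maclaurin]), the term of
    order N^-j is the integral of [em_operator W j g_A], the part of degree j of
    the product over i of D_i / (exp(D_i) - 1), where D_i is the derivative along
    w_i.  So E_j f is the sum over the vertices of these functions.

    The boundary term.  For j = 1 the operator is -1/2 times the sum of the D_i.
    The fundamental theorem of calculus in the direction w_i turns the integral
    of D_i g_A into minus the integral of g_A over the face u_i = 0, for the
    Lebesgue measure of the other coordinates ([divergence_facet]).  That
    measure is the Leray measure of the facet ([leray_facet_frame]): the
    latter is dy / |v_rk| in the coordinates y = (x_j), j different from k, and
    the change of coordinates has determinant a minor of order m - 1 of the
    matrix with rows w_i, which is the entry v_rk of the inverse matrix up to
    sign ([frame_cofactor]). *)

Set Implicit Arguments.
Unset Strict Implicit.
Unset Printing Implicit Defensive.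

Import Order.TTheory GRing.Theory Num.Theory.
Import numFieldNormedType.Exports.

Local Open Scope classical_set_scope.
Local Open Scope ring_scope.

(** * Smooth functions on R^m *)

Section line_derivatives.
Context {R : realType} {V : normedModType R}.
Implicit Types (f : V -> R) (x e w : V).

(** Restricting to lines reduces directional derivatives to derivatives of functions of a
    real variable, where the mean value theorem is available. *)
Lemma is_derive_line f x w (t : R) : derivable f (x + t *: w) w ->
  is_derive t 1 (fun s : R => f (x + s *: w)) ('D_w f (x + t *: w)).
Proof.
move=> df.
have E : (fun h : R => h^-1 *: (((fun s : R => f (x + s *: w)) \o shift t) (h *: 1)
    - f (x + t *: w))) =
  (fun h : R => h^-1 *: ((f \o shift (x + t *: w)) (h *: w) - f (x + t *: w))).
  apply/funext => h /=; congr (_ *: (f _ - _)).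
  by rewrite [h *: 1]mulr1 scalerDl addrCA.
by apply: DeriveDef; rewrite /derivable /derive E.
Qed.

Lemma is_derive_from_line f x w (d : R) :
  is_derive (0 : R) 1 (fun h : R => f (h *: w + x)) d -> is_derive x w f d.
Proof.
have E : (fun h : R => h^-1 *: (((fun h : R => f (h *: w + x)) \o shift 0) (h *: 1)
    - f (0 *: w + x))) =
  (fun h : R => h^-1 *: ((f \o shift x) (h *: w) - f x)).
  by apply/funext => h /=; rewrite addr0 scale0r add0r [h *: 1]mulr1.
move=> [dl dE]; apply: DeriveDef; first exact/derivable1P.
by rewrite /derive -E.
Qed.

(** The intermediate point is only located by |th| <= |a|, so that negative a needs no separate
    statement. *)
Lemma line_MVT f e : (forall x, derivable f x e) -> forall x (a : R),
  exists th : R, `|th| <= `|a| /\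
    f (x + a *: e) - f x = a * 'D_e f (x + th *: e).
Proof.
move=> df x a.
have dl (t : R) : is_derive t 1 (fun s : R => f (x + s *: e)) ('D_e f (x + t *: e)).
  exact: is_derive_line.
have cl (a1 b1 : R) : {within `[a1, b1], continuous (fun s : R => f (x + s *: e))}.
  apply: derivable_within_continuous => y _.
  by have [] := dl y.
have [a0|a0] := leP 0 a.
  have [c] := MVT_segment a0 (fun t _ => dl t) (@cl 0 a).
  rewrite in_itv /= => /andP[c0 ca] E; exists c; split.
    by rewrite !ger0_norm.
  by move: E; rewrite scale0r addr0 subr0 mulrC.
have [c] := MVT_segment (ltW a0) (fun t _ => dl t) (@cl a 0).
rewrite in_itv /= => /andP[ca c0] E; exists c; split.
  by rewrite !ler0_norm ?lerN2// ltW.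
by move: E; rewrite scale0r addr0 sub0r => E; rewrite -[LHS]opprB E mulrN opprK mulrC.
Qed.

(** Directional derivatives are additive in the direction if one of the two is continuous: the
    increment along w + c e splits into an increment along w at x and an increment along e at a
    nearby point, and the mean value theorem rewrites the latter. *)
Lemma is_derive_addv f x w e (c : R) :
  (forall x, derivable f x e) -> continuous ('D_e f) -> derivable f x w ->
  is_derive x (w + c *: e) f ('D_w f x + c * 'D_e f x).
Proof.
move=> de ce dw.
have /choice[th Hth] : forall h : R, exists th : R, `|th| <= `|h * c| /\
    f (x + h *: w + (h * c) *: e) - f (x + h *: w) =
    (h * c) * 'D_e f (x + h *: w + th *: e).
  by move=> h; exact: line_MVT.
have th0 : th h @[h --> 0^'] --> (0 : R).
  apply/norm_cvg0P.
  apply: (@squeeze_cvgr _ _ _ _ (fun=> 0) (fun h : R => `|h * c|)).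
  - by near=> h; rewrite normr_ge0 /=; case: (Hth h).
  - exact: cvg_cst.
  - rewrite -[X in _ --> X](@normr0 _ R); apply: cvg_norm.
    by rewrite -[X in _ --> X](mul0r c); apply: cvgMr_tmp; exact/cvg_within.
have lim1 : (c * 'D_e f (x + h *: w + th h *: e)) @[h --> 0^'] --> c * 'D_e f x.
  apply: cvgMl_tmp.
  have L : x + h *: w + th h *: e @[h --> 0^'] --> x + 0 *: w + 0 *: e.
    apply: cvgD; last by apply: cvgZr_tmp.
    apply: cvgD; first exact: cvg_cst.
    by apply: cvgZr_tmp; exact/cvg_within.
  rewrite !scale0r !addr0 in L.
  exact: cvg_comp L (ce x).
have L : h^-1 *: ((f \o shift x) (h *: (w + c *: e)) - f x) @[h --> 0^'] -->
    'D_w f x + c * 'D_e f x.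
  apply: cvg_trans; last exact: (cvgD dw lim1).
  apply: near_eq_cvg; near=> h => /=.
  have h0 : h != 0 by near: h; exact: nbhs_dnbhs_neq.
  have [_ E] := Hth h.
  have -> : h *: (w + c *: e) + x = x + h *: w + (h * c) *: e.
    by rewrite scalerDr scalerA addrC addrA.
  rewrite -[f (x + h *: w + _)](subrK (f (x + h *: w))) E -addrA scalerDr.
  rewrite [LHS]addrC [h *: w + x]addrC; congr (_ + _).
  by rewrite -[RHS]/(h^-1 * _) -!mulrA mulKf.
by apply: DeriveDef; [apply/cvg_ex; eexists; exact: L|exact: cvg_lim L].
Unshelve. all: by end_near. Qed.

Lemma derivable_shift f x w v : derivable f (x + v) w ->
  is_derive x w (fun y => f (y + v)) ('D_w f (x + v)).
Proof.
move=> df; have E : (fun h : R => h^-1 *: (((fun y => f (y + v)) \o shift x) (h *: w)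
    - f (x + v))) =
  (fun h : R => h^-1 *: ((f \o shift (x + v)) (h *: w) - f (x + v))).
  by apply/funext => h /=; rewrite addrA.
by apply: DeriveDef; rewrite /derivable /derive E.
Qed.

(** The mixed difference is symmetric in e1 and e2, while the right-hand side
    is the derivative along e1 first; this is what makes derivatives commute. *)
Lemma second_difference f e1 e2 : (forall x, derivable f x e1) ->
  (forall x, derivable ('D_e1 f) x e2) -> forall x (h : R),
  exists th : R * R, [/\ `|th.1| <= `|h|, `|th.2| <= `|h| &
    f (x + h *: e1 + h *: e2) - f (x + h *: e1) - (f (x + h *: e2) - f x) =
    h * h * 'D_e2 ('D_e1 f) (x + th.1 *: e1 + th.2 *: e2)].
Proof.
move=> d1 d2 x h.
pose phi y := f (y + h *: e2) - f y.
have dphi y : is_derive y e1 phi ('D_e1 f (y + h *: e2) - 'D_e1 f y).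
  by apply: is_deriveB; [exact: derivable_shift|exact: derivableP].
have [a [ha Ea]] := line_MVT (fun y => @ex_derive _ _ _ _ _ _ _ (dphi y)) x h.
have [b [hb Eb]] := line_MVT d2 (x + a *: e1) h.
exists (a, b); split => //=.
rewrite -/(phi (x + h *: e1)) -/(phi x) Ea.
by rewrite (@derive_val _ _ _ _ _ _ _ (dphi _)) Eb mulrA.
Qed.

(** The mixed difference quotient at [x] equals both mixed second derivatives
    at nearby points, so continuity of the latter makes them agree at [x]. *)
Lemma derive_comm f e1 e2 :
  (forall x, derivable f x e1) -> (forall x, derivable f x e2) ->
  (forall x, derivable ('D_e1 f) x e2) -> (forall x, derivable ('D_e2 f) x e1) ->
  continuous ('D_e2 ('D_e1 f)) -> continuous ('D_e1 ('D_e2 f)) ->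
  'D_e2 ('D_e1 f) = 'D_e1 ('D_e2 f).
Proof.
move=> d1 d2 d12 d21 c12 c21; apply/funext => x.
have lim0 (th : R -> R) : (forall h, `|th h| <= `|h|) -> th h @[h --> 0^'] --> (0 : R).
  move=> thh; apply/norm_cvg0P.
  apply: (@squeeze_cvgr _ _ _ _ (fun=> 0) (fun h : R => `|h|)).
  - by near=> h; rewrite normr_ge0 /=.
  - exact: cvg_cst.
  - by rewrite -[X in _ --> X](@normr0 _ R); apply: cvg_norm; exact/cvg_within.
have limx (F : V -> R) u v (a b : R -> R) : continuous F -> (forall h, `|a h| <= `|h|) ->
    (forall h, `|b h| <= `|h|) ->
    F (x + a h *: u + b h *: v) @[h --> 0^'] --> F x.
  move=> cF ha hb.
  have L : x + a h *: u + b h *: v @[h --> 0^'] --> x + 0 *: u + 0 *: v.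
    apply: cvgD; last by apply: cvgZr_tmp; exact: lim0.
    apply: cvgD; first exact: cvg_cst.
    by apply: cvgZr_tmp; exact: lim0.
  rewrite !scale0r !addr0 in L.
  exact: cvg_comp L (cF x).
have /choice[a Ha] := second_difference d1 d12 x.
have /choice[b Hb] := second_difference d2 d21 x.
have L1 : 'D_e2 ('D_e1 f) (x + (a h).1 *: e1 + (a h).2 *: e2) @[h --> 0^'] --> 'D_e2 ('D_e1 f) x.
  have [a1 a2] : (forall h, `|(a h).1| <= `|h|) /\ (forall h, `|(a h).2| <= `|h|).
    by split=> h; case: (Ha h).
  exact: (limx _ e1 e2 _ _ c12 a1 a2).
have L2 : 'D_e1 ('D_e2 f) (x + (b h).1 *: e2 + (b h).2 *: e1) @[h --> 0^'] --> 'D_e1 ('D_e2 f) x.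
  have [b1 b2] : (forall h, `|(b h).1| <= `|h|) /\ (forall h, `|(b h).2| <= `|h|).
    by split=> h; case: (Hb h).
  exact: (limx _ e2 e1 _ _ c21 b1 b2).
apply: (cvg_unique (@Rhausdorff R) L1).
apply: cvg_trans L2; apply: near_eq_cvg; near=> h.
have h0 : h != 0 by near: h; exact: nbhs_dnbhs_neq.
(* both values are the mixed difference divided by h * h *)
have [_ _ E1] := Ha h; have [_ _ E2] := Hb h.
have : h * h != 0 by rewrite mulf_neq0.
move=> /mulfI; apply; apply: (etrans (esym E2)); apply: etrans E1.
rewrite [x + h *: e2 + _]addrAC.
by rewrite !opprB addrACA [RHS]addrACA [- _ - _ in LHS]addrC.
Unshelve. all: by end_near. Qed.

End line_derivatives.

Section smooth_functions.
Context {R : realType} {m : nat}.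
Implicit Types (f g : 'rV[R]_m -> R) (x w : 'rV[R]_m) (n : nat).

Lemma rV_continuousD f g : continuous f -> continuous g ->
  continuous (fun x => f x + g x).
Proof. by move=> cf cg x; exact: (@cvgD R _ _ (nbhs x) _ f g _ _ (cf x) (cg x)). Qed.

Lemma rV_continuousM f g : continuous f -> continuous g ->
  continuous (fun x => f x * g x).
Proof. by move=> cf cg x; exact: (@cvgM R _ (nbhs x) _ f g _ _ (cf x) (cg x)). Qed.

Lemma rV_continuousV f : (forall x, f x != 0) -> continuous f ->
  continuous (fun x => (f x)^-1).
Proof. by move=> f0 cf x; exact: (@cvgV R _ (nbhs x) _ f _ (f0 x) (cf x)). Qed.

Lemma rV_continuous_norm f : continuous f -> continuous (fun x => `|f x|).
Proof. by move=> cf x; exact: (@cvg_norm R _ _ (nbhs x) _ f _ (cf x)). Qed.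

(** Unlike the quantification over all sequences of partial derivatives in [smooth], this recursive
    form allows induction on the order of differentiability. *)
Fixpoint Ck n f : Prop := continuous f /\
  if n is n'.+1 then forall i : 'I_m,
    (forall x, derivable f x (delta_mx ord0 i)) /\ Ck n' (partial i f)
  else True.

Lemma Ck_continuous n f : Ck n f -> continuous f.
Proof. by case: n => [|n] []. Qed.

Lemma Ck_derivable n f : Ck n.+1 f -> forall i x, derivable f x (delta_mx ord0 i).
Proof. by case=> _ H i; case: (H i). Qed.

Arguments Ck_derivable [n f] _ i x.

Lemma Ck_partial n f : Ck n.+1 f -> forall i, Ck n (partial i f).
Proof. by case=> _ H i; case: (H i). Qed.

Lemma Ck_succ n f : Ck n.+1 f -> Ck n f.
Proof.
elim: n f => [|n IH] f [cf Hf]; first by split.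
by split=> // i; have [df pf] := Hf i; split=> //; exact: IH.
Qed.

Lemma smooth_partial i f : smooth f -> smooth (partial i f).
Proof. by move=> sf s; have := sf (rcons s i); rewrite foldr_rcons. Qed.

Lemma smooth_continuous f : smooth f -> continuous f.
Proof. by move=> /(_ [::]) []. Qed.

Lemma smooth_derivable f : smooth f -> forall i x, derivable f x (delta_mx ord0 i).
Proof. by move=> /(_ [::]) []. Qed.

Arguments smooth_derivable [f] _ i x.

Lemma smoothP f : smooth f <-> forall n, Ck n f.
Proof.
split=> [sf n|].
  elim: n f sf => [|n IH] f sf; first by split=> //; exact: smooth_continuous.
  split=> [|i]; first exact: smooth_continuous.
  by split=> [x|]; [exact: smooth_derivable|apply: IH; exact: smooth_partial].
move=> Cf s; elim/last_ind: s f Cf => [|s i IH] f Cf.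
  by split; [exact: Ck_continuous (Cf 0%N)|exact: Ck_derivable (Cf 1%N)].
by rewrite foldr_rcons; apply: IH => n; exact: Ck_partial (Cf n.+1) i.
Qed.

Lemma Ck_cst n (c : R) : Ck n (fun=> c).
Proof.
elim: n c => [|n IH] c; split=> //; try exact: cst_continuous.
move=> i; split=> [x|]; first exact: derivable_cst.
rewrite (_ : partial i _ = fun=> 0)//.
by apply/funext => x; rewrite /partial derive_cst.
Qed.

Lemma CkD n f g : Ck n f -> Ck n g -> Ck n (fun x => f x + g x).
Proof.
elim: n f g => [|n IH] f g Cf Cg.
  by split; [exact: (rV_continuousD (proj1 Cf) (proj1 Cg))|].
split; [exact: (rV_continuousD (proj1 Cf) (proj1 Cg))|move=> i].
have df := Ck_derivable Cf i; have dg := Ck_derivable Cg i.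
split=> [x|]; first exact: (derivableD (df x) (dg x)).
rewrite (_ : partial i _ = fun x => partial i f x + partial i g x).
  exact: (IH _ _ (Ck_partial Cf i) (Ck_partial Cg i)).
by apply/funext => x; rewrite /partial (deriveD (df x) (dg x)).
Qed.

Lemma CkM n f g : Ck n f -> Ck n g -> Ck n (fun x => f x * g x).
Proof.
elim: n f g => [|n IH] f g Cf Cg.
  by split; [exact: (rV_continuousM (proj1 Cf) (proj1 Cg))|].
split; [exact: (rV_continuousM (proj1 Cf) (proj1 Cg))|move=> i].
have df := Ck_derivable Cf i; have dg := Ck_derivable Cg i.
split=> [x|]; first exact: (derivableM (df x) (dg x)).
rewrite (_ : partial i _ = fun x => f x * partial i g x + g x * partial i f x).
  exact: (CkD (IH _ _ (Ck_succ Cf) (Ck_partial Cg i)) (IH _ _ (Ck_succ Cg) (Ck_partial Cf i))).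
by apply/funext => x; rewrite /partial (deriveM (df x) (dg x)).
Qed.

Lemma CkV n f : (forall x, f x != 0) -> Ck n f -> Ck n (fun x => (f x)^-1).
Proof.
move=> f0; elim: n => [|n IH] Cf.
  by split; [exact: (rV_continuousV f0 (proj1 Cf))|].
split; [exact: (rV_continuousV f0 (proj1 Cf))|move=> i].
have df := Ck_derivable Cf i.
split=> [x|]; first exact: (derivableV (f0 x) (df x)).
have CV := IH (Ck_succ Cf).
rewrite (_ : partial i _ = fun x => -1 * ((f x)^-1 * (f x)^-1 * partial i f x)).
  exact: (CkM (Ck_cst n (-1)) (CkM (CkM CV CV) (Ck_partial Cf i))).
apply/funext => x; rewrite /partial (deriveV (f0 x) (df x)) expr2 invfM.
by rewrite -[LHS]/(- _ * _) mulN1r mulNr.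
Qed.

#[local] Opaque smooth.

Lemma smooth_cst (c : R) : smooth (fun _ : 'rV[R]_m => c).
Proof. by apply/smoothP => n; exact: Ck_cst. Qed.

Lemma smoothD f g : smooth f -> smooth g -> smooth (fun x => f x + g x).
Proof. by move=> /smoothP sf /smoothP sg; apply/smoothP => n; exact: CkD. Qed.

Lemma smoothM f g : smooth f -> smooth g -> smooth (fun x => f x * g x).
Proof. by move=> /smoothP sf /smoothP sg; apply/smoothP => n; exact: CkM. Qed.

Lemma smoothV f : (forall x, f x != 0) -> smooth f -> smooth (fun x => (f x)^-1).
Proof. by move=> f0 /smoothP sf; apply/smoothP => n; exact: CkV. Qed.

Lemma smooth_sum (I : Type) (r : seq I) (P : pred I) (F : I -> 'rV[R]_m -> R) :
  (forall i, smooth (F i)) -> smooth (fun x => \sum_(i <- r | P i) F i x).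
Proof.
move=> sF; elim: r => [|i r IH].
  by under eq_fun do rewrite big_nil; exact: smooth_cst.
under eq_fun do rewrite big_cons.
by case: (P i); [exact: (smoothD (sF i) IH)|exact: IH].
Qed.

Lemma smooth_prod (I : Type) (r : seq I) (P : pred I) (F : I -> 'rV[R]_m -> R) :
  (forall i, smooth (F i)) -> smooth (fun x => \prod_(i <- r | P i) F i x).
Proof.
move=> sF; elim: r => [|i r IH].
  by under eq_fun do rewrite big_nil; exact: smooth_cst.
under eq_fun do rewrite big_cons.
by case: (P i); [exact: (smoothM (sF i) IH)|exact: IH].
Qed.

(** The derivative along w is obtained by adding the coordinate directions to it one at a time. *)
Lemma smooth_is_derive f x w : smooth f ->
  is_derive x w f (\sum_i w ord0 i * partial i f x).
Proof.
move=> sf; rewrite {1}(row_sum_delta w).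
elim: (index_enum _) => [|i s IH].
  by rewrite !big_nil; exact: is_derive0.
rewrite !big_cons addrC [X in is_derive _ _ _ X]addrC -(@derive_val _ _ _ _ _ _ _ IH).
apply: is_derive_addv; [exact: smooth_derivable|exact: smooth_continuous (smooth_partial i sf)|].
exact: ex_derive.
Qed.

Lemma smooth_derivable_dir f x w : smooth f -> derivable f x w.
Proof. by move=> sf; have [] := smooth_is_derive x w sf. Qed.

Lemma derive_dirE f w : smooth f ->
  'D_w f = fun x => \sum_i w ord0 i * partial i f x.
Proof. by move=> sf; apply/funext => x; have [_] := smooth_is_derive x w sf. Qed.

Lemma smooth_foldr s f : smooth f -> smooth (foldr partial f s).
Proof. by move=> sf; elim: s => [//|i s IH]; exact: (smooth_partial i IH). Qed.

Lemma partialC i j f : smooth f ->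
  partial i (partial j f) = partial j (partial i f).
Proof.
move=> sf; have sp k := smooth_partial k sf.
exact: (derive_comm (smooth_derivable sf j) (smooth_derivable sf i)
  (smooth_derivable (sp j) i) (smooth_derivable (sp i) j)
  (smooth_continuous (smooth_partial i (sp j)))
  (smooth_continuous (smooth_partial j (sp i)))).
Qed.

Lemma partial_foldr i s f : smooth f ->
  partial i (foldr partial f s) = foldr partial (partial i f) s.
Proof.
move=> sf; elim: s => [//|j s IH].
by rewrite [foldr _ _ _]/= [RHS]/= (partialC _ _ (smooth_foldr s sf)) IH.
Qed.

Lemma foldr_partial_perm s t f : smooth f -> perm_eq s t ->
  foldr partial f s = foldr partial f t.
Proof.
move=> sf; elim: s t => [|i s IH] t; first by rewrite perm_sym => /perm_nilP ->.
move=> st; have it : i \in t by rewrite -(perm_mem st) mem_head.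
case/splitPr: it st => t1 t2; rewrite perm_sym -cat1s perm_catCA /= perm_cons perm_sym => st.
rewrite foldr_cat [foldr partial f (i :: t2)]/= [LHS]/=.
by rewrite -(partial_foldr i t1 (smooth_foldr t2 sf)) (IH _ st) foldr_cat.
Qed.

(** Partial derivatives commute, so that only the number of occurrences of each index matters. *)
Lemma mpartial_count s f : smooth f ->
  mpartial (fun i => count_mem i s) f = foldr partial f s.
Proof.
move=> sf.
have -> : mpartial (fun i => count_mem i s) f =
    foldr partial f (flatten [seq nseq (count_mem i s) i | i <- enum 'I_m]).
  rewrite /mpartial; elim: (enum 'I_m) => //= i r ->.
  rewrite foldr_cat; elim: (count_mem i s) => //= n <-.
  by [].
apply: foldr_partial_perm => //.
apply/allP => j _ /=; apply/eqP; rewrite count_flatten -map_comp.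
rewrite sumnE big_map big_enum /= (bigD1 j)//= count_nseq /= eqxx mul1n.
by rewrite big1 ?addn0// => i ij; rewrite count_nseq /= (negbTE ij) mul0n.
Qed.

(** Derivatives preserve vanishing off a closed set, because they are local.  This replaces the
    support, which would require a closure. *)
Definition vanishes_off (Z : set 'rV[R]_m) f := forall x, ~ Z x -> f x = 0.

Lemma vanishes_off_derive Z f w : closed Z ->
  vanishes_off Z f -> vanishes_off Z ('D_w f).
Proof.
move=> cZ Zf x Zx.
have oZ : open (~` Z) by exact: closed_openC.
have -> : 'D_w f x = 'D_w (fun=> 0 : R) x.
  apply: near_eq_derive; near=> y; apply: Zf.
  by near: y; exact: open_nbhs_nbhs.
exact: derive_cst.
Unshelve. all: by end_near. Qed.

Lemma vanishes_off_foldr Z f s : closed Z ->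
  vanishes_off Z f -> vanishes_off Z (foldr partial f s).
Proof. by move=> cZ Zf; elim: s => //= i s; exact: vanishes_off_derive. Qed.

(** Bounded derivatives make the remainder of the Euler-Maclaurin formula uniform in the base
    point. *)
Definition bounded_smooth f := smooth f /\
  forall s, exists M : R, forall x, `|foldr partial f s x| <= M.

Lemma bounded_smooth_compact Z f : compact Z -> closed Z -> vanishes_off Z f -> smooth f ->
  bounded_smooth f.
Proof.
move=> cZ clZ Zf sf; split=> // s; set g := foldr partial f s.
have cg : continuous g := smooth_continuous (smooth_foldr s sf).
have Zg : vanishes_off Z g.
  exact: vanishes_off_foldr.
have [Z0|/nonemptyPn Z0] := pselect (Z !=set0); last first.
  by exists 0 => x; rewrite Zg ?normr0 ?Z0.
have cng : {within Z, continuous (fun x => `|g x|)}.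
  by apply: continuous_subspaceT; exact: rV_continuous_norm cg.
have [c _ Hc] := EVT_max_rV Z0 cZ cng.
exists `|g c| => x; have [Zx|Zx] := pselect (Z x).
  by apply: Hc; exact/mem_set.
by rewrite Zg ?normr0.
Qed.

Lemma bounded_smooth_bound f : bounded_smooth f ->
  exists M : R, forall x, `|f x| <= M.
Proof. by case=> _ /(_ [::]). Qed.

Lemma bounded_smooth_partial i f : bounded_smooth f -> bounded_smooth (partial i f).
Proof.
move=> [sf bf]; split; first exact: (smooth_partial i sf).
by move=> s; have := bf (rcons s i); rewrite foldr_rcons.
Qed.

Lemma foldr_partialD s f g : smooth f -> smooth g ->
  foldr partial (fun x => f x + g x) s =
  fun x => foldr partial f s x + foldr partial g s x.
Proof.
move=> sf sg; elim: s => //= i s ->; apply/funext => x.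
have ds h : smooth h -> derivable (foldr partial h s) x (delta_mx ord0 i).
  by move=> sh; exact: (smooth_derivable (smooth_foldr s sh)).
by rewrite /partial (deriveD (ds f sf) (ds g sg)).
Qed.

Lemma foldr_partialZ s f (c : R) : smooth f ->
  foldr partial (fun x => c * f x) s = fun x => c * foldr partial f s x.
Proof.
move=> sf; elim: s => //= i s ->; apply/funext => x.
rewrite /partial (_ : (fun x => _) = c \*: foldr partial f s)//.
by rewrite (deriveZ _ (smooth_derivable (smooth_foldr s sf) _ _)).
Qed.

Lemma bounded_smoothD f g : bounded_smooth f -> bounded_smooth g ->
  bounded_smooth (fun x => f x + g x).
Proof.
move=> [sf bf] [sg bg]; split; first exact: (smoothD sf sg).
move=> s; have [M HM] := bf s; have [N HN] := bg s; exists (M + N) => x.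
by rewrite foldr_partialD//; apply: le_trans (ler_normD _ _) _; exact: lerD.
Qed.

Lemma bounded_smoothZ f (c : R) : bounded_smooth f ->
  bounded_smooth (fun x => c * f x).
Proof.
move=> [sf bf]; split; first exact: (smoothM (smooth_cst c) sf).
move=> s; have [M HM] := bf s; exists (`|c| * M) => x.
by rewrite foldr_partialZ// normrM ler_wpM2l.
Qed.

Lemma bounded_smooth0 : bounded_smooth (fun=> 0).
Proof.
apply: (@bounded_smooth_compact set0) => //; [exact: compact0|exact: closed0|exact: smooth_cst].
Qed.

Lemma bounded_smooth_sum (I : Type) (r : seq I) (F : I -> 'rV[R]_m -> R) :
  (forall i, bounded_smooth (F i)) -> bounded_smooth (fun x => \sum_(i <- r) F i x).
Proof.
move=> sF; elim: r => [|i r IH].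
  by under eq_fun do rewrite big_nil; exact: bounded_smooth0.
by under eq_fun do rewrite big_cons; exact: bounded_smoothD.
Qed.

Lemma bounded_smooth_derive f w : bounded_smooth f -> bounded_smooth ('D_w f).
Proof.
move=> bf; rewrite derive_dirE; last by case: bf.
by apply: bounded_smooth_sum => i; apply: bounded_smoothZ; exact: bounded_smooth_partial.
Qed.

End smooth_functions.

Arguments Ck_derivable {R m} [n f] _ i x.
Arguments smooth_derivable {R m} [f] _ i x.
Arguments smooth_derivable_dir {R m} [f] x w _.

(** * Linear differential operators *)

Section differential_operators.
Context {R : realType} {m : nat}.
Implicit Types (f g : 'rV[R]_m -> R) (D : ('rV[R]_m -> R) -> 'rV[R]_m -> R).

(** Finite sums of smooth multiples of iterated partial derivatives, without a normal form on the
    multi-indices: closure under sums and derivatives is then immediate, and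
    [diffop_differential_operator] collects the terms at the end. *)
Definition diffop D := exists (I : finType) (a : I -> 'rV[R]_m -> R)
    (s : I -> seq 'I_m),
  (forall i, smooth (a i)) /\
  forall f, smooth f -> D f = fun x => \sum_i a i x * foldr partial f (s i) x.

Lemma diffop_smooth D f : diffop D -> smooth f -> smooth (D f).
Proof.
move=> [I [a [s [sa DE]]]] sf; rewrite (DE f sf); apply: smooth_sum => i.
exact: (smoothM (sa i) (smooth_foldr (s i) sf)).
Qed.

Lemma diffop_mull g : smooth g -> diffop (fun f x => g x * f x).
Proof.
move=> sg; exists unit, (fun=> g), (fun=> [::]); split=> // f sf.
by apply/funext => x; rewrite big_const card_unit /= addr0.
Qed.

Lemma diffop0 : diffop (fun _ _ => 0).
Proof.
exists void, (of_void _), (of_void _).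
split=> [[]|f _]; apply/funext => x.
by rewrite big_pred0 // => -[].
Qed.

Lemma diffopD D1 D2 : diffop D1 -> diffop D2 ->
  diffop (fun f x => D1 f x + D2 f x).
Proof.
move=> [I [a [s [sa DE]]]] [J [b [t [sb EE]]]].
exists (I + J)%type, (fun k => match k with inl i => a i | inr j => b j end),
  (fun k => match k with inl i => s i | inr j => t j end).
split=> [[]//|f sf]; rewrite (DE f sf) (EE f sf).
by apply/funext => x; rewrite big_sumType.
Qed.

Lemma diffop_sum (I : Type) (r : seq I) (P : pred I)
    (D : I -> ('rV[R]_m -> R) -> 'rV[R]_m -> R) : (forall i, diffop (D i)) ->
  diffop (fun f x => \sum_(i <- r | P i) D i f x).
Proof.
move=> dD; elim: r => [|i r IH].
  rewrite (_ : (fun f x => _) = fun _ _ => 0); first exact: diffop0.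
  by apply/funext => f; apply/funext => x; rewrite big_nil.
rewrite (_ : (fun f x => _) = fun f x => (if P i then D i f x else 0) +
    \sum_(i <- r | P i) D i f x); last first.
  apply/funext => f; apply/funext => x; rewrite big_cons.
  by case: ifP => // _; rewrite add0r.
by case: (P i); [exact: (diffopD (dD i) IH)|exact: (diffopD diffop0 IH)].
Qed.

Lemma diffopZ D (c : R) : diffop D -> diffop (fun f x => c * D f x).
Proof.
move=> [I [a [s [sa DE]]]]; exists I, (fun i x => c * a i x), s.
split=> [i|f sf]; first exact: (smoothM (smooth_cst c) (sa i)).
rewrite (DE f sf); apply/funext => x; rewrite mulr_sumr.
by apply: eq_bigr => i _; rewrite mulrA.
Qed.

(** Leibniz's rule: each term a * d_s f produces one term where d_s f is differentiated and one
    where a is. *)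
Lemma diffop_partial D i : diffop D -> diffop (fun f => partial i (D f)).
Proof.
move=> [I [a [s [sa DE]]]].
exists (I + I)%type, (fun k => match k with inl k => a k | inr k => partial i (a k) end),
  (fun k => match k with inl k => i :: s k | inr k => s k end).
split=> [[k|k]|f sf]; [exact: sa|exact: (smooth_partial i (sa k))|].
rewrite (DE f sf); apply/funext => x; rewrite big_sumType [RHS]/= -big_split [RHS]/=.
have dF k : is_derive x (delta_mx ord0 i) (fun x => a k x * foldr partial f (s k) x)
    (a k x * partial i (foldr partial f (s k)) x +
     foldr partial f (s k) x * partial i (a k) x).
  have da := smooth_derivable (sa k) i x.
  have ds := smooth_derivable (smooth_foldr (s k) sf) i x.
  by have := is_deriveM (derivableP da) (derivableP ds).
transitivity (\sum_k (a k x * partial i (foldr partial f (s k)) x +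
     foldr partial f (s k) x * partial i (a k) x)); last first.
  by apply: eq_bigr => k _; rewrite [_ * partial i (a k) x]mulrC.
apply: (@derive_val _ _ _ _ _ _ _ _).
elim: (index_enum I) => [|k r IH].
  under eq_fun do rewrite big_nil.
  by rewrite big_nil; exact: is_derive_cst.
under eq_fun do rewrite big_cons.
rewrite big_cons.
exact: (is_deriveD (dF k) IH).
Qed.

Lemma diffop_derive D w : diffop D -> diffop (fun f => 'D_w (D f)).
Proof.
move=> dD; have [I [a [s [sa DE]]]] : diffop (fun f x => \sum_i w ord0 i * partial i (D f) x).
  by apply: diffop_sum => i; apply: diffopZ; exact: diffop_partial.
exists I, a, s; split=> // f sf.
by rewrite -(DE f sf) (derive_dirE w (diffop_smooth dD sf)).
Qed.

Lemma sum_count_mem (s : seq 'I_m) : (\sum_j count_mem j s)%N = size s.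
Proof.
elim: s => [|i s IH] /=; first by rewrite big1.
rewrite big_split /= IH (bigD1 i)//= eqxx big1 ?addn0//.
by move=> j ji; rewrite eq_sym (negbTE ji).
Qed.

Lemma diffop_differential_operator D : diffop D -> differential_operator D.
Proof.
move=> [I [a [s [sa DE]]]]; pose k := (\max_i size (s i))%N.
have sk i : (size (s i) <= k)%N by exact: (leq_bigmax i).
pose b i : {ffun 'I_m -> 'I_k.+1} := [ffun j => inord (count_mem j (s i))].
have bE i j : b i j = count_mem j (s i) :> nat.
  by rewrite ffunE inordK// ltnS (leq_trans (count_size _ _)).
exists k, (fun c x => \sum_(i | b i == c) a i x); split.
  by move=> c; exact: smooth_sum.
move=> f sf x; rewrite (DE f sf).
rewrite (partition_big b (fun c => \sum_i c i <= k)%N) /=; last first.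
  move=> i _; under eq_bigr do rewrite bE.
  by rewrite sum_count_mem.
apply: eq_bigr => c _; rewrite mulr_suml; apply: eq_bigr => i /eqP <-.
congr (_ * _); rewrite -(mpartial_count (s i) sf).
by congr (mpartial _ _ _); apply/funext => j; rewrite bE.
Qed.

End differential_operators.

(** * The flat function exp(-1/t) *)

Section flat_function.
Context {R : realType}.

(** The family t^-k exp(-1/t), t > 0, is closed under differentiation up to linear combinations
    ([flat_is_derive]); this yields the smoothness of exp(-1/t) by induction. *)
Definition flat (k : nat) (t : R) : R :=
  if 0 < t then t^-1 ^+ k * expR (- t^-1) else 0.

Lemma flat_gt0 k t : 0 < t -> 0 < flat k t.
Proof. by move=> t0; rewrite /flat t0 mulr_gt0 ?expR_gt0// exprn_gt0 ?invr_gt0. Qed.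

Lemma flat_le0 k t : t <= 0 -> flat k t = 0.
Proof. by move=> t0; rewrite /flat ltNge t0. Qed.

Lemma flat_ge0 k t : 0 <= flat k t.
Proof. by case: (ltP 0 t) => t0; [exact/ltW/flat_gt0|rewrite flat_le0]. Qed.

(** From x^(k+1) / (k+1)! <= exp(x) at x = 1/t.  The case of k+1 bounds the
    difference quotient of [flat k] at 0. *)
Lemma flat_bound k t : flat k t <= k.+1`!%:R * `|t|.
Proof.
case: (ltP 0 t) => t0; last by rewrite flat_le0// mulr_ge0.
rewrite /flat t0 gtr0_norm// expRN ler_pdivrMr ?expR_gt0//.
have t1 : 0 < t^-1 by rewrite invr_gt0.
have := expR_ge1Dxn k (ltW t1).
have F0 : 0 < k.+1`!%:R :> R by rewrite ltr0n fact_gt0.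
move=> /(le_trans _) H.
have {}H : t^-1 ^+ k.+1 / k.+1`!%:R <= expR t^-1 by apply: H; rewrite lerDr.
rewrite ler_pdivrMr// mulrC in H.
rewrite -(ler_pM2l t1) -exprS (_ : t^-1 * _ = k.+1`!%:R * expR t^-1)//.
by field; rewrite gt_eqF.
Qed.

Lemma flat_is_derive k (t : R) :
  is_derive t 1 (flat k) (flat k.+2 t - k%:R * flat k.+1 t).
Proof.
have [t0|t0|t0] := ltrgt0P t.
- have tn0 : t != 0 by rewrite gt_eqF.
  have nt : \near t, t^-1 ^+ k * expR (- t^-1) = flat k t.
    near=> s; rewrite /flat ifT//; near: s; exact: lt_nbhsr.
  apply: (near_eq_is_derive nt).
  have dV : is_derive t 1 (fun y : R => y^-1) (- t ^- 2).
    have := @is_deriveV _ id t 1 1 tn0 (is_derive_id _ _).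
    by rewrite [_ *: _]mulr1.
  have dX := is_deriveX k dV.
  have dexp (y : R) : is_derive y 1 expR (expR y : R).
    by apply: DeriveDef; [exact: derivable_expR|exact: (congr1 (fun g => g y) (@derive_expR R))].
  have dE := @is_derive1_comp _ expR (fun y => - y^-1) t _ _ (dexp _) (is_deriveN dV).
  have := is_deriveM dX dE.
  congr (is_derive _ _ _ _).
    by rewrite exprfctE.
  rewrite /flat t0 exprfctE /= -[_ *: (- _)]/(_ * _) -![_ *: _]/(_ * _) opprK -!exprVn.
  set y := t^-1; set E := expR _.
  case: k {nt dX} => [|k] /=; rewrite ?exprS ?expr0 ?expr1; by ring.
- have nt : \near t, 0 = flat k t.
    near=> s; rewrite flat_le0// ltW//; near: s; exact: lt_nbhsl.
  apply: (near_eq_is_derive nt).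
  rewrite !flat_le0 ?ltW// mulr0 subr0.
  exact: is_derive_cst.
- rewrite t0 !flat_le0// mulr0 subr0.
  have L : h^-1 *: ((flat k \o shift 0) (h *: 1) - flat k 0) @[h --> 0^'] --> (0 : R).
    apply/norm_cvg0P.
    apply: (@squeeze_cvgr _ _ _ _ (fun=> 0) (fun h : R => k.+2`!%:R * `|h|)).
    - near=> h; rewrite normr_ge0 /= addr0 [flat k 0]flat_le0// subr0 [h *: 1]mulr1.
      apply: le_trans (flat_bound k.+1 h).
      case: (ltP 0 h) => h0; last by rewrite !flat_le0// scaler0 normr0.
      rewrite /flat h0 -[_ *: _]/(_ * _) mulrA -exprS ger0_norm//.
      by rewrite mulr_ge0 ?expR_ge0// exprn_ge0// invr_ge0 ltW.
    - exact: cvg_cst.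
    - rewrite -[X in _ --> X](_ : k.+2`!%:R * `|0 : R| = 0); last by rewrite normr0 mulr0.
      by apply: cvgMl_tmp; apply: cvg_norm; exact/cvg_within.
  by apply: DeriveDef; [apply/cvg_ex; eexists; exact: L|exact: (cvg_lim (@Rhausdorff R) L)].
Unshelve. all: by end_near. Qed.

Context {m : nat}.

Definition affine (a : 'I_m -> R) (b : R) (x : 'rV[R]_m) := \sum_i x ord0 i * a i + b.

Lemma affine_line a b x i (s : R) :
  affine a b (s *: delta_mx ord0 i + x) = s * a i + affine a b x.
Proof.
rewrite /affine addrA; congr (_ + _).
under eq_bigr do rewrite !mxE mulrDl.
rewrite big_split /=; congr (_ + _).
rewrite (bigD1 i)//= !eqxx mulr1 big1 ?addr0// => j ji.
by rewrite (negbTE ji) mulr0 mul0r.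
Qed.

Lemma is_derive_flat_affine k a b x i :
  is_derive x (delta_mx ord0 i) (fun x => flat k (affine a b x))
    (a i * (flat k.+2 (affine a b x) - k%:R * flat k.+1 (affine a b x))).
Proof.
set l := affine a b x.
have d1 : is_derive (0 : R) 1 (fun h : R => h * a i + l) (a i).
  have := is_deriveD (is_deriveM (is_derive_id (0 : R) 1) (is_derive_cst (a i) (0 : R) 1))
    (is_derive_cst l (0 : R) 1).
  by rewrite scaler0 add0r addr0 [_ *: 1]mulr1.
have : is_derive (0 : R) 1 (flat k \o (fun h : R => h * a i + l))
   ((flat k.+2 l - k%:R * flat k.+1 l) * a i).
  apply: is_derive1_comp; rewrite mul0r add0r; exact: flat_is_derive.
have -> : flat k \o (fun h : R => h * a i + l) =
    (fun h : R => flat k (affine a b (h *: delta_mx ord0 i + x))).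
  by apply/funext => h /=; rewrite affine_line.
by rewrite mulrC; exact: is_derive_from_line.
Qed.

Lemma continuous_affine a b : continuous (affine a b).
Proof.
rewrite /affine; apply: (@rV_continuousD _ _ (fun x => \sum_i x ord0 i * a i) (fun=> b)); last exact: cst_continuous.
elim: (index_enum _) => [|i s IH].
  by under eq_fun do rewrite big_nil; exact: cst_continuous.
under eq_fun do rewrite big_cons.
apply: (@rV_continuousD _ _ (fun x => x ord0 i * a i) _ _ IH).
apply: (@rV_continuousM _ _ (fun x => x ord0 i) (fun=> a i)); last exact: cst_continuous.
exact: coord_continuous.
Qed.

Lemma continuous_flat k : continuous (flat k).
Proof.
move=> t; apply: differentiable_continuous; apply/derivable1_diffP.
exact: (@ex_derive _ _ _ _ _ _ _ (flat_is_derive k t)).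
Qed.

Lemma smooth_flat_affine k a b : smooth (fun x => flat k (affine a b x)).
Proof.
apply/smoothP => n; elim: n k => [|n IH] k.
  split=> // x; apply: (@continuous_comp _ _ _ (affine a b) (flat k)).
    exact: continuous_affine.
  exact: continuous_flat.
split.
  move=> x; apply: (@continuous_comp _ _ _ (affine a b) (flat k)).
    exact: continuous_affine.
  exact: continuous_flat.
move=> i; split.
  by move=> x; exact: (@ex_derive _ _ _ _ _ _ _ (is_derive_flat_affine k a b x i)).
rewrite (_ : partial i _ = fun x => a i * (flat k.+2 (affine a b x) + -k%:R * flat k.+1 (affine a b x))).
  exact: (CkM (Ck_cst n (a i)) (CkD (IH k.+2) (CkM (Ck_cst n (-k%:R)) (IH k.+1)))).
apply/funext => x; rewrite mulNr.
exact: (@derive_val _ _ _ _ _ _ _ (is_derive_flat_affine k a b x i)).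
Qed.

End flat_function.

(** * Fubini's theorem for Lebesgue measure on R^n *)

Section lebesgue_rV_fubini.
Context {R : realType}.
Local Notation leb := (@lebesgue_measure R).

Lemma rV_consE n (a : R) (y : 'rV[R]_n) :
  rV_cons (a, y) = row_mx (a%:M : 'rV_1) y :> 'rV_(1 + n).
Proof.
apply/rowP => k; case: (unliftP ord0 k) => [j|] ->; rewrite mxE.
  by rewrite liftK -rshift1 row_mxEr.
rewrite unlift_none; have -> : ord0 = lshift n ord0 :> 'I_(1 + n) by exact/val_inj.
by rewrite row_mxEl mxE.
Qed.

Lemma rV_cons_split n (x : 'rV[R]_n.+1) :
  x = rV_cons (x ord0 ord0, \row_j x ord0 (lift ord0 j)).
Proof.
apply/rowP => k; rewrite mxE.
by case: (unliftP ord0 k) => [j|] -> /=; rewrite ?mxE ?liftK ?unlift_none ?mxE.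
Qed.

Local Open Scope ereal_scope.

Lemma integral_rV_cons n (f : 'rV[R]_n.+1 -> \bar R) :
  measurable_fun setT f -> (forall x, 0 <= f x) ->
  \int[lebesgue_rV n.+1]_x f x =
  \int[(leb \x lebesgue_rV n)%E]_z f (rV_cons z).
Proof.
move=> mf f0.
have := @ge0_integral_pushforward _ _ (measurableTypeR R * 'rV[R]_n)%type _ R rV_cons (@measurable_rV_cons R n)
  (leb \x lebesgue_rV n)%E setT f measurableT mf (fun y _ => f0 y).
rewrite preimage_setT => <-.
apply: eq_measure_integral => [|mp A mA _]; [exact: (@measurable_rV_cons R n)|by []].
Qed.

Lemma measurable_fun_rV_cons n (f : 'rV[R]_n.+1 -> \bar R) :
  measurable_fun setT f -> measurable_fun setT (f \o rV_cons).
Proof. by move=> mf; exact: measurableT_comp mf (@measurable_rV_cons R n). Qed.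

Lemma integral_rV_cons1 n (f : 'rV[R]_n.+1 -> \bar R) :
  measurable_fun setT f -> (forall x, 0 <= f x) ->
  \int[lebesgue_rV n.+1]_x f x = \int[leb]_a \int[lebesgue_rV n]_y f (rV_cons (a, y)).
Proof.
move=> mf f0; rewrite integral_rV_cons//.
exact: (@fubini_tonelli1 _ _ (measurableTypeR R) 'rV[R]_n R leb (lebesgue_rV n) (f \o rV_cons) (measurable_fun_rV_cons mf) (fun z => f0 _)).
Qed.

Lemma integral_rV_cons2 n (f : 'rV[R]_n.+1 -> \bar R) :
  measurable_fun setT f -> (forall x, 0 <= f x) ->
  \int[lebesgue_rV n.+1]_x f x = \int[lebesgue_rV n]_y \int[leb]_a f (rV_cons (a, y)).
Proof.
move=> mf f0; rewrite integral_rV_cons//.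
exact: (@fubini_tonelli2 _ _ (measurableTypeR R) 'rV[R]_n R leb (lebesgue_rV n) (f \o rV_cons) (measurable_fun_rV_cons mf) (fun z => f0 _)).
Qed.

Lemma measurable_integral_rV_cons1 n (f : 'rV[R]_n.+1 -> \bar R) :
  measurable_fun setT f -> (forall x, 0 <= f x) ->
  measurable_fun setT (fun a => \int[lebesgue_rV n]_y f (rV_cons (a, y))).
Proof.
move=> mf f0.
exact: (@measurable_fun_fubini_tonelli_F _ _ (measurableTypeR R) 'rV[R]_n R (lebesgue_rV n) (f \o rV_cons) (measurable_fun_rV_cons mf) (fun z => f0 _)).
Qed.

Lemma measurable_integral_rV_cons2 n (f : 'rV[R]_n.+1 -> \bar R) :
  measurable_fun setT f -> (forall x, 0 <= f x) ->
  measurable_fun setT (fun y => \int[leb]_a f (rV_cons (a, y))).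
Proof.
move=> mf f0.
exact: (@measurable_fun_fubini_tonelli_G _ _ (measurableTypeR R) 'rV[R]_n R leb (f \o rV_cons) (measurable_fun_rV_cons mf) (fun z => f0 _)).
Qed.

(** The measures mapping A to its length and to |c| times the length of its inverse image agree on
    half-open intervals. *)
Lemma integral_affine1 (f : R -> \bar R) (c t : R) : c != 0%R ->
  measurable_fun setT f -> (forall x, 0 <= f x) ->
  \int[leb]_a f a = `|c|%:E * \int[leb]_a f (a * c + t)%R.
Proof.
move=> c0 mf f0.
pose phi (a : measurableTypeR R) : measurableTypeR R := (a * c + t)%R.
have mphi : measurable_fun [set: measurableTypeR R] phi.
  by apply: measurable_funD => //; exact: measurable_funM.
have := @ge0_integral_pushforward _ _ (measurableTypeR R) (measurableTypeR R) R phi mphi leb setT f measurableT mf (fun y _ => f0 y).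
rewrite preimage_setT => <-.
pose nu := measure_function_pushforward__canonical__measure_function_Measure leb mphi.
have /(_ erefl) E := @ge0_integral_mscale _ _ _ nu setT measurableT (`|c|%:nng)%R f mf (fun x _ => f0 x).
apply: etrans E; apply: eq_measure_integral => A mA _; apply: lebesgue_measure_unique => //.
move=> _ [[x y]] _ <-; rewrite /= /mscale /= /pushforward.
have [c1|c1|c1] := ltrgt0P c; last by rewrite c1 eqxx in c0.
  have -> : phi @^-1` `]x, y]%classic = `]((x - t) / c)%R, ((y - t) / c)%R]%classic.
    apply/seteqP; split => a; rewrite /phi /= !in_itv/=.
      by rewrite ltr_pdivrMr// ler_pdivlMr// ltrBlDr lerBrDr.
    by rewrite ltr_pdivrMr// ler_pdivlMr// ltrBlDr lerBrDr.
  rewrite !lebesgue_measure_itv/= !lte_fin ltr_pM2r ?invr_gt0// ltrD2r.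
  case: ifPn => _; last by rewrite mule0.
  rewrite -!EFinB -EFinM; congr EFin; by field.
have -> : phi @^-1` `]x, y]%classic = `[((y - t) / c)%R, ((x - t) / c)%R[%classic.
  apply/seteqP; split => a; rewrite /phi /= !in_itv/=.
    by rewrite ltr_ndivlMr// ler_ndivrMr// ltrBlDr lerBrDr andbC.
  by rewrite ltr_ndivlMr// ler_ndivrMr// ltrBlDr lerBrDr andbC.
rewrite !lebesgue_measure_itv/= !lte_fin ltr_nM2r ?invr_lt0// ltrD2r.
case: ifPn => _; last by rewrite mule0.
rewrite -!EFinB -EFinM; congr EFin; by field.
Qed.

End lebesgue_rV_fubini.

(** * Linear change of variables *)

Section measurable_continuous.
Context {R : realType} {n : nat}.

Let rational_cube (p : 'rV[rat]_n * nat) : set 'rV[R]_n :=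
  [set x | forall i, `|x ord0 i - ratr (p.1 ord0 i)| < p.2.+1%:R^-1].

Lemma measurable_box (A : 'I_n -> set R) : (forall i, measurable (A i)) ->
  measurable [set x : 'rV[R]_n | forall i, A i (x ord0 i)].
Proof.
move=> mA; rewrite (_ : [set _ | _] = \bigcap_(i in [set: 'I_n])
    ((fun x : 'rV[R]_n => x ord0 i) @^-1` A i)).
  apply: fin_bigcap_measurable => // i _.
  by rewrite -[X in measurable X]setTI; exact: measurable_coord.
by apply/seteqP; split => x /= H i; [move=> _|]; exact: H.
Qed.

Let measurable_rational_cube p : measurable (rational_cube p).
Proof.
apply: (@measurable_box (fun i => [set t : R | `|t - ratr (p.1 ord0 i)| < p.2.+1%:R^-1])) => i.
rewrite (_ : [set _ | _] = `](ratr (p.1 ord0 i) - p.2.+1%:R^-1), (ratr (p.1 ord0 i) + p.2.+1%:R^-1)[%classic).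
  exact: measurable_itv.
by apply/seteqP; split => t /=; rewrite in_itv /= ltr_distl.
Qed.

(** The sigma-algebra is generated by the coordinates, so an open set has to be written as a
    countable union of cubes with rational centres. *)
Lemma open_measurable_rV (O : set 'rV[R]_n) : open O -> measurable O.
Proof.
move=> oO.
pose F p := if `[< rational_cube p `<=` O >] then rational_cube p else set0.
have -> : O = \bigcup_p F p.
  apply/seteqP; split => x; last first.
    by move=> [p _]; rewrite /F; case: asboolP => // pO /pO.
  move=> Ox.
  have /nbhs_ballP[e /= e0 xeO] : nbhs x O by exact: open_nbhs_nbhs.
  have [k _ /= ke] : \forall k \near \oo, k.+1%:R^-1 < e / 2.
    by apply: (@near_infty_natSinv_lt R (PosNum _)); rewrite divr_gt0.
  have {}ke := ke k (leqnn k).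
  have /choice[q Hq] : forall i, exists q : rat, `|x ord0 i - ratr q| < k.+1%:R^-1.
    move=> i; have [|q] := @rat_in_itvoo R (x ord0 i - k.+1%:R^-1) (x ord0 i + k.+1%:R^-1).
      by rewrite ltrD2l gtrN// invr_gt0.
    by rewrite in_itv /= => qx; exists q; rewrite distrC ltr_distl.
  exists (\row_i q i, k) => //; rewrite /F.
  have xc : rational_cube (\row_i q i, k) x by move=> i; rewrite mxE.
  case: asboolP => // -[] y yc; apply: xeO; split => // i j.
  rewrite (ord1 i) /ball /=.
  have := yc j; rewrite /= mxE => yq.
  rewrite (splitr e); apply: le_lt_trans (ler_distD (ratr (q j)) _ _) _.
  apply: ltrD; first exact: lt_trans (Hq j) ke.
  by rewrite distrC; exact: lt_trans yq ke.
apply: countable_bigcupT_measurable => [|p]; first exact: countableP.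
by rewrite /F; case: ifP => // _; exact: measurable_rational_cube.
Qed.

Lemma continuous_measurable_rV (f : 'rV[R]_n -> R) : continuous f ->
  measurable_fun setT f.
Proof.
move=> /continuousP cf; apply: (measurability _ (RGenOpens.measurableE R)).
move=> _ [_ [a [b ->] <-]]; rewrite setTI; apply: open_measurable_rV.
exact/cf/interval_open.
Qed.

End measurable_continuous.

Section change_of_variables.
Context {R : realType}.
Local Notation leb := (@lebesgue_measure R).

(** Boxes are stable under intersection and generate the sigma-algebra. *)
Lemma lebesgue_rV_unique n (mu : {measure set 'rV[R]_n -> \bar R}) :
  (forall A : 'I_n -> set R, (forall i, measurable (A i)) ->
    mu [set x | forall i, A i (x ord0 i)] = (\prod_(i < n) leb (A i))%E) ->
  forall A, measurable A -> mu A = lebesgue_rV n A.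
Proof.
move=> muE.
pose box (A : 'I_n -> set R) := [set x : 'rV[R]_n | forall i, A i (x ord0 i)].
pose G := [set B | exists2 A, (forall i, measurable (A i)) & B = box A].
pose g (k : nat) := box (fun i => `](- k%:R), k%:R[%classic).
apply: (@measure_unique _ R _ G g).
- apply/seteqP; split; last first.
    apply: smallest_sub; first exact: sigma_algebra_measurable.
    by move=> _ [A mA ->]; exact: measurable_box.
  apply: smallest_sub; first exact: smallest_sigma_algebra.
  rewrite -bigcup_seq => B /= [i _ [Y mY <-]].
  apply: sub_sigma_algebra; exists (fun j => if j == i then Y else setT).
    by move=> j; case: ifP.
  rewrite setTI; apply/seteqP; split => x /=.
    by move=> Yx j; case: eqP => [->|].
  by move=> /(_ i); rewrite eqxx.
- move=> _ _ [A mA ->] [B mB ->]; exists (fun i => A i `&` B i).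
    by move=> i; exact: measurableI.
  by apply/seteqP; split => x /=; [case=> a b i; split|move=> H; split=> i; case: (H i)].
- by move=> k; exists (fun i => `](- k%:R), k%:R[%classic).
- apply/seteqP; split => // x _.
  pose M := \sum_i `|x ord0 i|.
  exists (Num.truncn M).+1 => // i /=; rewrite in_itv /= -ltr_norml.
  apply: le_lt_trans (truncnS_gt M).
  by rewrite /M (bigD1 i)//= lerDl sumr_ge0.
- by move=> _ [A mA ->]; rewrite [LHS]muE//; exact/esym/lebesgue_rV_box.
- move=> k; rewrite muE//.
  suff /fin_numPlt/andP[] : (\prod_(i < n) leb [set` `](- k%:R)%R, (k%:R)%R[])%E \is a fin_num by [].
  elim/big_ind : _ => // [x y|i _]; first exact: fin_numM.
  by rewrite lebesgue_measure_itv/=; case: ifP.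
Qed.

Lemma measurable_mulmxD n p (A : 'M[R]_(n, p)) b :
  measurable_fun setT (fun x : 'rV[R]_n => x *m A + b).
Proof.
apply: measurable_fun_rVP => i.
under eq_fun do rewrite !mxE.
apply: measurable_funD => //; apply: measurable_sum => j.
by apply: measurable_funM => //; exact: measurable_coord.
Qed.

Local Open Scope ereal_scope.

(** Restricted to nonnegative functions, so that Tonelli's theorem applies without an
    integrability condition; [integral_transfer] extends such formulas to signed functions. *)
Definition change_of_variables n (A : 'M[R]_n) :=
  forall (b : 'rV[R]_n) (f : 'rV[R]_n -> \bar R),
    measurable_fun setT f -> (forall x, 0 <= f x) ->
    \int[lebesgue_rV n]_x f x =
      `|\det A|%:E * \int[lebesgue_rV n]_x f ((x *m A)%R + b)%R.

Lemma change_of_variables_mul n (A B : 'M[R]_n) :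
  change_of_variables A -> change_of_variables B ->
  change_of_variables (A *m B).
Proof.
move=> cA cB b f mf f0; rewrite (cB b f mf f0).
have mg : measurable_fun setT (fun x : 'rV[R]_n => f ((x *m B)%R + b)%R).
  exact: measurableT_comp mf (measurable_mulmxD B b).
rewrite (cA 0%R _ mg (fun x => f0 _)) det_mulmx normrM EFinM muleA.
rewrite [X in X * _ = _]muleC; congr (_ * _).
by apply: eq_integral => x _; rewrite addr0 mulmxA.
Qed.

(** A permutation of the coordinates maps boxes to boxes of the same volume.  The translation is
    taken care of by the hypothesis, an instance of the triangular case. *)
Lemma change_of_variables_perm n : change_of_variables (1%:M : 'M[R]_n) ->
  forall s : {perm 'I_n}, change_of_variables (perm_mx s : 'M[R]_n).
Proof.
move=> c1 s b f mf f0.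
have -> : `|\det (perm_mx s : 'M[R]_n)|%R = 1%R by rewrite det_perm normrX normrN1 expr1n.
rewrite mul1e (c1 b f mf f0) det1 normr1 mul1e.
under eq_integral do rewrite mulmx1.
have mg : measurable_fun setT (fun x : 'rV[R]_n => f (x + b)%R).
  by have := measurableT_comp mf (measurable_mulmxD 1%:M b); under eq_fun do rewrite /= mulmx1.
pose phi (x : 'rV[R]_n) := (x *m perm_mx s)%R.
have mphi : measurable_fun setT phi.
  by have := measurable_mulmxD (perm_mx s : 'M[R]_n) 0; under eq_fun do rewrite addr0.
have := @ge0_integral_pushforward _ _ _ _ R phi mphi (lebesgue_rV n) setT _ measurableT mg
  (fun y _ => f0 _).
rewrite preimage_setT => <-.
pose nu := measure_function_pushforward__canonical__measure_function_Measure (lebesgue_rV n) mphi.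
apply: (@eq_measure_integral _ _ _ _ nu) => A mA _; apply/esym.
apply: (@lebesgue_rV_unique _ nu) => // {mA}A mA.
rewrite /nu /= /pushforward.
rewrite (_ : _ @^-1` _ = [set x : 'rV[R]_n | forall j, A (s j) (x ord0 j)]).
  rewrite (@lebesgue_rV_box R n (fun j => A (s j)) (fun j => mA (s j))).
  by rewrite [RHS](reindex_inj (@perm_inj _ s)).
have phiE x i : phi x ord0 (s i) = x ord0 i.
  by rewrite /phi -[s]invgK -col_permE mxE invgK permK.
apply/seteqP; split => x /= H i; first by have := H (s i); rewrite phiE.
by rewrite -[i](permKV s) phiE; exact: H.
Qed.

Lemma rV_cons_mul_ublock n (a t : R) (u y b : 'rV[R]_n) (D : 'M[R]_n) (b0 : R) :
  (rV_cons (t, y) *m (block_mx a%:M u 0 D : 'M[R]_(1 + n)) + rV_cons (b0, b) =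
  rV_cons (t * a + b0, y *m D + (t *: u + b)))%R.
Proof.
transitivity (row_mx (t%:M : 'rV_1) y *m (block_mx a%:M u 0 D : 'M[R]_(1 + n)) + row_mx b0%:M b)%R.
  by rewrite !rV_consE.
rewrite rV_consE mul_row_block add_row_mx; congr row_mx.
  by rewrite -scalar_mxM mulmx0 addr0 raddfD.
by rewrite mul_scalar_mx addrCA addrA.
Qed.

Lemma rV_cons_mul_lblock n (a t : R) (y b : 'rV[R]_n) (c : 'cV[R]_n) (D : 'M[R]_n) (b0 : R) :
  (rV_cons (t, y) *m (block_mx a%:M 0 c D : 'M[R]_(1 + n)) + rV_cons (b0, b) =
  rV_cons (t * a + ((y *m c) ord0 ord0 + b0), y *m D + b))%R.
Proof.
transitivity (row_mx (t%:M : 'rV_1) y *m (block_mx a%:M 0 c D : 'M[R]_(1 + n)) + row_mx b0%:M b)%R.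
  by rewrite !rV_consE.
rewrite rV_consE mul_row_block add_row_mx; congr row_mx.
  by rewrite -scalar_mxM !raddfD /= -mx11_scalar addrA.
by rewrite mulmx0 add0r.
Qed.

Lemma measurable_rV_cons_fst n (y : 'rV[R]_n) : measurable_fun setT (fun a => rV_cons (a, y)).
Proof.
apply: (@measurable_rV_insert R _ _ n.+1 ord0 id (fun=> y)).
  exact: measurable_id.
exact: measurable_cst.
Qed.

Lemma measurable_rV_cons_snd n (a : R) :
  measurable_fun setT (fun y : 'rV[R]_n => rV_cons (a, y)).
Proof.
apply: (@measurable_rV_insert R _ _ n.+1 ord0 (fun=> a) id).
  exact: measurable_cst.
exact: measurable_id.
Qed.

(** Integrate first over the remaining coordinates: for a fixed first coordinate t, they undergo
    the affine map with linear part D and a translation depending on t. *)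
Lemma change_of_variables_ublock n a u (D : 'M[R]_n) : a != 0%R ->
  change_of_variables D ->
  change_of_variables (block_mx a%:M u 0 D : 'M[R]_(1 + n)).
Proof.
move=> a0 cD b f mf f0.
rewrite (rV_cons_split b); set b0 := b _ _; set b' := (\row_j _)%R.
rewrite (integral_rV_cons1 mf f0).
have mF := measurable_integral_rV_cons1 mf f0.
have F0 s : 0 <= \int[lebesgue_rV n]_y f (rV_cons (s, y)) by apply: integral_ge0 => y _.
rewrite (integral_affine1 b0 a0 mF F0).
have mg := measurableT_comp mf (measurable_mulmxD (block_mx a%:M u 0 D : 'M[R]_(1 + n)) (rV_cons (b0, b'))).
rewrite (integral_rV_cons1 mg (fun x => f0 _)).
rewrite det_ublock det_scalar1 normrM EFinM -muleA; congr (_ * _).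
rewrite -ge0_integralZl//; first last.
- by move=> t _; apply: integral_ge0 => y _; exact: f0.
- exact: measurable_integral_rV_cons1 mg (fun x => f0 _).
apply: eq_integral => t _.
rewrite (cD (t *: u + b')%R _ (measurableT_comp mf (measurable_rV_cons_snd _)) (fun x => f0 _)).
congr (_ * _); apply: eq_integral => y _ /=.
by rewrite rV_cons_mul_ublock.
Qed.

(** Here the first coordinate is integrated first, its translation depending on the others. *)
Lemma change_of_variables_lblock n a c (D : 'M[R]_n) : a != 0%R ->
  change_of_variables D ->
  change_of_variables (block_mx a%:M 0 c D : 'M[R]_(1 + n)).
Proof.
move=> a0 cD b f mf f0.
rewrite (rV_cons_split b); set b0 := b _ _; set b' := (\row_j _)%R.
rewrite (integral_rV_cons2 mf f0).
have mF := measurable_integral_rV_cons2 mf f0.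
have F0 y : 0 <= \int[leb]_a f (rV_cons (a, y)) by apply: integral_ge0 => t _.
rewrite (cD b' _ mF F0).
have mg := measurableT_comp mf (measurable_mulmxD (block_mx a%:M 0 c D : 'M[R]_(1 + n)) (rV_cons (b0, b'))).
rewrite (integral_rV_cons2 mg (fun x => f0 _)).
rewrite det_lblock det_scalar1 mulrC normrM EFinM -muleA; congr (_ * _).
rewrite -ge0_integralZl//; first last.
- by move=> y _; apply: integral_ge0 => t _; exact: f0.
- exact: measurable_integral_rV_cons2 mg (fun x => f0 _).
apply: eq_integral => y _.
rewrite (@integral_affine1 _ _ a ((y *m c) ord0 ord0 + b0)%R a0 (measurableT_comp mf (measurable_rV_cons_fst _)) (fun x => f0 _)).
congr (_ * _); apply: eq_integral => t _ /=.
by rewrite rV_cons_mul_lblock.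
Qed.

Lemma change_of_variables_mx0 (A : 'M[R]_0) : change_of_variables A.
Proof.
move=> b f mf f0; rewrite det_mx00 normr1 mul1e.
by apply: eq_integral => x _; rewrite (thinmx0 x) (thinmx0 (_ + _)%R).
Qed.

Lemma change_of_variables_upper n (A : 'M[R]_n) : (forall i, A i i != 0%R) ->
  (forall i j : 'I_n, (j < i)%N -> A i j = 0%R) -> change_of_variables A.
Proof.
elim: n A => [|n IH] A Ai A0; first exact: change_of_variables_mx0.
have -> : A = block_mx (A ord0 ord0)%:M (@ursubmx _ 1 n 1 n A) 0 (@drsubmx _ 1 n 1 n A)
    :> 'M[R]_(1 + n).
  rewrite -[LHS](@submxK _ 1 n 1 n); congr block_mx.
    by apply/matrixP => i j; rewrite !ord1 !mxE eqxx mulr1n !lshift0.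
  by apply/matrixP => i j; rewrite !ord1 !mxE A0//= lshift0.
apply: change_of_variables_ublock; first exact: Ai.
apply: IH => [i|i j ji]; rewrite !mxE; first exact: Ai.
by rewrite A0//= ltn_add2l.
Qed.

Lemma change_of_variables_lower n (A : 'M[R]_n) : (forall i, A i i != 0%R) ->
  (forall i j : 'I_n, (i < j)%N -> A i j = 0%R) -> change_of_variables A.
Proof.
elim: n A => [|n IH] A Ai A0; first exact: change_of_variables_mx0.
have -> : A = block_mx (A ord0 ord0)%:M 0 (@dlsubmx _ 1 n 1 n A) (@drsubmx _ 1 n 1 n A)
    :> 'M[R]_(1 + n).
  rewrite -[LHS](@submxK _ 1 n 1 n); congr block_mx.
    by apply/matrixP => i j; rewrite !ord1 !mxE eqxx mulr1n !lshift0.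
  by apply/matrixP => i j; rewrite !ord1 !mxE A0//= lshift0.
apply: change_of_variables_lblock; first exact: Ai.
apply: IH => [i|i j ji]; rewrite !mxE; first exact: Ai.
by rewrite A0//= ltn_add2l.
Qed.

(** By the LU decomposition, an invertible matrix is a product of a permutation matrix and of
    triangular matrices, which are treated one coordinate at a time. *)
Lemma change_of_variables_unitmx n (A : 'M[R]_n) : A \in unitmx ->
  change_of_variables A.
Proof.
case: n A => [|n] A Au; first exact: change_of_variables_mx0.
have := cormen_lup_correct A; have := cormen_lup_perm A.
have := cormen_lup_detL A; have := @cormen_lup_lower _ _ A; have := @cormen_lup_upper _ _ A.
case: (cormen_lup A) => [[P L] U] /= Uup Llow detL /is_perm_mxP[s ->] PA.
have c1 : change_of_variables (1%:M : 'M[R]_n.+1).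
  apply: change_of_variables_upper => [i|i j ij]; first by rewrite mxE eqxx oner_eq0.
  by rewrite mxE -val_eqE /= gtn_eqF.
have -> : A = (perm_mx (s^-1)%g *m (L *m U))%R.
  by rewrite -[(L *m U)%R]PA mulmxA -perm_mxM mulVg perm_mx1 mul1mx.
apply: change_of_variables_mul; first exact: change_of_variables_perm.
apply: change_of_variables_mul.
  apply: change_of_variables_lower => [i|i j ij]; first by rewrite Llow// eqxx oner_eq0.
  by rewrite Llow ?(ltnW ij)// -val_eqE /= ltn_eqF.
apply: change_of_variables_upper => [i|i j ij]; last exact: Uup.
have : (\det U != 0)%R.
  have := congr1 determinant PA; rewrite !det_mulmx detL mul1r => <-.
  rewrite mulf_neq0//; first by rewrite det_perm signr_eq0.
  by move: Au; rewrite unitmxE unitfE.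
rewrite -det_tr det_trig; last first.
  by apply/is_trig_mxP => j k jk; rewrite mxE Uup.
by move/prodf_neq0 => /(_ i erefl); rewrite mxE.
Qed.

End change_of_variables.

(** * Integrals over cubes *)

Section cube_integral.
Context {R : realType}.
Local Notation leb := (@lebesgue_measure R).
Implicit Types (L M : R) (n : nat).

Definition bounded_measurable n (h : 'rV[R]_n -> R) :=
  measurable_fun setT h /\ exists M : R, forall x, `|h x| <= M.

Definition cube n L : set 'rV[R]_n := [set t | forall i, `[0, L]%classic (t ord0 i)].

Arguments cube n L : clear implicits.

Definition cube_integral n L (h : 'rV[R]_n -> R) : R :=
  \int[lebesgue_rV n]_(t in cube n L) h t.

Lemma measurable_cube n L : measurable (cube n L).
Proof. exact: (@measurable_box R n (fun=> `[0, L]%classic)). Qed.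

Lemma lebesgue_cube n L : 0 <= L -> lebesgue_rV n (cube n L) = (L ^+ n)%:E.
Proof.
move=> L0; rewrite /cube (@lebesgue_rV_box R n (fun=> `[0, L]%classic))//.
under eq_bigr do rewrite lebesgue_measure_itv/= lte_fin.
move: L0; rewrite le_eqVlt => /orP[/eqP <-|L0].
  rewrite ltxx; case: n => [|n]; first by rewrite big_ord0.
  by rewrite big_ord_recl mul0e expr0n.
rewrite L0 sube0; elim: n => [|n IH]; first by rewrite big_ord0.
by rewrite big_ord_recl IH exprS EFinM.
Qed.

Lemma bounded_measurable_bounded n (h : 'rV[R]_n -> R) A :
  bounded_measurable h -> [bounded h x | x in A].
Proof.
move=> [_ [M hM]]; exists M; split; first exact: num_real.
by move=> N MN x _; exact: le_trans (hM x) (ltW MN).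
Qed.

Lemma cube_integrable n L (h : 'rV[R]_n -> R) : 0 <= L -> bounded_measurable h ->
  (lebesgue_rV n).-integrable (cube n L) (EFin \o h).
Proof.
move=> L0 bh; apply: measurable_bounded_integrable.
- exact: measurable_cube.
- by rewrite [X in (X < _)%E](_ : _ = (L ^+ n)%:E) ?ltry//; exact: lebesgue_cube.
- by apply: measurable_funTS; case: bh.
- exact: bounded_measurable_bounded.
Qed.

Lemma bounded_measurableD n (g h : 'rV[R]_n -> R) :
  bounded_measurable g -> bounded_measurable h ->
  bounded_measurable (fun x => g x + h x).
Proof.
move=> [mg [M gM]] [mh [N hN]]; split; first exact: measurable_funD.
exists (M + N) => x; apply: le_trans (ler_normD _ _) _; exact: lerD.
Qed.

Lemma bounded_measurableZ n (c : R) (h : 'rV[R]_n -> R) :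
  bounded_measurable h -> bounded_measurable (fun x => c * h x).
Proof.
move=> [mh [N hN]]; split; first exact: measurable_funM.
by exists (`|c| * N) => x; rewrite normrM ler_wpM2l.
Qed.

Lemma bounded_measurable_sum n (I : Type) (s : seq I) (h : I -> 'rV[R]_n -> R) :
  (forall i, bounded_measurable (h i)) ->
  bounded_measurable (fun x => \sum_(i <- s) h i x).
Proof.
move=> bh; elim: s => [|i s IH].
  under eq_fun do rewrite big_nil.
  by split=> //; exists 0 => x; rewrite normr0.
by under eq_fun do rewrite big_cons; exact: bounded_measurableD.
Qed.

Lemma bounded_measurable_comp n p (h : 'rV[R]_p -> R) (phi : 'rV[R]_n -> 'rV[R]_p) :
  measurable_fun setT phi -> bounded_measurable h -> bounded_measurable (h \o phi).
Proof.
move=> mphi [mh [M hM]]; split; last by exists M => x; exact: hM.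
exact: measurableT_comp.
Qed.

Lemma cube_integralD n L (g h : 'rV[R]_n -> R) : 0 <= L ->
  bounded_measurable g -> bounded_measurable h ->
  cube_integral L (fun x => g x + h x) = cube_integral L g + cube_integral L h.
Proof.
move=> L0 bg bh; rewrite /cube_integral RintegralD//.
- exact: measurable_cube.
- exact: cube_integrable.
- exact: cube_integrable.
Qed.

Lemma cube_integralZ n L c (h : 'rV[R]_n -> R) : 0 <= L ->
  bounded_measurable h ->
  cube_integral L (fun x => c * h x) = c * cube_integral L h.
Proof.
move=> L0 bh; rewrite /cube_integral RintegralZl//.
- exact: measurable_cube.
- exact: cube_integrable.
Qed.

Lemma cube_integral0 n L : @cube_integral n L (fun=> 0) = 0.
Proof. by rewrite /cube_integral /Rintegral integral0. Qed.

Lemma cube_integral_sum n L (I : Type) (s : seq I) (h : I -> 'rV[R]_n -> R) : 0 <= L ->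
  (forall i, bounded_measurable (h i)) ->
  cube_integral L (fun x => \sum_(i <- s) h i x) = \sum_(i <- s) cube_integral L (h i).
Proof.
move=> L0 bh; elim: s => [|i s IH].
  under eq_fun do rewrite big_nil.
  by rewrite big_nil cube_integral0.
under eq_fun do rewrite big_cons.
by rewrite big_cons cube_integralD ?IH//; exact: bounded_measurable_sum.
Qed.

Lemma cube_integral_mx0 L (h : 'rV[R]_0 -> R) : cube_integral L h = h 0.
Proof.
have cT : cube 0 L = setT by apply/seteqP; split => // t _ [].
rewrite /cube_integral /Rintegral cT (eq_measure_integral (\d_(0 : 'rV[R]_0)))//.
rewrite integral_dirac//= ?diracT ?mul1e//; first by rewrite indicT mul1r.
apply/measurable_EFinP => _ Y _; rewrite setTI.
have [Y0|Y0] := pselect (Y (h 0)).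
  rewrite (_ : _ @^-1` _ = setT)//; apply/seteqP; split => // t _ /=.
  by rewrite (thinmx0 t).
rewrite (_ : _ @^-1` _ = set0)//; apply/seteqP; split => // t /=.
by rewrite (thinmx0 t).
Qed.

Lemma cube_cons n L (a : R) (y : 'rV[R]_n) :
  cube n.+1 L (rV_cons (a, y)) <-> `[0, L]%classic a /\ cube n L y.
Proof.
split=> [H|[Ha Hy] i].
  split; first by have := H ord0; rewrite mxE unlift_none.
  by move=> i; have := H (lift ord0 i); rewrite mxE liftK.
by case: (unliftP ord0 i) => [j|] ->; rewrite mxE ?liftK ?unlift_none//; exact: Hy.
Qed.

Section cons.
Variables (n : nat) (L : R) (h : 'rV[R]_n.+1 -> R).
Hypotheses (L0 : 0 <= L) (bh : bounded_measurable h).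

Lemma bounded_measurable_slice a : bounded_measurable (fun y => h (rV_cons (a, y))).
Proof. exact: bounded_measurable_comp (@measurable_rV_cons_snd R n a) bh. Qed.

Let F : 'rV[R]_n.+1 -> \bar R := (EFin \o h) \_ (cube n.+1 L).

Let intF : (lebesgue_rV n.+1).-integrable setT F.
Proof.
apply/(integrable_mkcond _ (@measurable_cube n.+1 L)).
exact: cube_integrable.
Qed.

Let intFcons : (leb \x lebesgue_rV n)%E.-integrable setT (F \o rV_cons).
Proof.
have mF : measurable_fun setT F by exact: measurable_int intF.
apply/integrableP; split; first exact: measurable_fun_rV_cons.
have /integrableP[_] := intF.
rewrite integral_rV_cons//; exact: measurableT_comp.
Qed.

Let inner a : (\int[lebesgue_rV n]_y F (rV_cons (a, y)) =
  (((fun a => cube_integral L (fun y => h (rV_cons (a, y)))) \_ `[0, L]) a)%:E)%E.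
Proof.
rewrite patchE; case: ifPn => [|]; rewrite ?inE ?notin_setE => aL.
  have -> : (fun y => F (rV_cons (a, y))) = (EFin \o (fun y => h (rV_cons (a, y)))) \_ (cube n L).
    apply/funext => y; rewrite /F !patchE.
    have [Hl Hr] := cube_cons L a y.
    have [Hy|Hy] := pselect (cube n L y).
      by rewrite (mem_set Hy) (mem_set (Hr (conj (set_mem aL) Hy))).
    by rewrite (memNset Hy) memNset// => /Hl[].
  rewrite -(integral_mkcond (cube n L)) /cube_integral /Rintegral fineK//.
  apply: integrable_fin_num; first exact: measurable_cube.
  exact: cube_integrable L0 (bounded_measurable_slice a).
apply: integral0_eq => y _; rewrite /F patchE ifF//.
by apply: memNset => /cube_cons[].
Qed.

Lemma slice_integral_integrable :
  leb.-integrable `[0, L] (EFin \o (fun a => cube_integral L (fun y => h (rV_cons (a, y))))).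
Proof.
have := integrable_fubini_F intFcons.
rewrite [X in _.-integrable _ X -> _](_ : _ =
    (EFin \o (fun a => cube_integral L (fun y => h (rV_cons (a, y))))) \_ `[0, L]).
  by move/(integrable_mkcond (EFin \o _)); apply; exact: measurable_itv.
by apply/funext => a; rewrite /fubini_F [LHS]inner patchE [RHS]patchE /=; case: ifP.
Qed.

Lemma cube_integral_cons :
  cube_integral L h =
  \int[leb]_(a in `[0, L]) cube_integral L (fun y => h (rV_cons (a, y))).
Proof.
have mF : measurable_fun setT F by exact: measurable_int intF.
rewrite /cube_integral {1}/Rintegral integral_mkcond -/F.
have -> : (\int[lebesgue_rV n.+1]_x F x = \int[(leb \x lebesgue_rV n)%E]_z F (rV_cons z))%E.
  have := @integral_pushforward _ _ (measurableTypeR R * 'rV[R]_n)%type _ R rV_cons (@measurable_rV_cons R n)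
    (leb \x lebesgue_rV n)%E setT F mF intFcons measurableT.
  rewrite preimage_setT => <-.
  by apply: eq_measure_integral => [|mp A mA _]; [exact: (@measurable_rV_cons R n)|by []].
rewrite -(integral12_prod_meas1 intFcons) /fubini_F /=.
under eq_integral do rewrite inner.
by rewrite -/(Rintegral _ _ _) -Rintegral_mkcond.
Qed.

Let intg y : leb.-integrable `[0, L] (EFin \o (fun a => h (rV_cons (a, y)))).
Proof.
apply: (@measurable_bounded_integrable _ (measurableTypeR R)).
- exact: measurable_itv.
- rewrite [X in (X < _)%E](_ : _ = (if (0%:E < L%:E)%E then (L%:E - 0%:E)%E else 0%:E)).
    by case: ifP => _; rewrite ?ltry// -EFinB ltry.
  exact: (@lebesgue_measure_itv R `[0, L]).
- apply: measurable_funTS; case: bh => mh _.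
  exact: measurableT_comp mh (@measurable_rV_cons_fst R n y).
- have [_ [M hM]] := bh; exists M; split; first exact: num_real.
  by move=> N MN a _; exact: le_trans (hM _) (ltW MN).
Qed.

Let inner2 y : (\int[leb]_a F (rV_cons (a, y)) =
  (((fun y => \int[leb]_(a in `[0, L]) h (rV_cons (a, y)))%R \_ (cube n L)) y)%:E)%E.
Proof.
rewrite patchE; case: ifPn => [|]; rewrite ?inE ?notin_setE => yL.
  have -> : (fun a => F (rV_cons (a, y))) = (EFin \o (fun a => h (rV_cons (a, y)))) \_ `[0, L].
    apply/funext => a; rewrite /F !patchE.
    have [Hl Hr] := cube_cons L a y.
    have [Ha|Ha] := pselect (`[0, L]%classic a).
      by rewrite (mem_set Ha) (mem_set (Hr (conj Ha (set_mem yL)))).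
    by rewrite (memNset Ha) memNset// => /Hl[].
  rewrite /Rintegral fineK; first by rewrite [RHS]integral_mkcond.
  apply: integrable_fin_num; last exact: intg.
  exact: measurable_itv.
apply: integral0_eq => a _; rewrite /F patchE ifF//.
by apply: memNset => /cube_cons[].
Qed.

Lemma cube_integral_cons2 :
  cube_integral L h =
  cube_integral L (fun y => \int[leb]_(a in `[0, L]) h (rV_cons (a, y))).
Proof.
have mF : measurable_fun setT F by exact: measurable_int intF.
rewrite /cube_integral {1}/Rintegral integral_mkcond -/F.
have -> : (\int[lebesgue_rV n.+1]_x F x = \int[(leb \x lebesgue_rV n)%E]_z F (rV_cons z))%E.
  have := @integral_pushforward _ _ (measurableTypeR R * 'rV[R]_n)%type _ R rV_cons (@measurable_rV_cons R n)
    (leb \x lebesgue_rV n)%E setT F mF intFcons measurableT.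
  rewrite preimage_setT => <-.
  by apply: eq_measure_integral => [|mp A mA _]; [exact: (@measurable_rV_cons R n)|by []].
rewrite -(integral21_prod_meas1 intFcons) /fubini_G /=.
under eq_integral do rewrite inner2.
by rewrite -/(Rintegral _ _ _) -Rintegral_mkcond.
Qed.

End cons.

End cube_integral.

Arguments cube {R} n L.

(** * The Euler-Maclaurin formula in one variable *)

Section euler_maclaurin_one_variable.
Context {R : realType}.
Local Notation leb := (@lebesgue_measure R).

(** The numbers c_a = B_a / a!, of generating function t / (e^t - 1), defined by the recursion
    [em_coefE] that they satisfy; B_a is the a-th Bernoulli number, with B_1 = -1/2. *)
Fixpoint em_coefs (n : nat) : seq R :=
  if n is n'.+1 then let s := em_coefs n' in
    rcons s ((n' == 0)%:R - \sum_(a < n') s`_a / (n'.+1 - a)`!%:R)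
  else [::].

Definition em_coef (n : nat) : R := (em_coefs n.+1)`_n.

Lemma size_em_coefs n : size (em_coefs n) = n.
Proof. by elim: n => //= n IH; rewrite size_rcons IH. Qed.

Lemma nth_em_coefs n a : (a < n)%N -> (em_coefs n)`_a = em_coef a.
Proof.
elim: n => // n IH; rewrite ltnS leq_eqVlt => /orP[/eqP ->//|an].
by rewrite /= nth_rcons size_em_coefs an IH.
Qed.

(** The identity (sum_a c_a t^a) (e^t - 1) / t = 1, coefficient by coefficient. *)
Lemma em_coefE n :
  \sum_(a < n.+1) em_coef a / (n.+1 - a)`!%:R = (n == 0)%:R.
Proof.
rewrite big_ord_recr /= subSnn factS fact0 muln1 divr1 {2}/em_coef /= nth_rcons.
rewrite size_em_coefs ltnn eqxx addrC.
under [X in _ - X]eq_bigr => a _ do rewrite nth_em_coefs//.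
by rewrite subrK.
Qed.

Lemma em_coef0 : em_coef 0 = 1.
Proof. by have := em_coefE 0; rewrite big_ord1 subSnn factS fact0 muln1 divr1. Qed.

Lemma em_coef1 : em_coef 1 = - 2^-1.
Proof.
have := em_coefE 1; rewrite big_ord_recr big_ord1 /= em_coef0 subSnn factS fact0 muln1 divr1 mul1r.
by move/eqP; rewrite addrC addr_eq0 => /eqP.
Qed.

Lemma exchange_triangle (K : nat) (F : nat -> nat -> R) :
  \sum_(a < K.+1) \sum_(b < (K - a).+1) F a b =
  \sum_(l < K.+1) \sum_(a < l.+1) F a (l - a)%N.
Proof.
elim: K => [|K IH]; first by rewrite !big_ord1.
rewrite big_ord_recr [RHS]big_ord_recr /= -IH subnn big_ord1.
rewrite [X in _ = _ + X]big_ord_recr /= subnn addrA; congr (_ + _).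
rewrite -big_split /=; apply: eq_bigr => a _.
by rewrite subSn -1?ltnS// big_ord_recr.
Qed.

Section jet.
Variables (H : nat -> R -> R).
Hypothesis dH : forall a (t : R), 0 <= t -> is_derive t 1 (H a) (H a.+1 t).

Let taylor n a s (t : R) := \sum_(j < n) H (a + j)%N s * t ^+ j / j`!%:R.

Let is_derive_taylor n a s (t : R) :
  is_derive t 1 (taylor n.+1 a s) (taylor n a.+1 s t).
Proof.
have -> : taylor n.+1 a s = (cst (H a s)) + \sum_(j < n)
    (fun u : R => H (a + j.+1)%N s / j.+1`!%:R * u ^+ j.+1).
  apply/funext => u; rewrite /taylor big_ord_recl /= addn0 expr0 fact0 divr1 mulr1.
  rewrite [RHS]/= /GRing.add /= fct_sumE; congr (_ + _).
  by apply: eq_bigr => j _; rewrite mulrAC.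
rewrite -[taylor _ _ _ _]add0r; apply: is_deriveD.
apply: is_derive_sum => j.
have dX : is_derive t 1 (fun u : R => u ^+ j.+1) (j.+1%:R * t ^+ j).
  have := is_deriveX j.+1 (is_derive_id t 1); rewrite [_ *: 1]mulr1 /=.
  by rewrite exprfctE.
have := is_deriveZ (H (a + j.+1)%N s / j.+1`!%:R) dX.
congr (is_derive _ _ _ _).
rewrite -[_ *: _]/(_ * _) addSnnS factS natrM invfM.
have : j.+1%:R != 0 :> R by rewrite pnatr_eq0.
move=> j0; have : j`!%:R != 0 :> R by rewrite pnatr_eq0 -lt0n fact_gt0.
move: j0; set x := (j.+1%:R : R); set y := (j`!%:R : R); move: x y => x y x0 y0.
by field; rewrite x0 y0.
Qed.

Lemma taylor_bound n a (s B t : R) : 0 <= s -> 0 <= t ->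
  (forall u : R, 0 <= u -> `|H (a + n)%N u| <= B) ->
  `|H a (s + t) - taylor n a s t| <= B * t ^+ n.
Proof.
elim: n a t => [|n IH] a t s0 t0 HB.
  by rewrite /taylor big_ord0 subr0 expr0 mulr1 -[a]addn0 HB// addr_ge0.
pose phi u := H a (s + u) - taylor n.+1 a s u.
have dphi (u : R) : 0 <= u -> is_derive u 1 phi (H a.+1 (s + u) - taylor n a.+1 s u).
  move=> u0; apply: is_deriveB; last exact: is_derive_taylor.
  have dS : is_derive u 1 (fun u : R => s + u) 1.
    have := is_deriveD (is_derive_cst s u 1) (is_derive_id u 1).
    by rewrite add0r.
  have := @is_derive1_comp _ (H a) (fun u => s + u) u _ _ (dH a (addr_ge0 s0 u0)) dS.
  by rewrite mulr1.
have phi0 : phi 0 = 0.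
  rewrite /phi /taylor addr0 big_ord_recl /= addn0 expr0 fact0 divr1 mulr1.
  rewrite big1 ?addr0 ?subrr// => j _.
  by rewrite expr0n /= mulr0 mul0r.
have cphi : {within `[0, t], continuous phi}.
  apply: derivable_within_continuous => u; rewrite in_itv /= => /andP[u0 _].
  exact: (@ex_derive _ _ _ _ _ _ _ (dphi u u0)).
have [u|u] := MVT_segment (df := fun u => H a.+1 (s + u) - taylor n a.+1 s u) t0 _ cphi.
  by rewrite in_itv /= => /andP[/ltW u0 _]; exact: dphi.
rewrite in_itv /= => /andP[u0 ut].
rewrite -/(phi t) phi0 !subr0 => ->.
rewrite normrM (ger0_norm t0) exprSr mulrA ler_wpM2r//.
apply: (le_trans (IH a.+1 u s0 u0 _)) => [v v0|]; first by rewrite addSnnS HB.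
have B0 : 0 <= B by apply: le_trans (HB 0 _).
by rewrite ler_wpM2l// lerXn2r.
Qed.

(** Expanding each difference H a (s + t) - H a s by Taylor's formula, the coefficient of
    t^(l+1) times the (l+1)-st derivative is the convolution [em_coefE], hence 0 for l > 0;
    only t * H 1 s remains. *)
Lemma em_cell K (s B t : R) : 0 <= s -> 0 <= t ->
  (forall u : R, 0 <= u -> `|H K.+2 u| <= B) ->
  `|\sum_(a < K.+1) em_coef a * t ^+ a * (H a (s + t) - H a s) - t * H 1%N s| <=
  (\sum_(a < K.+1) `|em_coef a|) * B * t ^+ K.+2.
Proof.
move=> s0 t0 HB.
have E : \sum_(a < K.+1) em_coef a * t ^+ a * (taylor (K - a).+2 a s t - H a s) = t * H 1%N s.
  pose F a b := em_coef a / b.+1`!%:R * (t ^+ (a + b).+1 * H (a + b).+1 s).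
  transitivity (\sum_(a < K.+1) \sum_(b < (K - a).+1) F a b).
    apply: eq_bigr => a _.
    rewrite /taylor big_ord_recl /= addn0 expr0 fact0 divr1 mulr1.
    rewrite addrAC subrr add0r mulr_sumr; apply: eq_bigr => b _.
    rewrite /F /= /bump /= add1n addnS -addnS exprD; ring.
  rewrite exchange_triangle big_ord_recl /= big_ord1 /F addn0 em_coef0 factS fact0 muln1 divr1.
  rewrite mul1r expr1 big1 ?addr0// => l _; rewrite /bump /= add1n.
  rewrite (eq_bigr (fun a : 'I__ => em_coef a / (l.+2 - a)`!%:R * (t ^+ l.+2 * H l.+2 s))).
    by rewrite -mulr_suml em_coefE mul0r.
  move=> a _; have al : (a <= l.+1)%N by rewrite -ltnS.
  by rewrite /F -subSn// subnKC.
rewrite -E -sumrB mulr_suml mulr_suml; apply: le_trans (ler_norm_sum _ _ _) _.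
apply: ler_sum => a _; have aK : (a <= K)%N by rewrite -ltnS.
rewrite -mulrBr opprB addrA subrK !normrM (ger0_norm (exprn_ge0 _ t0)).
rewrite -!mulrA ler_wpM2l//.
rewrite (_ : K.+2 = a + (K - a).+2)%N; last by rewrite !addnS subnKC.
rewrite exprD mulrCA ler_wpM2l ?exprn_ge0//.
apply: taylor_bound => // u u0; rewrite !addnS subnKC//; exact: HB.
Qed.

(** The terms H a (N t) - H a 0 telescope over the N cells of length t.  As H a is a primitive of
    H a.+1, they are the integrals of H 1, the function being summed, and of its derivatives. *)
Lemma em_interval K N (B t : R) : 0 <= t ->
  (forall u : R, 0 <= u -> `|H K.+2 u| <= B) ->
  `|\sum_(a < K.+1) em_coef a * t ^+ a * (H a (N%:R * t) - H a 0) -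
    t * \sum_(k < N) H 1%N (k%:R * t)| <=
  N%:R * ((\sum_(a < K.+1) `|em_coef a|) * B * t ^+ K.+2).
Proof.
move=> t0 HB.
have -> : \sum_(a < K.+1) em_coef a * t ^+ a * (H a (N%:R * t) - H a 0) =
    \sum_(k < N) \sum_(a < K.+1) em_coef a * t ^+ a * (H a (k%:R * t + t) - H a (k%:R * t)).
  rewrite exchange_big /=; apply: eq_bigr => a _; rewrite -mulr_sumr; congr (_ * _).
  elim: N => [|N IH]; first by rewrite mul0r subrr big_ord0.
  rewrite big_ord_recr /= -IH -natr1 mulrDl mul1r.
  by rewrite [RHS]addrC addrA subrK.
rewrite mulr_sumr -sumrB mulr_natl -[X in _ *+ X](card_ord N) -sumr_const.
apply: le_trans (ler_norm_sum _ _ _) _; apply: ler_sum => k _.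
by apply: em_cell => //; rewrite mulr_ge0.
Qed.

End jet.

End euler_maclaurin_one_variable.

Section primitive.
Context {R : realType}.
Local Notation leb := (@lebesgue_measure R).

Lemma continuous_integrable_itv (h : R -> R) (a b : R) : continuous h ->
  leb.-integrable `[a, b] (EFin \o h).
Proof.
move=> ch; apply: continuous_compact_integrable; first exact: segment_compact.
exact: continuous_subspaceT.
Qed.

(** The primitive starts at -1, so that it is differentiable at 0 and not merely from the right. *)
Lemma continuous_primitive (h : R -> R) : continuous h ->
  exists F : R -> R, forall t : R, 0 <= t -> is_derive t 1 F (h t).
Proof.
move=> ch; exists (fun x => \int[leb]_(t in `[(-1), x]) h t) => t t0.
have t1 : -1 < t by rewrite (lt_le_trans _ t0)// ltrN10.
have [|dF Fh] := @continuous_FTC1_closed R h (-1) t (t + 1) _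
    (continuous_integrable_itv _ _ ch) t1 (ch t); first by rewrite ltrDl.
by apply: DeriveDef; [exact: dF|rewrite -derive1E; exact: Fh].
Qed.

Lemma integral_of_derivative (h F : R -> R) (L : R) : 0 < L -> continuous h ->
  (forall t : R, 0 <= t -> is_derive t 1 F (h t)) ->
  \int[leb]_(t in `[0, L]) h t = F L - F 0.
Proof.
move=> L0 ch dF.
have cF (t : R) : 0 <= t -> {for t, continuous F}.
  move=> t0; apply: differentiable_continuous; apply/derivable1_diffP.
  exact: (@ex_derive _ _ _ _ _ _ _ (dF t t0)).
rewrite /Rintegral (@continuous_FTC2 _ _ F)//; first by exact: continuous_subspaceT.
  split.
  - move=> t; rewrite in_itv /= => /andP[/ltW t0 _].
    exact: (@ex_derive _ _ _ _ _ _ _ (dF t t0)).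
  - by apply: cvg_at_right_filter; exact: cF.
  - by apply: cvg_at_left_filter; apply: cF; exact: ltW.
move=> t; rewrite in_itv /= => /andP[/ltW t0 _].
by rewrite derive1E; exact: (@derive_val _ _ _ _ _ _ _ (dF t t0)).
Qed.

End primitive.

Arguments em_coef R n : clear implicits.

(** * The Euler-Maclaurin formula on a parallelepiped *)

Section integral_sums.
Context d (T : measurableType d) (R : realType) (mu : {measure set T -> \bar R}).
Variables (D : set T).
Hypothesis mD : measurable D.

Lemma integrable_sum_fin (I : Type) (s : seq I) (f : I -> T -> R) :
  (forall i, mu.-integrable D (EFin \o f i)) ->
  mu.-integrable D (EFin \o (fun x => \sum_(i <- s) f i x)).
Proof.
move=> fi; elim: s => [|i s IH].
  by under [X in EFin \o X]eq_fun do rewrite big_nil; exact: integrable0.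
under [X in EFin \o X]eq_fun do rewrite big_cons.
exact: (integrableD mD (fi i) IH).
Qed.

Lemma Rintegral_sum (I : Type) (s : seq I) (f : I -> T -> R) :
  (forall i, mu.-integrable D (EFin \o f i)) ->
  \int[mu]_(x in D) (\sum_(i <- s) f i x) = \sum_(i <- s) \int[mu]_(x in D) f i x.
Proof.
move=> fi; elim: s => [|i s IH].
  under eq_Rintegral do rewrite big_nil.
  by rewrite big_nil /Rintegral integral0.
under eq_Rintegral do rewrite big_cons.
by rewrite big_cons -IH RintegralD//; exact: integrable_sum_fin.
Qed.

Lemma integrableZ_fin (c : R) (f : T -> R) : mu.-integrable D (EFin \o f) ->
  mu.-integrable D (EFin \o (fun x => c * f x)).
Proof. by move=> fi; exact: (integrableZl mD c fi). Qed.

Lemma integrableB_fin (f g : T -> R) : mu.-integrable D (EFin \o f) ->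
  mu.-integrable D (EFin \o g) -> mu.-integrable D (EFin \o (fun x => f x - g x)).
Proof.
move=> fi gi; have := integrableD mD fi (integrableZ_fin (-1) gi).
rewrite [X in integrable _ _ X -> _](_ : _ = EFin \o (fun x => f x - g x))//.
by apply/funext => x /=; rewrite mulN1r.
Qed.

End integral_sums.

Section lattice_mean.
Context {R : realType} {m : nat}.
Implicit Types (G : 'rV[R]_m -> R) (x y w : 'rV[R]_m).

(** The sum of G over the points x + t k_1 w_1 + ... + t k_n w_n with 0 <= k_i < N, times t^n,
    for w_i the rows of W ([lattice_mean_points]); the recursion on the rows is the one along which
    the Euler-Maclaurin formula is iterated. *)
Fixpoint lattice_mean n : 'M[R]_(n, m) -> R -> nat -> ('rV[R]_m -> R) -> 'rV[R]_m -> R :=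
  match n with
  | 0 => fun _ _ _ G x => G x
  | n'.+1 => fun W t N G x =>
      t * \sum_(k < N) lattice_mean (row' ord0 W) t N G (x + (k%:R * t) *: row ord0 W)
  end.

Variables (t : R) (N : nat).

Lemma lattice_mean_sum n (W : 'M[R]_(n, m)) (I : Type) (s : seq I) (c : I -> R)
    (G : I -> 'rV[R]_m -> R) x :
  lattice_mean W t N (fun y => \sum_(i <- s) c i * G i y) x =
  \sum_(i <- s) c i * lattice_mean W t N (G i) x.
Proof.
elim: n W x => // n IH W x /=.
under eq_bigr do rewrite IH.
rewrite exchange_big /= mulr_sumr; apply: eq_bigr => i _.
by rewrite -mulr_sumr mulrCA.
Qed.

Lemma lattice_meanD n (W : 'M[R]_(n, m)) G1 G2 x :
  lattice_mean W t N (fun y => G1 y + G2 y) x =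
  lattice_mean W t N G1 x + lattice_mean W t N G2 x.
Proof.
elim: n W x => // n IH W x /=.
under eq_bigr do rewrite IH.
by rewrite big_split /= mulrDr.
Qed.

Lemma lattice_mean_shift n (W : 'M[R]_(n, m)) G v x :
  lattice_mean W t N (fun y => G (y + v)) x = lattice_mean W t N G (x + v).
Proof.
elim: n W x => // n IH W x /=.
by under eq_bigr do rewrite IH addrAC.
Qed.

Lemma lattice_mean_cons n (W : 'M[R]_(n.+1, m)) G x :
  lattice_mean W t N G x =
  lattice_mean (row' ord0 W) t N
    (fun y => t * \sum_(k < N) G (y + (k%:R * t) *: row ord0 W)) x.
Proof.
rewrite /= mulr_sumr.
rewrite (_ : (fun y => t * _) = (fun y => \sum_(k < N) t * G (y + (k%:R * t) *: row ord0 W))).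
  by rewrite lattice_mean_sum; apply: eq_bigr => k _; rewrite lattice_mean_shift.
by apply/funext => y; rewrite mulr_sumr.
Qed.

Lemma lattice_mean_bound n (W : 'M[R]_(n, m)) G (M : R) x : 0 <= t ->
  (forall y, `|G y| <= M) ->
  `|lattice_mean W t N G x| <= (N%:R * t) ^+ n * M.
Proof.
move=> t0 GM; elim: n W x => [|n IH] W x; first by rewrite mul1r.
rewrite /= normrM ger0_norm// exprS -!mulrA mulrCA ler_wpM2l//.
apply: le_trans (ler_norm_sum _ _ _) _.
rewrite [X in _ <= X]mulr_natl -[X in _ <= _ *+ X](card_ord N) -sumr_const.
by apply: ler_sum => k _; exact: IH.
Qed.

Lemma lattice_mean_continuous n (W : 'M[R]_(n, m)) G : continuous G ->
  continuous (lattice_mean W t N G).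
Proof.
move=> cG; elim: n W => // n IH W /=.
apply: (@rV_continuousM _ _ (fun=> t)); first exact: cst_continuous.
elim: (index_enum _) => [|k s IHs].
  by under eq_fun do rewrite big_nil; exact: cst_continuous.
under eq_fun do rewrite big_cons.
apply: rV_continuousD => // x.
apply: (@continuous_comp _ _ _ (fun y : 'rV[R]_m => y + (k%:R * t) *: row ord0 W)).
  exact: (@cvgD R _ _ (nbhs x) _ id (fun=> (k%:R * t) *: row ord0 W) _ _ cvg_id (cvg_cst _)).
exact: IH.
Qed.

End lattice_mean.

Section line_integral.
Context {R : realType} {m : nat}.
Local Notation leb := (@lebesgue_measure R).
Implicit Types (G : 'rV[R]_m -> R) (x y w : 'rV[R]_m).

Definition line_integral (L : R) w G x := \int[leb]_(s in `[0, L]) G (x + s *: w).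

Lemma continuous_line G x w : continuous G -> continuous (fun s : R => G (x + s *: w)).
Proof.
move=> cG s; apply: (@continuous_comp _ _ _ (fun s : R => x + s *: w) G); last exact: cG.
by apply: cvgD; [exact: cvg_cst|apply: cvgZr_tmp; exact: cvg_id].
Qed.

Lemma lattice_mean_line_integral t N n (W : 'M[R]_(n, m)) G w (L : R) x : continuous G ->
  lattice_mean W t N (line_integral L w G) x =
  \int[leb]_(s in `[0, L]) lattice_mean W t N G (x + s *: w).
Proof.
move=> cG; elim: n W x => // n IH W x /=.
have cl k : leb.-integrable `[0, L] (EFin \o (fun s : R =>
    lattice_mean (row' ord0 W) t N G (x + s *: w + (k%:R * t) *: row ord0 W))).
  apply: continuous_integrable_itv.
  have := @continuous_line _ (x + (k%:R * t) *: row ord0 W) w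
    (@lattice_mean_continuous R m t N n (row' ord0 W) G cG).
  suff -> : (fun s : R => lattice_mean (row' ord0 W) t N G (x + s *: w + (k%:R * t) *: row ord0 W)) =
    (fun s : R => lattice_mean (row' ord0 W) t N G (x + (k%:R * t) *: row ord0 W + s *: w)) by [].
  by apply/funext => s; rewrite addrAC.
rewrite RintegralZl//; last by apply: integrable_sum_fin => // k; exact: cl.
rewrite Rintegral_sum//; congr (_ * _); apply: eq_bigr => k _; rewrite IH.
by apply: eq_Rintegral => s _; rewrite addrAC.
Qed.

Lemma iterD_bounded_smooth a w G : bounded_smooth G ->
  bounded_smooth (iter a (fun F => 'D_w F) G).
Proof. by move=> bG; elim: a => //= a; exact: bounded_smooth_derive. Qed.

Lemma em_line (L : nat) w G (K : nat) : (0 < L)%N -> bounded_smooth G ->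
  exists C : R, forall N, (0 < N)%N -> forall y,
  `|N%:R^-1 * \sum_(k < L * N) G (y + (k%:R * N%:R^-1) *: w) -
    \sum_(a < K.+1) em_coef R a * N%:R^-1 ^+ a *
       line_integral L%:R w (iter a (fun F => 'D_w F) G) y| <= C * N%:R^-1 ^+ K.+1.
Proof.
move=> L0 bG.
have [B HB] := bounded_smooth_bound (iterD_bounded_smooth K.+1 w bG).
exists (L%:R * ((\sum_(a < K.+1) `|em_coef R a|) * B)) => N N0 y.
set t := N%:R^-1.
have t0 : 0 <= t by rewrite invr_ge0.
pose h a (s : R) := iter a (fun F => 'D_w F) G (y + s *: w).
have sm a : smooth (iter a (fun F => 'D_w F) G) by case: (iterD_bounded_smooth a w bG).
have ch a : continuous (h a) by exact: continuous_line (smooth_continuous (sm a)).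
have [F dF] := continuous_primitive (ch 0%N).
pose H a := if a is a'.+1 then h a' else F.
have dH a (s : R) : 0 <= s -> is_derive s 1 (H a) (H a.+1 s).
  case: a => [|a] s0; first exact: dF.
  have := is_derive_line (smooth_derivable_dir (y + s *: w) w (sm a)).
  exact.
have HH (u : R) : 0 <= u -> `|H K.+2 u| <= B by move=> _; exact: HB.
have Nt : (L * N)%:R * t = L%:R.
  by rewrite natrM -mulrA mulfV ?mulr1// pnatr_eq0 -lt0n.
have := em_interval dH (L * N) t0 HH; rewrite Nt distrC.
have -> : \sum_(a < K.+1) em_coef R a * t ^+ a * (H a L%:R - H a 0) =
    \sum_(a < K.+1) em_coef R a * t ^+ a * line_integral L%:R w (iter a (fun F => 'D_w F) G) y.
  apply: eq_bigr => a _; congr (_ * _); rewrite /line_integral.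
  by rewrite (integral_of_derivative _ (ch a) (dH a))// ltr0n.
move=> /le_trans; apply.
set S := \sum_(a < K.+1) _.
have -> : L%:R * (S * B) * t ^+ K.+1 = (L * N)%:R * t * (S * B) * t ^+ K.+1 by rewrite Nt.
by rewrite [t ^+ K.+2]exprS !mulrA -!mulrA [t * (S * _)]mulrCA [t * (B * _)]mulrCA.
Qed.

End line_integral.

Section euler_maclaurin.
Context {R : realType} {m : nat}.
Local Notation leb := (@lebesgue_measure R).
Implicit Types (G : 'rV[R]_m -> R) (x y w : 'rV[R]_m).

(** The part of degree j of the product of D / (exp(D) - 1) over the derivatives D along the rows
    of W. *)
Fixpoint em_operator n : 'M[R]_(n, m) -> nat -> ('rV[R]_m -> R) -> 'rV[R]_m -> R :=
  match n with
  | 0 => fun _ j G => if j is 0 then G else fun=> 0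
  | n'.+1 => fun W j G x => \sum_(a < j.+1) em_coef R a *
      em_operator (row' ord0 W) (j - a) (iter a (fun F => 'D_(row ord0 W) F) G) x
  end.

Lemma em_operator_bounded_smooth n (W : 'M[R]_(n, m)) j G : bounded_smooth G ->
  bounded_smooth (em_operator W j G).
Proof.
elim: n W j G => [|n IH] W [|j] G bG //=; try exact: bounded_smooth0.
  apply: bounded_smooth_sum => a; apply: bounded_smoothZ; apply: IH.
  exact: iterD_bounded_smooth.
apply: bounded_smooth_sum => a; apply: bounded_smoothZ; apply: IH.
exact: iterD_bounded_smooth.
Qed.

Definition parallelepiped_integral n (W : 'M[R]_(n, m)) (L : R) G x :=
  cube_integral L (fun u : 'rV[R]_n => G (x + u *m W)).

Lemma bounded_smooth_measurable n (W : 'M[R]_(n, m)) G x : bounded_smooth G ->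
  bounded_measurable (fun u : 'rV[R]_n => G (x + u *m W)).
Proof.
move=> [sG bG]; split; last by have [M HM] := bG [::]; exists M => u; exact: HM.
under eq_fun do rewrite addrC.
exact: measurableT_comp (continuous_measurable_rV (smooth_continuous sG)) (measurable_mulmxD W x).
Qed.

Lemma rV_cons_mul n (W : 'M[R]_(n.+1, m)) (s : R) (u : 'rV[R]_n) :
  rV_cons (s, u) *m W = s *: row ord0 W + u *m row' ord0 W.
Proof.
apply/rowP => j; rewrite !mxE big_ord_recl !mxE unlift_none; congr (_ + _).
by apply: eq_bigr => i _; rewrite !mxE liftK.
Qed.

Lemma parallelepiped_integral_cons n (W : 'M[R]_(n.+1, m)) L G x : 0 <= L ->
  bounded_smooth G ->
  parallelepiped_integral W L G x =
  \int[leb]_(s in `[0, L]) parallelepiped_integral (row' ord0 W) L G (x + s *: row ord0 W).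
Proof.
move=> L0 bG; rewrite /parallelepiped_integral.
rewrite (cube_integral_cons L0 (bounded_smooth_measurable W x bG)).
apply: eq_Rintegral => s _; congr cube_integral; apply/funext => u.
by rewrite rV_cons_mul addrA.
Qed.

Lemma parallelepiped_slice_integrable n (W : 'M[R]_(n.+1, m)) L G x : 0 <= L ->
  bounded_smooth G ->
  leb.-integrable `[0, L] (EFin \o (fun s =>
    parallelepiped_integral (row' ord0 W) L G (x + s *: row ord0 W))).
Proof.
move=> L0 bG.
have := slice_integral_integrable L0 (bounded_smooth_measurable W x bG).
congr (_.-integrable _ _); apply/funext => s /=; congr (_%:E).
congr cube_integral; apply/funext => u.
by rewrite rV_cons_mul addrA.
Qed.

(** By induction on the number of directions: the one-variable formula replaces the sum along the
    first row by integrals over [0, L], up to a remainder whose mean over the other directions is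
    of the same order; then the induction hypothesis applies under the integral sign, since its
    remainder is uniform in the base point.  Products of powers of 1/N recombine by degree
    ([exchange_triangle]). *)
Lemma euler_maclaurin n (W : 'M[R]_(n, m)) (L : nat) G (K : nat) : (0 < L)%N ->
  bounded_smooth G ->
  exists C : R, forall N, (0 < N)%N -> forall x,
  `|lattice_mean W N%:R^-1 (L * N) G x -
    \sum_(j < K.+1) N%:R^-1 ^+ j * parallelepiped_integral W L%:R (em_operator W j G) x|
  <= C * N%:R^-1 ^+ K.+1.
Proof.
move=> L0; elim: n W G K => [|n IH] W G K bG.
  exists 0 => N _ x; rewrite mul0r big_ord_recl /= expr0 mul1r.
  rewrite big1 ?addr0 => [|j _]; last first.
    by rewrite /parallelepiped_integral cube_integral_mx0 /= mulr0.
  by rewrite /parallelepiped_integral cube_integral_mx0 mul0mx addr0 subrr normr0.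
set w := row ord0 W; set W' := row' ord0 W.
pose Ga a := iter a (fun F => 'D_w F) G.
have bGa a : bounded_smooth (Ga a) by exact: iterD_bounded_smooth.
have [C1 HC1] := em_line w K L0 bG.
have /choice[C2 HC2] a := IH W' (Ga a) (K - a)%N (bGa a).
exists (L%:R ^+ n * C1 + \sum_(a < K.+1) `|em_coef R a| * (C2 a * L%:R)) => N N0 x.
set t := N%:R^-1.
have t0 : 0 <= t by rewrite invr_ge0.
have LR0 : 0 <= L%:R :> R by rewrite ler0n.
have Nt : (L * N)%:R * t = L%:R.
  by rewrite natrM -mulrA mulfV ?mulr1// pnatr_eq0 -lt0n.
pose A y := t * \sum_(k < L * N) G (y + (k%:R * t) *: w).
pose S y := \sum_(a < K.+1) em_coef R a * t ^+ a * line_integral L%:R w (Ga a) y.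
have -> : lattice_mean W t (L * N) G x =
    lattice_mean W' t (L * N) S x + lattice_mean W' t (L * N) (fun y => A y - S y) x.
  rewrite lattice_mean_cons -lattice_meanD; congr lattice_mean; apply/funext => y.
  by rewrite addrC subrK.
have HR : `|lattice_mean W' t (L * N) (fun y => A y - S y) x| <= L%:R ^+ n * C1 * t ^+ K.+1.
  rewrite -mulrA -Nt; apply: lattice_mean_bound => // y; exact: HC1.
have -> : \sum_(j < K.+1) t ^+ j * parallelepiped_integral W L%:R (em_operator W j G) x =
  \sum_(a < K.+1) em_coef R a * t ^+ a *
    \sum_(b < (K - a).+1) t ^+ b * parallelepiped_integral W L%:R (em_operator W' b (Ga a)) x.
  under [RHS]eq_bigr do rewrite mulr_sumr.
  rewrite (exchange_triangle K (fun a b => em_coef R a * t ^+ a *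
    (t ^+ b * parallelepiped_integral W L%:R (em_operator W' b (Ga a)) x))).
  apply: eq_bigr => j _; rewrite /parallelepiped_integral /=.
  rewrite cube_integral_sum//; last first.
    move=> a; apply: bounded_measurableZ; apply: bounded_smooth_measurable.
    exact: (em_operator_bounded_smooth _ _ (bGa a)).
  rewrite mulr_sumr; apply: eq_bigr => a _.
  rewrite cube_integralZ//; last first.
    by apply: bounded_smooth_measurable; exact: (em_operator_bounded_smooth _ _ (bGa a)).
  have aj : (a <= j)%N by rewrite -ltnS.
  by rewrite -{1}(subnKC aj) exprD; ring.
rewrite addrAC; apply: le_trans (ler_normD _ _) _; rewrite mulrDl [X in _ <= X]addrC.
apply: lerD; last exact: HR.
rewrite lattice_mean_sum -sumrB mulr_suml.
apply: le_trans (ler_norm_sum _ _ _) _; apply: ler_sum => a _.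
have aK : (a <= K)%N by rewrite -ltnS.
rewrite -mulrBr 2!normrM (ger0_norm (exprn_ge0 _ t0)).
rewrite -!mulrA ler_wpM2l//.
have tK : t ^+ K.+1 = t ^+ a * t ^+ (K - a).+1 by rewrite -exprD addnS subnKC.
rewrite tK [X in _ <= X](_ : _ = t ^+ a * (C2 a * t ^+ (K - a).+1 * L%:R)); last by ring.
rewrite ler_wpM2l ?exprn_ge0//.
have cGa : continuous (Ga a) by apply: smooth_continuous; case: (bGa a).
rewrite lattice_mean_line_integral//.
have bE b : bounded_smooth (em_operator W' b (Ga a)) by exact: em_operator_bounded_smooth.
have ii b := parallelepiped_slice_integrable W x LR0 (bE b).
have il : leb.-integrable `[0, L%:R] (EFin \o (fun s => lattice_mean W' t (L * N) (Ga a) (x + s *: w))).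
  apply: continuous_integrable_itv; apply: continuous_line.
  exact: lattice_mean_continuous.
have mI : measurable (`[0, L%:R]%classic : set (measurableTypeR R)) by exact: measurable_itv.
rewrite (eq_bigr (fun b : 'I__ => \int[leb]_(s in `[0, L%:R]) (t ^+ b *
    parallelepiped_integral W' L%:R (em_operator W' b (Ga a)) (x + s *: w)))); last first.
  by move=> b _; rewrite (parallelepiped_integral_cons W x LR0 (bE b)) -RintegralZl//; exact: ii.
rewrite -Rintegral_sum//; last by move=> b; exact: integrableZ_fin.
rewrite -RintegralB//; last by apply: integrable_sum_fin => // b; exact: integrableZ_fin.
have isum : leb.-integrable `[0, L%:R] (EFin \o (fun s => \sum_(b < (K - a).+1) t ^+ b *
    parallelepiped_integral W' L%:R (em_operator W' b (Ga a)) (x + s *: w))).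
  by apply: integrable_sum_fin => // b; exact: integrableZ_fin.
have idiff : leb.-integrable `[0, L%:R] (EFin \o (fun s => lattice_mean W' t (L * N) (Ga a) (x + s *: w) -
    \sum_(b < (K - a).+1) t ^+ b *
    parallelepiped_integral W' L%:R (em_operator W' b (Ga a)) (x + s *: w))).
  by apply: integrableB_fin; [exact: mI|exact: il|exact: isum].
apply: (le_trans (le_normr_Rintegral mI idiff)).
have -> : C2 a * t ^+ (K - a).+1 * L%:R = \int[leb]_(s in `[0, L%:R]) (C2 a * t ^+ (K - a).+1).
  by rewrite Rintegral_cst//= lebesgue_measure_itv/= lte_fin ltr0n L0 sube0.
apply: le_Rintegral => //.
- exact: (integrable_norm idiff).
- by apply: continuous_integrable_itv; exact: cst_continuous.
- by move=> s _; exact: HC2.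
Qed.

End euler_maclaurin.

(** * Vertices and unimodular frames *)

Section pairing_theory.
Context {R : realType} {m : nat}.
Implicit Types (x y : 'rV[R]_m) (u : 'rV[int]_m).

Lemma pairingD x y u : pairing (x + y) u = pairing x u + pairing y u.
Proof.
rewrite /pairing -big_split /=; apply: eq_bigr => i _.
by rewrite mxE mulrDl.
Qed.

Lemma pairingZ (c : R) x u : pairing (c *: x) u = c * pairing x u.
Proof.
rewrite /pairing mulr_sumr; apply: eq_bigr => i _.
by rewrite mxE mulrA.
Qed.

Lemma pairingB x y u : pairing (x - y) u = pairing x u - pairing y u.
Proof. by rewrite -scaleN1r pairingD pairingZ mulN1r. Qed.

Lemma norm_coord_le x i : `|x ord0 i| <= `|x|.
Proof.
rewrite [leRHS](_ : _ = mx_norm x)// mx_normrE.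
exact: (le_bigmax _ (fun ij => `|x ij.1 ij.2|) (ord0, i)).
Qed.

Lemma pairing_bound x u : `|pairing x u| <= `|x| * \sum_i `|(u ord0 i)%:~R|.
Proof.
rewrite /pairing mulr_sumr; apply: le_trans (ler_norm_sum _ _ _) _.
by apply: ler_sum => i _; rewrite normrM ler_wpM2r// norm_coord_le.
Qed.

Lemma bounded_set_norm (A : set 'rV[R]_m) : bounded_set A ->
  exists2 M : R, 0 <= M & forall x, A x -> `|x| <= M.
Proof.
move=> [M [_ HM]]; exists (Num.max 0 (M + 1)); first by rewrite le_max lexx.
by move=> x Ax; apply: HM => //; rewrite lt_max ltrDl ltr01 orbT.
Qed.

End pairing_theory.

Section vertices.
Context {R : realType} {m d : nat}.
Variables (v : 'I_d -> 'rV[int]_m) (lambda : 'I_d -> R).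
Implicit Types (x y : 'rV[R]_m).

Let P := polytope v lambda.

(** Move from y along w, which keeps the active inequalities active; as P is bounded, another
    inequality must become active before it fails. *)
Lemma active_add_line y (w : 'rV[R]_m) : bounded_set P -> P y -> w != 0 ->
  (forall r, active v lambda y r -> pairing w (v r) = 0) ->
  exists y' r0, [/\ P y', (forall r, active v lambda y r -> active v lambda y' r),
    active v lambda y' r0 & ~~ active v lambda y r0].
Proof.
move=> /bounded_set_norm[M M0 HM] Py w0 Hw.
have [r1 r10] : exists r, pairing w (v r) < 0.
  apply/not_existsP => Hr.
  have nw : 0 < `|w| by rewrite normr_gt0.
  (* at time s the point has left the ball of radius M *)
    pose s := (M + `|y| + 1) / `|w|.
  have s0 : 0 <= s by rewrite divr_ge0// addr_ge0// addr_ge0.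
  have /HM : P (y + s *: w).
    move=> r; rewrite pairingD pairingZ; apply: (le_trans (Py r)).
    by rewrite lerDl mulr_ge0// leNgt; apply/negP; exact: Hr.
  apply/negP; rewrite -ltNge.
  have : `|s *: w| <= `|y + s *: w| + `|y|.
    by have := ler_normB (y + s *: w) y; rewrite addrAC subrr add0r.
  rewrite normrZ ger0_norm// /s divfK ?gt_eqF// => H.
  by move: H; rewrite addrAC lerD2r; apply: lt_le_trans; rewrite ltrDl.
(* the time at which the r-th inequality becomes active, for decreasing l_r *)
pose tau r := (pairing y (v r) - lambda r) / - pairing w (v r).
have [r0 /= r00 Hmin] := @arg_minP _ _ _ r1 (fun r => pairing w (v r) < 0) tau r10.
have tau0 : 0 <= tau r0.
  by rewrite divr_ge0// ?subr_ge0 ?Py// oppr_ge0 ltW.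
exists (y + tau r0 *: w), r0; split.
- move=> r; rewrite pairingD pairingZ.
  have [rw|rw] := leP 0 (pairing w (v r)).
    by apply: (le_trans (Py r)); rewrite lerDl mulr_ge0.
  have := Hmin r rw; rewrite {2}/tau ler_pdivlMr ?oppr_gt0//.
  by move=> H; rewrite -subr_ge0 addrAC; move: H; rewrite mulrN -subr_ge0 opprK.
- move=> r ar; rewrite /active pairingD pairingZ Hw// mulr0 addr0.
  exact: ar.
- have w0' : pairing w (v r0) != 0 by rewrite lt_eqF.
  by rewrite /active pairingD pairingZ /tau invrN mulrN mulNr (divfK w0') opprB addrC subrK.
- by apply/negP => /Hw E; rewrite E ltxx in r00.
Qed.

(** Choose a point with as many active inequalities as possible among those where the inequalities
    active at x stay active.  If it were in the interior of a segment of P, the direction of the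
    segment would allow [active_add_line] to activate one more. *)
Lemma vertex_above x : bounded_set P -> P x ->
  exists2 y, vertex P y & forall r, active v lambda x r -> active v lambda y r.
Proof.
move=> bP Px.
pose Q n := `[< exists y, [/\ P y, (forall r, active v lambda x r -> active v lambda y r) &
  #|active v lambda y| = n] >].
have Q0 : exists n, Q n by exists #|active v lambda x|; apply/asboolP; exists x.
have Qb n : Q n -> (n <= d)%N.
  by move=> /asboolP[y [_ _ <-]]; rewrite -[X in (_ <= X)%N](card_ord d); exact: max_card.
case: (ex_maxnP Q0 Qb) => n /asboolP[y [Py xy yn]] nmax.
exists y => //; split => // a b t Pa Pb /andP[t0 t1] yE.
suff ab : a = b by move: yE; rewrite ab -scalerDl addrC subrK scale1r => ->.
apply: contrapT => /eqP; rewrite -subr_eq0 => w0.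
have [r ar|y' [r0 [Py' yy' r0y' r0y]]] := active_add_line bP Py w0.
  have := Pa r; have := Pb r; move: ar; rewrite /active yE pairingD !pairingZ.
  move=> /eqP E Hb Ha; rewrite pairingB; apply/eqP; rewrite subr_eq0; apply/eqP.
  by nra.
suff : (n < #|active v lambda y'|)%N.
  rewrite ltnNge nmax//; apply/asboolP; exists y'; split => // r /xy; exact: yy'.
rewrite -yn; apply: proper_card; apply/properP; split.
  by apply/fintype.subsetP => r; exact: yy'.
by exists r0.
Qed.

(** A unimodular coordinate system at a vertex x: rho numbers the facets through x, and the rows
    of W form the dual basis to their normals, that is, they are the primitive edge vectors at x. *)
Record frame x (rho : 'I_m -> 'I_d) (W : 'M[int]_m) : Prop := {
  frame_inj : injective rho;
  frame_active : forall r, active v lambda x r <-> exists i, r = rho i;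
  frame_dual : W *m (\matrix_i v (rho i))^T = 1%:M;
  frame_lattice : exists z : 'rV[int]_m, x = map_mx intr z
}.

Lemma vertex_frame x : delzant v lambda -> vertex P x -> exists rho W, frame x rho W.
Proof.
move=> hP vx; have cardA := delzant_simple hP vx; have := delzant_smooth hP vx.
have lx := delzant_lattice hP vx.
rewrite /active_normals.
pose V : 'M[int]_(m, m) := \matrix_(i < m) v (enum_val (cast_ord (esym cardA) i)).
move=> bV; exists (fun i => enum_val (cast_ord (esym cardA) i)).
have bV' z : exists c : 'rV[int]_m, c *m V = z.
  have [c [cE _]] := bV z; exists (\row_i c ord0 (cast_ord (esym cardA) i)).
  rewrite -cE; apply/rowP => j; rewrite !mxE.
  rewrite (reindex (cast_ord (esym cardA))) /=; last first.
    exists (cast_ord cardA) => i _; first exact: cast_ordKV.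
    exact: cast_ordK.
  by apply: eq_bigr => i _; rewrite !mxE.
have /choice[B HB] : forall i : 'I_m, exists c : 'rV[int]_m, c *m V = delta_mx ord0 i.
  by move=> i; exact: bV'.
have BV : (\matrix_i B i) *m V = 1%:M.
  by apply/row_matrixP => i; rewrite row_mul rowK HB row1.
exists (\matrix_i B i)^T; split=> //.
- by move=> i j /enum_val_inj /cast_ord_inj.
- move=> r; split=> [ar|[i ->]]; last exact: (enum_valP (cast_ord (esym cardA) i)).
  exists (cast_ord cardA (enum_rank_in ar r)).
  by rewrite cast_ordK enum_rankK_in.
- by rewrite -trmx_mul mulmx1C// trmx1.
Qed.

Section frame_theory.
Variables (x : 'rV[R]_m) (rho : 'I_m -> 'I_d) (W : 'M[int]_m).
Hypothesis fW : frame x rho W.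

Let WR : 'M[R]_m := map_mx intr W.

Lemma frame_perm (s : {perm 'I_m}) : frame x (rho \o s) (row_perm s W).
Proof.
case: fW => injrho actrho dual zx; split=> //.
- exact: inj_comp injrho perm_inj.
- move=> r; rewrite actrho; split=> [[i ->]|[i ->]]; last by exists (s i).
  by exists ((s^-1)%g i); rewrite /= permKV.
- have -> : (\matrix_i v ((rho \o s) i))^T = col_perm s (\matrix_i v (rho i))^T.
    by apply/matrixP => i j; rewrite !mxE.
  rewrite row_permE col_permE -mulmxA [W *m _]mulmxA dual mul1mx.
  by rewrite -perm_mxM mulgV perm_mx1.
Qed.

Let VR : 'M[R]_m := (\matrix_i map_mx intr (v (rho i)))^T.

Let WV : WR *m VR = 1%:M.
Proof.
have := congr1 (map_mx (intr : int -> R)) (frame_dual fW).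
rewrite map_mxM map_mx1 => <-; congr (_ *m _).
by apply/matrixP => i j; rewrite !mxE.
Qed.

Let pairingE y i : pairing y (v (rho i)) = (y *m VR) ord0 i.
Proof. by rewrite /pairing mxE; apply: eq_bigr => j _; rewrite !mxE. Qed.

Lemma frame_vertex_pairing i : pairing x (v (rho i)) = lambda (rho i).
Proof. by apply/eqP; apply/(frame_active fW); exists i. Qed.

Lemma pairing_frame (t : 'rV[R]_m) i :
  pairing (x + t *m WR) (v (rho i)) = lambda (rho i) + t ord0 i.
Proof.
by rewrite pairingD frame_vertex_pairing pairingE -mulmxA WV mulmx1.
Qed.

Lemma frame_unitmx : WR \in unitmx.
Proof. by case/mulmx1_unit: WV. Qed.

(** The determinants of W and of the matrix of the normals are integers with product 1. *)
Lemma frame_det : `|\det WR| = 1.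
Proof.
have dW : `|\det W|%N = 1%N.
  have := congr1 (fun M => `|\det M|%N) (frame_dual fW); rewrite det_mulmx det1 abszM.
  by move/eqP; rewrite muln_eq1 => /andP[/eqP].
by rewrite det_map_mx /= -intr_norm -natr_absz dW.
Qed.

(** By Cramer's rule, the entries of the inverse of W, which are those of the normals, are its
    cofactors, up to the sign that is the determinant of W. *)
Lemma frame_cofactor i k :
  `|\det (row' i (col' k WR))| = `|(v (rho i) ord0 k)%:~R|.
Proof.
have -> : (v (rho i) ord0 k)%:~R = VR k i by rewrite !mxE.
have -> : VR = invmx WR.
  by rewrite -[LHS]mul1mx -(mulVmx frame_unitmx) -mulmxA WV mulmx1.
rewrite /invmx frame_unitmx mxE normrM normfV frame_det invr1 mul1r mxE.
by rewrite /cofactor normrM normrX normrN1 expr1n mul1r.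
Qed.

End frame_theory.

End vertices.

(** * A partition of unity indexed by the vertices *)

Section partition_of_unity.
Context {R : realType} {m d : nat}.
Variables (v : 'I_d -> 'rV[int]_m) (lambda : 'I_d -> R).
Implicit Types (x y : 'rV[R]_m) (A : {set 'I_d}) (f g : 'rV[R]_m -> R).

Let P := polytope v lambda.

(** A vertex is represented by the set A of the facets through it, so that the vertices range over a
    finite type. *)
Definition vertex_set A : bool :=
  `[< exists2 x, vertex P x & forall r, active v lambda x r = (r \in A) >].

Definition away A : set 'rV[R]_m :=
  [set x | forall r, r \notin A -> lambda r <= pairing x (v r)].

Lemma closed_away A : closed (away A).
Proof.
rewrite (_ : away A = \bigcap_(r in [set r | r \notin A])
    (fun x => pairing x (v r) - lambda r) @^-1` [set t | 0 <= t]).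
  apply: closed_bigI => r _; apply: preimage_closed; last exact: closed_ge.
  by move=> x _; exact: continuous_affine.
by apply/seteqP; split => x /= H r rA; have := H r rA; rewrite /= subr_ge0.
Qed.

Definition bump A x : R := \prod_(r | r \notin A) flat 0 (pairing x (v r) - lambda r).

(** The second sum vanishes exactly on P; it makes the denominator of [cutoff] positive on the
    whole space. *)
Definition bump_total x : R :=
  \sum_(A | vertex_set A) bump A x + \sum_r flat 0 (lambda r - pairing x (v r)).

Definition cutoff A x : R := bump A x * (bump_total x)^-1.

Lemma smooth_bump A : smooth (bump A).
Proof.
apply: smooth_prod => r.
exact: (smooth_flat_affine 0 (fun i => (v r ord0 i)%:~R) (- lambda r)).
Qed.

Lemma smooth_bump_total : smooth bump_total.
Proof.
apply: smoothD; apply: smooth_sum => r; first exact: smooth_bump.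
rewrite (_ : (fun x => _) = fun x => flat 0 (affine (fun i => - (v r ord0 i)%:~R) (lambda r) x)).
  exact: smooth_flat_affine.
apply/funext => x; congr flat; rewrite /affine addrC; congr (_ + _).
by rewrite /pairing -sumrN; apply: eq_bigr => i _; rewrite mulrN.
Qed.

Hypothesis hP : delzant v lambda.

Let bP : bounded_set P := delzant_bounded hP.

Lemma bump_ge0 A x : 0 <= bump A x.
Proof. by apply: prodr_ge0 => r _; exact: flat_ge0. Qed.

Lemma bump_total_gt0 x : 0 < bump_total x.
Proof.
have h1 : 0 <= \sum_(A | vertex_set A) bump A x by apply: sumr_ge0 => A _; exact: bump_ge0.
have h2 : 0 <= \sum_r flat 0 (lambda r - pairing x (v r)) by apply: sumr_ge0 => r _; exact: flat_ge0.
have [Px|] := pselect (P x).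
  have [y vy xy] := vertex_above bP Px.
  pose A := [set r | active v lambda y r]%SET.
  have vA : vertex_set A by apply/asboolP; exists y => // r; rewrite inE.
  rewrite ltr_pwDl// (bigD1 A)//= ltr_pwDl//; last by apply: sumr_ge0 => B _; exact: bump_ge0.
  apply: prodr_gt0 => r rA; apply: flat_gt0; rewrite subr_gt0 lt_neqAle Px andbT.
  by apply: contra rA => /eqP E; rewrite inE; apply: xy; rewrite /active -E.
move=> /existsNP[r /negP]; rewrite -ltNge => xr.
rewrite ltr_wpDl// (bigD1 r)//= ltr_pwDl//; first by apply: flat_gt0; rewrite subr_gt0.
by apply: sumr_ge0 => s _; exact: flat_ge0.
Qed.

Lemma smooth_cutoff A : smooth (cutoff A).
Proof.
apply: smoothM; first exact: smooth_bump.
apply: smoothV; last exact: smooth_bump_total.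
by move=> x; rewrite gt_eqF// bump_total_gt0.
Qed.

Lemma cutoff_eq0 A x r : r \notin A -> pairing x (v r) <= lambda r -> cutoff A x = 0.
Proof.
move=> rA xr; rewrite /cutoff /bump (bigD1 r)//= flat_le0 ?mul0r//.
by rewrite subr_le0.
Qed.

(** On the cone cut out by the inequalities of A, [away A] is P itself.  So the localized function
    vanishes on the part of that cone which is outside P. *)
Lemma cutoff_vanishes A f : vanishes_off (away A) (fun x => cutoff A x * f x).
Proof.
move=> x /existsNP[r /not_implyP[rA /negP]]; rewrite -ltNge => xr.
by rewrite (cutoff_eq0 rA (ltW xr)) mul0r.
Qed.

Lemma sum_cutoff x : P x -> \sum_(A | vertex_set A) cutoff A x = 1.
Proof.
move=> Px; rewrite /cutoff -mulr_suml.
have -> : \sum_(A | vertex_set A) bump A x = bump_total x.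
  rewrite /bump_total [X in _ + X]big1 ?addr0// => r _.
  by rewrite flat_le0// subr_le0.
by rewrite mulfV// gt_eqF// bump_total_gt0.
Qed.

Lemma vertex_frames : exists p : {set 'I_d} -> 'rV[R]_m * ('I_m -> 'I_d) * 'M[int]_m,
  forall A, vertex_set A -> frame v lambda (p A).1.1 (p A).1.2 (p A).2 /\
    forall r, (r \in A) <-> exists i, r = (p A).1.2 i.
Proof.
have [z0 /interior_subset Pz0] := delzant_full_dim hP.
have [x0 vx0 _] := vertex_above bP Pz0; have [rho0 [W0 _]] := vertex_frame hP vx0.
have /choice[p Hp] : forall A, exists q : 'rV[R]_m * ('I_m -> 'I_d) * 'M[int]_m,
    vertex_set A -> frame v lambda q.1.1 q.1.2 q.2 /\
    forall r, (r \in A) <-> exists i, r = q.1.2 i.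
  move=> A; have [/asboolP[x vx xA]|nA] := boolP (vertex_set A); last first.
    by exists (x0, rho0, W0).
  have [rho [W fW]] := vertex_frame hP vx; exists (x, rho, W) => _; split=> // r.
  by rewrite -xA; exact: frame_active fW r.
by exists p.
Qed.

Lemma polytope_coordinate_bound :
  exists2 L : nat, (0 < L)%N & forall y r, P y -> pairing y (v r) - lambda r < L%:R.
Proof.
have [M M0 HM] := bounded_set_norm bP.
pose b r := M * (\sum_i `|(v r ord0 i)%:~R|) + `|lambda r|.
have b0 r : 0 <= b r by rewrite addr_ge0// mulr_ge0// sumr_ge0.
exists (Num.truncn (\sum_r b r)).+1 => // y r Py.
apply: le_lt_trans (truncnS_gt _); rewrite (bigD1 r)//=.
apply: le_trans (ler_wpDr (sumr_ge0 _ (fun s _ => b0 s)) (lexx _)).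
apply: lerD; last by rewrite -normrN ler_norm.
apply: le_trans (ler_norm _) (le_trans (pairing_bound _ _) _).
by rewrite ler_wpM2r ?HM// sumr_ge0.
Qed.

End partition_of_unity.

(** * Integrals over the polytope in a frame *)

Section em_operator_theory.
Context {R : realType} {m : nat}.
Implicit Types (G : 'rV[R]_m -> R).

Lemma em_operator_zero n (W : 'M[R]_(n, m)) G : em_operator W 0 G = G.
Proof.
elim: n W => // n IH W; apply/funext => x /=.
by rewrite big_ord1 em_coef0 mul1r IH.
Qed.

(** Only the terms of total degree 1 contribute, with c_0 = 1 and c_1 = -1/2. *)
Lemma em_operator_one n (W : 'M[R]_(n, m)) G x :
  em_operator W 1 G x = - 2^-1 * \sum_i 'D_(row i W) G x.
Proof.
elim: n W x => [|n IH] W x; first by rewrite /= big_ord0 mulr0.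
rewrite /= big_ord_recl big_ord1 /= em_coef0 mul1r subn0 IH em_operator_zero.
rewrite /bump /= em_coef1 -mulrDr big_ord_recl addrC; congr (_ * (_ + _)).
apply: eq_bigr => i _; congr ('D_(_) _ _).
by apply/rowP => j; rewrite !mxE.
Qed.

Lemma diffop_em_operator n (W : 'M[R]_(n, m)) j D : diffop D ->
  diffop (fun f => em_operator W j (D f)).
Proof.
elim: n W j D => [|n IH] W j D dD.
  by case: j => [|j] //=; exact: diffop0.
apply: diffop_sum => a; apply: diffopZ.
apply: (IH (row' ord0 W) (j - a)%N (fun f => iter a (fun F => 'D_(row ord0 W) F) (D f))).
by elim: (a : nat) => //= b; exact: diffop_derive.
Qed.

Lemma vanishes_off_em_operator n (W : 'M[R]_(n, m)) j Z G : closed Z ->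
  vanishes_off Z G -> vanishes_off Z (em_operator W j G).
Proof.
move=> cZ; elim: n W j G => [|n IH] W j G ZG; first by case: j.
move=> x Zx /=; rewrite big1// => a _; rewrite IH ?mulr0//.
by elim: (a : nat) => //= b; exact: (vanishes_off_derive _ cZ).
Qed.

End em_operator_theory.

Section integral_transfer.
Context d1 d2 (T1 : measurableType d1) (T2 : measurableType d2) (R : realType).
Variables (mu : {measure set T1 -> \bar R}) (nu : {measure set T2 -> \bar R}).
Variables (D : set T1) (E : set T2) (phi : T2 -> T1).

(** A formula for nonnegative functions extends to signed ones by taking positive and negative
    parts. *)
Lemma integral_transfer :
  (forall f : T1 -> \bar R, measurable_fun setT f -> (forall x, 0 <= f x)%E ->
    (\int[mu]_(x in D) f x = \int[nu]_(y in E) f (phi y))%E) ->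
  forall f : T1 -> \bar R, measurable_fun setT f ->
    (\int[mu]_(x in D) f x = \int[nu]_(y in E) f (phi y))%E.
Proof.
move=> H f mf; rewrite integralE [RHS]integralE.
rewrite (H _ (measurable_funepos mf)) ?(H _ (measurable_funeneg mf))//.
have -> : (fun y => f (phi y)) = f \o phi by [].
by rewrite (funepos_comp f phi) (funeneg_comp f phi).
Qed.

End integral_transfer.

Section frame_integrals.
Context {R : realType} {m d : nat}.
Local Notation leb := (@lebesgue_measure R).
Variables (v : 'I_d -> 'rV[int]_m) (lambda : 'I_d -> R).
Implicit Types (x y : 'rV[R]_m) (A : {set 'I_d}) (f g : 'rV[R]_m -> R).

Let P := polytope v lambda.

Lemma measurable_polytope : measurable P.
Proof.
rewrite (_ : P = \bigcap_(s in [set: 'I_d]) (pairing ^~ (v s) @^-1` `[lambda s, +oo[)).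
  apply: fin_bigcap_measurable => // s _.
  by rewrite -[X in measurable X]setTI; exact: measurable_pairing.
apply/seteqP; split => x Px s; first by move=> _; rewrite /= in_itv/= andbT.
by have := Px s I; rewrite /= in_itv/= andbT.
Qed.

Variables (x : 'rV[R]_m) (rho : 'I_m -> 'I_d) (W : 'M[int]_m) (A : {set 'I_d}) (L : nat).
Hypothesis fW : frame v lambda x rho W.
Hypothesis rhoA : forall r, (r \in A) <-> exists i, r = rho i.
Hypothesis PL : forall y r, P y -> pairing y (v r) - lambda r < L%:R.

Let WR : 'M[R]_m := map_mx intr W.

(** L is a common upper bound of the functions l_r on P, which are the frame coordinates for the
    r in A. *)
Lemma frame_polytope (u : 'rV[R]_m) : P (x + u *m WR) ->
  forall i, 0 <= u ord0 i < L%:R.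
Proof.
move=> Pu i; have := PL (rho i) Pu; have := Pu (rho i).
by rewrite (pairing_frame fW) lerDl addrAC subrr add0r => -> ->.
Qed.

Lemma away_frame (u : 'rV[R]_m) : (forall i, 0 <= u ord0 i) ->
  away v lambda A (x + u *m WR) -> P (x + u *m WR).
Proof.
move=> u0 au r; have [/rhoA[i ->]|] := boolP (r \in A); last exact: au.
by rewrite (pairing_frame fW) lerDl.
Qed.

Lemma frame_restrict g (u : 'rV[R]_m) : vanishes_off (away v lambda A) g ->
  (g \_ P) (x + u *m WR) = ((fun u => g (x + u *m WR)) \_ (cube m L%:R)) u.
Proof.
move=> Ag; rewrite !patchE.
have [Pu|Pu] := pselect (P (x + u *m WR)).
  rewrite (mem_set Pu) mem_set// => i /=; rewrite in_itv /=.
  by have /andP[-> /ltW ->] := frame_polytope Pu i.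
rewrite (memNset Pu); case: ifPn => // /set_mem cu; rewrite Ag// => au.
apply: Pu; apply: away_frame => // i.
by have := cu i; rewrite /= in_itv /= => /andP[].
Qed.

Lemma frame_change f : measurable_fun setT f ->
  (\int[lebesgue_rV m]_y (f y)%:E = \int[lebesgue_rV m]_u (f (x + u *m WR))%:E)%E.
Proof.
move=> mf.
apply: (@integral_transfer _ _ _ _ _ (lebesgue_rV m) (lebesgue_rV m) setT setT
  (fun u => x + u *m WR) _ (EFin \o f)); last exact/measurable_EFinP.
move=> h mh h0; rewrite (change_of_variables_unitmx (frame_unitmx fW) x mh h0).
rewrite (frame_det fW) mul1e.
by apply: eq_integral => u _; rewrite addrC.
Qed.

Lemma frame_integral g : measurable_fun setT g -> vanishes_off (away v lambda A) g ->
  parallelepiped_integral WR L%:R g x = \int[lebesgue_rV m]_(y in P) g y.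
Proof.
move=> mg Ag.
rewrite Rintegral_mkcond /parallelepiped_integral /cube_integral Rintegral_mkcond.
rewrite /Rintegral [in RHS]frame_change; last first.
  by apply/(@measurable_restrictT _ _ _ _ P g measurable_polytope); exact: measurable_funTS.
congr fine; apply: eq_integral => u _; congr EFin.
by rewrite frame_restrict.
Qed.

End frame_integrals.

Section divergence.
Context {R : realType} {n d : nat}.
Local Notation leb := (@lebesgue_measure R).
Variables (v : 'I_d -> 'rV[int]_n.+1) (lambda : 'I_d -> R).
Implicit Types (g : 'rV[R]_n.+1 -> R).

Let P := polytope v lambda.

Variables (x : 'rV[R]_n.+1) (rho : 'I_n.+1 -> 'I_d) (W : 'M[int]_n.+1) (A : {set 'I_d}) (L : nat).
Hypothesis L0 : (0 < L)%N.
Hypothesis fW : frame v lambda x rho W.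
Hypothesis rhoA : forall r, (r \in A) <-> exists i, r = rho i.
Hypothesis PL : forall y r, P y -> pairing y (v r) - lambda r < L%:R.

Let WR : 'M[R]_n.+1 := map_mx intr W.

(** Fundamental theorem of calculus along the first row of W.  There is no contribution from the
    end u_1 = L: the function vanishes there, because that face of the cube does not meet P. *)
Lemma divergence_facet0 g : bounded_smooth g -> vanishes_off (away v lambda A) g ->
  \int[lebesgue_rV n.+1]_(y in P) 'D_(row ord0 WR) g y =
  - cube_integral L%:R (fun t : 'rV[R]_n => g (x + t *m row' ord0 WR)).
Proof.
move=> bg Ag; have bDg := bounded_smooth_derive (row ord0 WR) bg.
have sDg : smooth ('D_(row ord0 WR) g) by case: bDg.
have sg : smooth g by case: bg.
rewrite -(frame_integral fW rhoA PL); first last.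
- apply: vanishes_off_derive; [exact: closed_away|exact: Ag].
- exact: continuous_measurable_rV (smooth_continuous sDg).
have LR : 0 <= L%:R :> R by rewrite ler0n.
rewrite /parallelepiped_integral (cube_integral_cons2 LR (bounded_smooth_measurable _ x bDg)).
rewrite -mulN1r -cube_integralZ//; last first.
  exact: (bounded_smooth_measurable (row' ord0 WR) x bg).
apply: eq_Rintegral => y /set_mem cy; set w := row ord0 WR.
pose x' := x + y *m row' ord0 WR.
have E s : x + rV_cons (s, y) *m WR = x' + s *: w.
  by rewrite rV_cons_mul -/w [s *: _ + _]addrC addrA.
under eq_Rintegral do rewrite E.
have dg (s : R) : 0 <= s -> is_derive s 1 (fun s : R => g (x' + s *: w)) ('D_w g (x' + s *: w)).
  by move=> _; exact: is_derive_line (smooth_derivable_dir _ _ sg).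
have L0' : 0 < L%:R :> R by rewrite ltr0n.
rewrite (integral_of_derivative L0' (@continuous_line _ _ _ x' w (smooth_continuous sDg)) dg).
rewrite scale0r addr0 mulN1r -[RHS]add0r; congr (_ - _).
have cL : cube n.+1 L%:R (rV_cons (L%:R, y)).
  by apply/cube_cons; split => //=; rewrite in_itv /= LR lexx.
have := frame_restrict fW rhoA PL (rV_cons (L%:R, y)) Ag.
rewrite [RHS]patchE (mem_set cL) E => <-; rewrite patchE memNset//.
rewrite -E => /(frame_polytope fW PL)/(_ ord0).
by rewrite mxE unlift_none ltxx andbF.
Qed.

End divergence.

Section divergence_facets.
Context {R : realType} {n d : nat}.
Variables (v : 'I_d -> 'rV[int]_n.+1) (lambda : 'I_d -> R).

Let P := polytope v lambda.

Variables (x : 'rV[R]_n.+1) (rho : 'I_n.+1 -> 'I_d) (W : 'M[int]_n.+1) (A : {set 'I_d}) (L : nat).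
Hypothesis L0 : (0 < L)%N.
Hypothesis fW : frame v lambda x rho W.
Hypothesis rhoA : forall r, (r \in A) <-> exists i, r = rho i.
Hypothesis PL : forall y r, P y -> pairing y (v r) - lambda r < L%:R.

Let WR : 'M[R]_n.+1 := map_mx intr W.

(** The rows of a frame can be permuted, which brings the i-th one to the front. *)
Lemma divergence_facet (g : 'rV[R]_n.+1 -> R) i :
  bounded_smooth g -> vanishes_off (away v lambda A) g ->
  \int[lebesgue_rV n.+1]_(y in P) 'D_(row i WR) g y =
  - cube_integral L%:R (fun t : 'rV[R]_n => g (x + t *m row' i WR)).
Proof.
move=> bg Ag; pose s : {perm 'I_n.+1} := lift_perm ord0 i 1.
have rhosA r : (r \in A) <-> exists j, r = (rho \o s) j.
  rewrite rhoA; split=> [[j ->]|[j ->]]; last by exists (s j).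
  by exists ((s^-1)%g j); rewrite /= permKV.
have := divergence_facet0 L0 (frame_perm fW s) rhosA PL bg Ag.
have -> : row ord0 (map_mx intr (row_perm s W)) = row i WR.
  by apply/rowP => j; rewrite !mxE lift_perm_id.
have -> : row' ord0 (map_mx intr (row_perm s W)) = row' i WR :> 'M[R]_(n.+1.-1, n.+1).
  by apply/matrixP => a b; rewrite !mxE lift_perm_lift perm1.
by [].
Qed.

End divergence_facets.

(** * The Leray measure in a frame *)

Section restricted_measure.
Context d (T : measurableType d) (R : realType).
Variables (mu : {measure set T -> \bar R}) (F : set T).
Hypothesis mF : measurable F.

Lemma ge0_integral_mrestr (D : set T) (f : T -> \bar R) : measurable D ->
  measurable_fun setT f -> (forall x, 0 <= f x)%E ->
  (\int[mrestr mu mF]_(x in D) f x = \int[mu]_(x in D `&` F) f x)%E.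
Proof.
move=> mD mf f0.
have mDF : measurable (D `&` F) by exact: measurableI.
have mDC : measurable (D `\` F) by exact: measurableD.
rewrite -[in LHS](setUIDK D F) ge0_integral_setU//; last first.
- by rewrite disj_set2E; apply/eqP/seteqP; split => x //= [[_ Fx] [_ /(_ Fx)]].
- exact: measurable_funTS.
rewrite [X in (_ + X)%E](_ : _ = 0%E) ?adde0.
  apply: eq_measure_integral => B mB BD; rewrite /= /mrestr setIidl// => x /BD[].
  by [].
apply: null_set_integral => //; first exact: measurable_funTS.
rewrite /= /mrestr (_ : _ `&` _ = set0) ?measure0//.
by apply/seteqP; split => x //= [[_ /[apply]]].
Qed.

End restricted_measure.

Section leray_measure.
Context {R : realType} {n d : nat}.
Variables (v : 'I_d -> 'rV[int]_n.+1) (lambda : 'I_d -> R).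
Implicit Types (g : 'rV[R]_n.+1 -> R).

Let P := polytope v lambda.

Lemma primitive_neq0 (u : 'rV[int]_n.+1) : primitive u -> exists k, u ord0 k != 0.
Proof.
move=> pu; apply/existsP; rewrite -[X in is_true X]negbK; apply/negP => /existsPn u0.
suff : (0 = 1)%N by [].
rewrite -[RHS]pu big1// => i _; have := u0 i; rewrite negbK => /eqP ->.
by rewrite absz0.
Qed.

(** The definition of the Leray measure of a facet in the chart solving for x_k, with the choice
    of k hidden. *)
Lemma leray_facet_ge0 r : primitive (v r) -> exists2 k, v r ord0 k != 0 &
  forall (D : set 'rV[R]_n.+1) (f : 'rV[R]_n.+1 -> \bar R), measurable D ->
    facet v lambda r `<=` D -> measurable_fun setT f -> (forall x, 0 <= f x)%E ->
    (\int[leray_facet v lambda r]_(x in D) f x = (`|(v r ord0 k)%:~R|^-1)%:E *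
     \int[lebesgue_rV n]_(y in chart (v r) (lambda r) k @^-1` facet v lambda r)
        f (chart (v r) (lambda r) k y))%E.
Proof.
move=> /primitive_neq0[k0 k00]; rewrite /leray_facet.
case: pickP => [k kne|/(_ k0)]; last by rewrite k00.
exists k => // D f mD FD mf f0.
rewrite ge0_integral_mscale//; first last.
- exact: measurable_funTS.
congr (_ * _)%E; rewrite ge0_integral_mrestr//.
rewrite (setIidr FD).
have := @ge0_integral_pushforward _ _ 'rV[R]_n 'rV[R]_n.+1 R (chart (v r) (lambda r) k)
  (measurable_chart (v r) (lambda r) k) (lebesgue_rV n) (facet v lambda r) f (measurable_facet v lambda r)
  (measurable_funTS mf) (fun y _ => f0 y).
move=> <-.
exact: (@eq_measure_integral _ _ _ _ (measure_function_pushforward__canonical__measure_function_Measure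
    (lebesgue_rV n) (measurable_chart (v r) (lambda r) k)) (chart_lebesgue (v r) (lambda r) k)).
Qed.

Lemma chart_unique (u : 'rV[int]_n.+1) (l : R) k (z : 'rV[R]_n.+1) : u ord0 k != 0 ->
  pairing z u = l -> chart u l k (col' k z) = z.
Proof.
move=> uk zu; apply/rowP => j; rewrite mxE.
case: (unliftP k j) => [i|] ->; first by rewrite mxE.
rewrite -zu /pairing (bigD1_ord k)//=.
under [X in _ - X]eq_bigr do rewrite mxE.
by rewrite addrK mulfK// intr_eq0.
Qed.

Section frame.
Variables (x : 'rV[R]_n.+1) (rho : 'I_n.+1 -> 'I_d) (W : 'M[int]_n.+1) (A : {set 'I_d}) (L : nat).
Hypothesis fW : frame v lambda x rho W.
Hypothesis rhoA : forall r, (r \in A) <-> exists i, r = rho i.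
Hypothesis PL : forall y r, P y -> pairing y (v r) - lambda r < L%:R.
Variable i : 'I_n.+1.

Let WR : 'M[R]_n.+1 := map_mx intr W.
Let r := rho i.
Let point_of (t : 'rV[R]_n) := x + t *m (row' i WR : 'M[R]_(n, n.+1)).

Let insert0 (t : 'rV[R]_n) : 'rV[R]_n.+1 := @rV_insert R n.+1 i 0 t.

Let point_ofE t : point_of t = x + insert0 t *m WR.
Proof.
congr (_ + _); apply/rowP => j; rewrite !mxE (bigD1_ord i)//= mxE unlift_none mul0r add0r.
by apply: eq_bigr => a _; rewrite !mxE liftK.
Qed.

Let pairing_point_of t : pairing (point_of t) (v r) = lambda r.
Proof. by rewrite point_ofE (pairing_frame fW) mxE unlift_none addr0. Qed.

Let measurable_point_of : measurable_fun setT point_of.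
Proof.
have := measurable_mulmxD (row' i WR : 'M[R]_(n, n.+1)) x.
by under eq_fun do rewrite addrC.
Qed.

(** The projection forgetting x_k, in the frame coordinates of the facet, is affine, and the
    determinant of its linear part is a minor of W; [frame_cofactor] says that this determinant
    cancels the density of the Leray measure. *)
Lemma leray_facet_frame_ge0 (D : set 'rV[R]_n.+1) (f : 'rV[R]_n.+1 -> \bar R) :
  primitive (v r) -> measurable D ->
  facet v lambda r `<=` D -> measurable_fun setT f -> (forall x, 0 <= f x)%E ->
  (\int[leray_facet v lambda r]_(x in D) f x =
   \int[lebesgue_rV n]_(t in (fun t : 'rV[R]_n => (x + t *m row' i WR)%R) @^-1` facet v lambda r)
     f (x + t *m row' i WR)%R)%E.
Proof.
move=> /leray_facet_ge0[k k0 H] mD FD mf f0; rewrite H//.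
rewrite integral_mkcond [in RHS]integral_mkcond.
set h := _ \_ _.
have mchart : measurable_fun setT (chart (v r) (lambda r) k) by exact: measurable_chart.
have mpre : measurable (chart (v r) (lambda r) k @^-1` facet v lambda r).
  by rewrite -[X in measurable X]setTI; apply: mchart => //; exact: measurable_facet.
have mh : measurable_fun setT h.
  apply/(measurable_restrictT _ mpre).
  by apply: measurable_funTS; exact: measurableT_comp mf mchart.
have h0 y : (0 <= h y)%E by rewrite /h patchE; case: ifP.
pose M : 'M[R]_n := row' i (col' k WR).
have vr0 : `|(v r ord0 k)%:~R| != 0 :> R by rewrite normr_eq0 intr_eq0.
have detM : `|\det M| = `|(v r ord0 k)%:~R| by exact: frame_cofactor fW i k.
have uM : M \in unitmx by rewrite unitmxE unitfE -normr_eq0 detM.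
rewrite (change_of_variables_unitmx uM (col' k x) mh h0) detM muleA -EFinM mulVf// mul1e.
apply: eq_integral => t _.
have -> : h ((t *m M)%R + col' k x)%R = h (col' k (point_of t)).
  congr h; rewrite addrC; apply/rowP => j; rewrite !mxE; congr (_ + _).
  by apply: eq_bigr => a _; rewrite !mxE.
have E := chart_unique k0 (pairing_point_of t).
rewrite /h !patchE.
have [Ft|Ft] := pselect (facet v lambda r (point_of t)).
  by rewrite mem_set ?mem_set//= E.
by rewrite memNset ?memNset//= E.
Qed.

Lemma leray_facet_frame (D : set 'rV[R]_n.+1) g :
  primitive (v r) -> measurable D -> facet v lambda r `<=` D ->
  measurable_fun setT g -> vanishes_off (away v lambda A) g ->
  \int[leray_facet v lambda r]_(y in D) g y =
  cube_integral L%:R (fun t : 'rV[R]_n => g (x + t *m row' i WR)).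
Proof.
move=> pr mD FD mg Ag; rewrite /cube_integral /Rintegral; congr fine.
rewrite (@integral_transfer _ _ _ _ _ (leray_facet v lambda r) (lebesgue_rV n) D
  (point_of @^-1` facet v lambda r) point_of); first last.
- exact/measurable_EFinP.
- by move=> f mf f0; exact: leray_facet_frame_ge0.
rewrite integral_mkcond [in RHS]integral_mkcond; apply: eq_integral => t _.
rewrite !patchE /=.
have cubeP : P (point_of t) -> cube n L%:R t.
  rewrite point_ofE => /(frame_polytope fW PL) H j; rewrite /= in_itv /=.
  by have := H (lift i j); rewrite mxE liftK => /andP[-> /ltW ->].
have [Pt|Pt] := pselect (P (point_of t)).
  rewrite mem_set; last by split.
  by rewrite (mem_set (cubeP Pt)).
rewrite memNset; last by case.
case: ifPn => // /set_mem ct; rewrite -[x + _]/(point_of t) Ag// => au.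
apply: Pt; move: au; rewrite point_ofE; apply: (away_frame fW rhoA) => j; rewrite mxE.
case: unliftP => [a _|_] //; have := ct a.
by rewrite /= in_itv /= => /andP[].
Qed.

Lemma leray_facet_finite (D : set 'rV[R]_n.+1) :
  primitive (v r) -> measurable D -> facet v lambda r `<=` D ->
  (leray_facet v lambda r D < +oo)%E.
Proof.
move=> pr mD FD.
have := leray_facet_frame_ge0 pr mD FD (@measurable_cst _ _ _ _ setT (1%E : \bar R)) (fun=> lee01).
rewrite integral_cst// mul1e => ->.
rewrite integral_cst ?mul1e; last first.
  by rewrite -[X in measurable X]setTI; apply: measurable_point_of => //; exact: measurable_facet.
apply: (@le_lt_trans _ _ (lebesgue_rV n (cube n L%:R))); last first.
  by rewrite [X in (X < _)%E](_ : _ = (L%:R ^+ n)%:E) ?ltry//; exact: lebesgue_cube.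
apply: le_measure; [apply/mem_set|apply/mem_set|].
- by rewrite -[X in measurable X]setTI; apply: measurable_point_of => //; exact: measurable_facet.
- exact: measurable_cube.
- move=> t [Pt _] j; move: Pt; rewrite -/(point_of t) point_ofE => /(frame_polytope fW PL) H; rewrite /= in_itv /=.
  by have := H (lift i j); rewrite mxE liftK => /andP[-> /ltW ->].
Qed.

End frame.

Lemma leray_facet_vanish r (D : set 'rV[R]_n.+1) g :
  primitive (v r) -> measurable D -> facet v lambda r `<=` D ->
  measurable_fun setT g -> (forall y, facet v lambda r y -> g y = 0) ->
  \int[leray_facet v lambda r]_(y in D) g y = 0.
Proof.
move=> pr mD FD mg g0; have [k k0 H] := leray_facet_ge0 pr.
have z (f : 'rV[R]_n.+1 -> \bar R) : measurable_fun setT f -> (forall x, 0 <= f x)%E ->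
    (forall y, facet v lambda r y -> f y = 0%E) ->
    (\int[leray_facet v lambda r]_(y in D) f y = 0)%E.
  by move=> mf f0 fz; rewrite H// integral0_eq ?mule0// => y /fz.
have mg' : measurable_fun setT (EFin \o g) by exact/measurable_EFinP.
rewrite /Rintegral integralE !z ?sube0//.
- exact: measurable_funeneg.
- by move=> y /g0 E; rewrite (funenegE (EFin \o g)) /= E /= oppr0 maxxx.
- exact: measurable_funepos.
- by move=> y /g0 E; rewrite (funeposE (EFin \o g)) /= E maxxx.
Qed.

Section boundary.
Hypothesis hP : delzant v lambda.

Let D := closure P `\` P°.

Let bP : bounded_set P := delzant_bounded hP.

Lemma closed_polytope : closed P.
Proof.
rewrite (_ : P = away v lambda finset.set0); first exact: closed_away.
by apply/seteqP; split => x H r; [move=> _|]; apply: H; rewrite inE.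
Qed.

Lemma measurable_boundary : measurable D.
Proof.
have mC : measurable (closure P : set 'rV[R]_n.+1).
  rewrite -[X in measurable X]setCK; apply: measurableC; apply: open_measurable_rV.
  by apply: closed_openC; exact: closed_closure.
apply: (measurableD mC); apply: open_measurable_rV; exact: open_interior.
Qed.

Lemma boundary_sub : D `<=` P.
Proof. by move=> x [+ _]; rewrite -(closure_id _).1//; exact: closed_polytope. Qed.

(** From a point of a facet, moving against its normal leaves P at once. *)
Lemma facet_sub_boundary r : facet v lambda r `<=` D.
Proof.
move=> y [Py yr]; split; first exact: subset_closure.
move=> /nbhs_ballP[e /= e0 He].
pose w : 'rV[R]_n.+1 := map_mx intr (v r); pose s : R := e / (2 * (`|w| + 1)).
have w1 : 0 < `|w| + 1 by rewrite ltr_wpDl.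
have s0 : 0 < s by rewrite divr_gt0// mulr_gt0.
have ww : 0 < pairing w (v r).
  have [k vk] := primitive_neq0 (delzant_primitive hP r).
  have sq j : 0 <= w ord0 j * (v r ord0 j)%:~R by rewrite mxE -expr2 sqr_ge0.
  rewrite /pairing (bigD1 k)//= ltr_pwDl ?sumr_ge0//.
  by rewrite mxE -expr2 exprn_even_gt0//= intr_eq0.
have /(_ r) : P (y - s *: w).
  apply: He; rewrite -ball_normE /= opprB addrC subrK normrZ gtr0_norm// /s.
  rewrite mulrAC ltr_pdivrMr ?mulr_gt0// ltr_pM2l//.
  by rewrite mulrDr mulr1 mulr2n mulrDl mul1r -addrA ltrDl ltr_wpDl.
by rewrite pairingB pairingZ yr leNgt gtrBl mulr_gt0.
Qed.

Lemma facet_vertex r : exists2 A, vertex_set v lambda A & r \in A.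
Proof.
have [x0 [M [[Px0 xr] _ _]]] := delzant_facet hP r.
have [y vy xy] := vertex_above bP Px0.
exists [set s | active v lambda y s]%SET; last by rewrite inE; apply: xy; apply/eqP.
by apply/asboolP; exists y => // s; rewrite inE.
Qed.

Lemma leray_facet_boundary_finite r : (leray_facet v lambda r D < +oo)%E.
Proof.
have [A vA rA] := facet_vertex r; have [p /(_ A vA) [fW rhoA]] := vertex_frames hP.
have [L _ PL] := polytope_coordinate_bound hP.
have /rhoA[i ->] := rA; apply: (leray_facet_finite fW PL (i := i)).
- exact: (delzant_primitive hP).
- exact: measurable_boundary.
- exact: facet_sub_boundary.
Qed.

Lemma leray_boundary_finite : (leray v lambda D < +oo)%E.
Proof. by apply: lte_sum_pinfty => r _; exact: leray_facet_boundary_finite. Qed.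

Lemma ge0_leray_integral (f : 'rV[R]_n.+1 -> \bar R) :
  measurable_fun setT f -> (forall x, 0 <= f x)%E ->
  (\int[leray v lambda]_(x in D) f x = \sum_(r < d) \int[leray_facet v lambda r]_(x in D) f x)%E.
Proof.
move=> mf f0; have mD := measurable_boundary.
pose nu (k : nat) : {measure set 'rV[R]_n.+1 -> \bar R} := oapp (leray_facet v lambda) mzero (insub k).
have nuE (r : 'I_d) : nu r = leray_facet v lambda r by rewrite /nu valK.
transitivity (\int[msum nu d]_(x in D) f x)%E.
  by apply: eq_measure_integral => B _ _; apply: eq_bigr => r _; rewrite nuE.
rewrite ge0_integral_measure_sum//; last exact: measurable_funTS.
by apply: eq_bigr => r _; rewrite nuE.
Qed.

Lemma finite_integrable (mu : {measure set 'rV[R]_n.+1 -> \bar R}) g :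
  (mu D < +oo)%E -> bounded_measurable g -> mu.-integrable D (EFin \o g).
Proof.
move=> fD bg; apply: measurable_bounded_integrable => //.
- exact: measurable_boundary.
- by apply: measurable_funTS; case: bg.
- exact: bounded_measurable_bounded.
Qed.

(** A bounded function is a nonnegative function minus a constant, and all the measures are finite
    on the boundary; so additivity over the facets for nonnegative functions is enough. *)
Lemma leray_integral g : bounded_measurable g ->
  \int[leray v lambda]_(x in D) g x = \sum_(r < d) \int[leray_facet v lambda r]_(x in D) g x.
Proof.
move=> bg; have [mg [M gM]] := bg.
have ge0 h : bounded_measurable h -> (forall x, 0 <= h x) ->
    \int[leray v lambda]_(x in D) h x = \sum_(r < d) \int[leray_facet v lambda r]_(x in D) h x.
  move=> bh h0; rewrite /Rintegral ge0_leray_integral ?sum_fine//; first last.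
  - by apply/measurable_EFinP; case: bh.
  - move=> r _; apply: integrable_fin_num; first exact: measurable_boundary.
    exact: finite_integrable (leray_facet_boundary_finite r) bh.
have bM : bounded_measurable (fun=> M : R) by move=> k; split => //; exists `|M|.
have b2 : bounded_measurable (fun x => g x + M) by exact: bounded_measurableD.
have M0 : 0 <= M by exact: le_trans (gM 0).
have split_int (mu : {measure set 'rV[R]_n.+1 -> \bar R}) : (mu D < +oo)%E ->
    \int[mu]_(x in D) g x = \int[mu]_(x in D) (g x + M) - \int[mu]_(x in D) M.
  move=> fD; rewrite -RintegralB//; first last.
  - exact: finite_integrable.
  - exact: finite_integrable.
  - exact: measurable_boundary.
  by apply: eq_Rintegral => x _; rewrite addrK.
rewrite (split_int _ leray_boundary_finite) !ge0//; last first.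
  by move=> x; rewrite -lerBlDr sub0r; have := gM x; rewrite ler_norml => /andP[].
rewrite -sumrB; apply: eq_bigr => r _; rewrite [RHS](split_int (leray_facet v lambda r))//.
exact: leray_facet_boundary_finite.
Qed.

Variables (p : {set 'I_d} -> 'rV[R]_n.+1 * ('I_n.+1 -> 'I_d) * 'M[int]_n.+1) (L : nat).
Hypothesis fp : forall A, vertex_set v lambda A -> frame v lambda (p A).1.1 (p A).1.2 (p A).2 /\
    forall r, (r \in A) <-> exists i, r = (p A).1.2 i.
Hypothesis PL : forall y r, P y -> pairing y (v r) - lambda r < L%:R.

(** For the function localized at A, the facets outside A contribute 0, because [cutoff A] vanishes
    on them; those in A are faces u_i = 0 of the orthant of the frame. *)
Lemma leray_integral_frames f :
  (forall A, bounded_measurable (fun x => cutoff v lambda A x * f x)) ->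
  \int[leray v lambda]_(x in D) f x =
  \sum_(A | vertex_set v lambda A) \sum_i cube_integral L%:R (fun t : 'rV[R]_n =>
    cutoff v lambda A ((p A).1.1 + t *m row' i (map_mx intr (p A).2)) *
    f ((p A).1.1 + t *m row' i (map_mx intr (p A).2))).
Proof.
move=> bg; have mD := measurable_boundary.
transitivity (\int[leray v lambda]_(x in D) \sum_(A | vertex_set v lambda A) (cutoff v lambda A x * f x)).
  apply: eq_Rintegral => x /set_mem /boundary_sub Px.
  by rewrite -mulr_suml sum_cutoff// mul1r.
under eq_Rintegral do rewrite -big_filter.
rewrite Rintegral_sum//; last by move=> A; exact: finite_integrable leray_boundary_finite (bg A).
rewrite big_filter; apply: eq_bigr => A vA; have [fW rhoA] := fp vA.
rewrite leray_integral// (bigID (mem A)) /= [X in _ + X]big1 ?addr0; last first.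
  move=> r rA; apply: leray_facet_vanish => //.
  - exact: (delzant_primitive hP).
  - exact: facet_sub_boundary.
  - by case: (bg A).
  - by move=> y [_ yr]; rewrite (@cutoff_eq0 _ _ _ v lambda A y r rA) ?mul0r// yr.
have AE : A = ((p A).1.2 @: [set: 'I_n.+1])%SET.
  apply/setP => r; apply/idP/imsetP => [/rhoA[i ->]|[i _ ->]]; first by exists i.
  by apply/rhoA; exists i.
rewrite (eq_bigl [in ((p A).1.2 @: [set: 'I_n.+1])%SET]); last by move=> r; rewrite {1}AE.
rewrite big_imset /=; last by move=> i j _ _; exact: (frame_inj fW).
apply: eq_big => [i|i _]; first by rewrite inE.
apply: (leray_facet_frame fW rhoA PL) => //.
- exact: (delzant_primitive hP).
- exact: facet_sub_boundary.
- by case: (bg A).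
- exact: cutoff_vanishes.
Qed.

End boundary.

End leray_measure.

(** * Lattice points in a frame *)

Section lattice_points.
Context {R : realType} {m : nat}.
Implicit Types (G : 'rV[R]_m -> R) (x : 'rV[R]_m).

Lemma lattice_mean_points n (W : 'M[R]_(n, m)) t M G x :
  lattice_mean W t M G x =
  t ^+ n * \sum_(k : 'rV['I_M]_n) G (x + (\row_i ((k ord0 i)%:R * t)) *m W).
Proof.
elim: n W x => [|n IH] W x /=.
  have k0 : 'I_0 -> 'I_M by case.
  rewrite mul1r (big_pred1 (\row_j k0 j)); last first.
    by move=> k; apply/esym/eqP/rowP; case.
  by rewrite thinmx0 mul0mx addr0.
pose cons (p : 'I_M * 'rV['I_M]_n) : 'rV['I_M]_n.+1 := @rV_insert _ n.+1 ord0 p.1 p.2.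
rewrite exprS -mulrA; congr (_ * _).
under eq_bigr do rewrite IH.
rewrite -mulr_sumr; congr (_ * _).
rewrite pair_big /= (reindex cons) /=; last first.
  exists (fun k => (k ord0 ord0, \row_j k ord0 (lift ord0 j))) => [[a y] _|k _].
    by congr pair; [rewrite mxE unlift_none|apply/rowP => j; rewrite !mxE liftK].
  apply/rowP => j; rewrite mxE; case: unliftP => [i ->|->] //.
  by rewrite mxE.
apply: eq_bigr => -[a y] _; congr G; rewrite -addrA; congr (_ + _) => /=.
rewrite -rV_cons_mul; congr (_ *m _); apply/rowP => j; rewrite !mxE.
by case: unliftP => [i _|_]; rewrite ?mxE.
Qed.

End lattice_points.

Section riemann_sums.
Context {R : realType} {m d : nat}.
Variables (v : 'I_d -> 'rV[int]_m) (lambda : 'I_d -> R).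
Implicit Types (x y : 'rV[R]_m) (f g : 'rV[R]_m -> R).

Let P := polytope v lambda.

Section frame.
Variables (x : 'rV[R]_m) (rho : 'I_m -> 'I_d) (W : 'M[int]_m) (A : {set 'I_d}) (L : nat).
Hypothesis fW : frame v lambda x rho W.
Hypothesis rhoA : forall r, (r \in A) <-> exists i, r = rho i.
Hypothesis PL : forall y r, P y -> pairing y (v r) - lambda r < L%:R.
Variable N : nat.
Hypothesis N0 : (0 < N)%N.

Let WR : 'M[R]_m := map_mx intr W.

(** A lattice point a with a/N in P has integral coordinates N u, because N x is a lattice point and
    W is invertible over the integers. *)
Lemma dilated_lattice_frame : exists2 phi : 'rV['I_(L * N)]_m -> 'rV[int]_m,
  injective phi /\ (forall k, N%:R^-1 *: map_mx intr (phi k) =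
    x + (\row_i ((k ord0 i)%:R * N%:R^-1)) *m WR) &
  dilated_lattice_points P N `<=` range phi.
Proof.
have [z zx] := frame_lattice fW.
have N0' : N%:R != 0 :> R by rewrite pnatr_eq0 -lt0n.
pose V : 'M[int]_m := (\matrix_i v (rho i))^T.
have VW : V *m W = 1%:M := mulmx1C (frame_dual fW).
pose phi (k : 'rV['I_(L * N)]_m) : 'rV[int]_m := N%:R *: z + map_mx (fun i : 'I__ => (i : nat)%:R) k *m W.
have phiE k : N%:R^-1 *: map_mx intr (phi k) = x + (\row_i ((k ord0 i)%:R * N%:R^-1)) *m WR.
  rewrite /phi map_mxD map_mxZ scalerDr scalerA.
  rewrite rmorph_nat mulVf// scale1r zx map_mxM scalemxAl; congr (_ + _ *m _).
  by apply/rowP => i; rewrite !mxE rmorph_nat mulrC.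
exists phi; first split=> // k k'.
  move=> /addrI /(congr1 (mulmx^~ V)); rewrite -!mulmxA (frame_dual fW) !mulmx1.
  move=> /rowP kk'; apply/rowP => i; apply/val_inj; have := kk' i; rewrite !mxE.
  by move/eqP; rewrite eqr_nat => /eqP.
move=> a [y Py ya]; pose c : 'rV[int]_m := (a - N%:R *: z) *m V.
have cW : c *m W = a - N%:R *: z by rewrite -mulmxA VW mulmx1.
have yE : y = x + (N%:R^-1 *: map_mx intr c) *m WR.
  rewrite -scalemxAl -map_mxM cW map_mxB map_mxZ -ya zx rmorph_nat -scalerBr scalerA mulVf//.
  by rewrite scale1r addrC subrK.
have := Py; rewrite {1}yE => /(frame_polytope fW PL) cL.
clearbody c; have cN i : 0 <= c ord0 i < (L * N)%:R.
  have := cL i; rewrite !mxE mulrC pmulr_lge0 ?invr_gt0 ?ltr0n// ltr_pdivrMr ?ltr0n// ler0z.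
  by rewrite -natrM [X in _ < X]pmulrn natz ltr_int.
have cN' i : (`|c ord0 i| < L * N)%N.
  by have /andP[c0] := cN i; rewrite -ltz_nat gez0_abs// natz.
have kc : map_mx (fun i : 'I_(L * N) => (i : nat)%:R) (\row_i Ordinal (cN' i)) = c.
  apply/rowP => i; rewrite 2!mxE [LHS]natz; apply: gez0_abs.
  by have /andP[] := cN i.
exists (\row_i Ordinal (cN' i)); first exact: I.
by rewrite /phi kc cW addrC subrK.
Qed.

(** The points of the cube that are outside P are added to the sum, or removed from it, freely: the
    function vanishes there. *)
Lemma riemann_sum_frame g : vanishes_off (away v lambda A) g ->
  riemann_sum P g N = N%:R ^+ m * lattice_mean WR N%:R^-1 (L * N) g x.
Proof.
move=> Ag; have [phi [phiI phiE] Pphi] := dilated_lattice_frame.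
have N0' : N%:R != 0 :> R by rewrite pnatr_eq0 -lt0n.
rewrite lattice_mean_points mulrA -exprMn mulfV// expr1n mul1r.
rewrite /riemann_sum (@fsbig_fwiden _ _ _ _ [seq phi k | k : 'rV['I_(L * N)]_m]).
- by rewrite big_map big_enum; apply: eq_bigr => k _; rewrite phiE.
- by move=> a /Pphi[k _ <-] /=; apply: map_f; rewrite mem_enum.
- by rewrite map_inj_uniq ?enum_uniq.
- move=> a [/= /mapP[k _ ->] aP]; rewrite phiE Ag// => au.
  apply: aP; exists (N%:R^-1 *: map_mx intr (phi k)).
    rewrite phiE; apply: (away_frame fW rhoA) au => i.
    by rewrite mxE mulr_ge0// invr_ge0.
  by rewrite scalerA mulfV// scale1r.
Qed.

Lemma finite_dilated_lattice : finite_set (dilated_lattice_points P N).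
Proof.
have [phi _ Pphi] := dilated_lattice_frame.
by apply: sub_finite_set Pphi _; apply: finite_image.
Qed.

End frame.

Hypothesis hP : delzant v lambda.

Lemma riemann_sum_cutoff f N : (0 < N)%N ->
  riemann_sum P f N =
  \sum_(A | vertex_set v lambda A) riemann_sum P (fun x => cutoff v lambda A x * f x) N.
Proof.
move=> N0; have [L _ PL] := polytope_coordinate_bound hP.
have [z0 /interior_subset Pz0] := delzant_full_dim hP.
have [x0 vx0 _] := vertex_above (delzant_bounded hP) Pz0; have [rho0 [W0 f0]] := vertex_frame hP vx0.
have fin := finite_dilated_lattice f0 PL N0.
rewrite /riemann_sum; under [RHS]eq_bigr do rewrite fsbig_finite//.
rewrite exchange_big fsbig_finite// big_seq [RHS]big_seq; apply: eq_bigr => a.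
rewrite in_fset_set// => /set_mem[y Py /= ya].
rewrite -mulr_suml sum_cutoff ?mul1r// -ya scalerA mulVf ?scale1r//.
by rewrite pnatr_eq0 -lt0n.
Qed.

End riemann_sums.

(** * The asymptotic expansion *)

Section bounded_polytope.
Context {R : realType} {m d : nat}.
Variables (v : 'I_d -> 'rV[int]_m) (lambda : 'I_d -> R).
Hypothesis bP : bounded_set (polytope v lambda).

Let P := polytope v lambda.

Lemma lebesgue_polytope : (lebesgue_rV m P < +oo)%E.
Proof.
have [M _ HM] := bounded_set_norm bP.
pose B := [set x : 'rV[R]_m | forall i, `[- M, M]%classic (x ord0 i)].
have mB : measurable B := @measurable_box R m (fun=> `[- M, M]%classic) (fun=> measurable_itv _).
apply: (@le_lt_trans _ _ (lebesgue_rV m B)).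
  apply: le_measure; [apply/mem_set; exact: measurable_polytope|exact/mem_set|].
  move=> x Px i; rewrite /= in_itv /= -ler_norml.
  exact: le_trans (norm_coord_le x i) (HM x Px).
rewrite (@lebesgue_rV_box R m (fun=> `[- M, M]%classic))//.
suff : (\prod_(i < m) lebesgue_measure `[(- M)%R, M])%E \is a fin_num by rewrite fin_numE => /andP[_]; rewrite ltey.
apply: (big_ind (fun e : \bar R => e \is a fin_num)) => // [a b|i _]; first exact: fin_numM.
by rewrite lebesgue_measure_itv /=; case: ifP.
Qed.

Lemma polytope_integrable g : bounded_smooth g -> (lebesgue_rV m).-integrable P (EFin \o g).
Proof.
move=> [sg bg]; apply: measurable_bounded_integrable.
- exact: measurable_polytope.
- exact: lebesgue_polytope.
- exact: measurable_funTS (continuous_measurable_rV (smooth_continuous sg)).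
have [M HM] := bg [::]; exists M; split; first exact: num_real.
by move=> c Mc x _; exact: le_trans (HM x) (ltW Mc).
Qed.

End bounded_polytope.

Section expansion.
Context {R : realType} {m d : nat}.
Variables (v : 'I_d -> 'rV[int]_m) (lambda : 'I_d -> R).
Hypothesis hP : delzant v lambda.

Let P := polytope v lambda.

Variables (p : {set 'I_d} -> 'rV[R]_m * ('I_m -> 'I_d) * 'M[int]_m) (L : nat).
Hypothesis fp : forall A, vertex_set v lambda A -> frame v lambda (p A).1.1 (p A).1.2 (p A).2 /\
    forall r, (r \in A) <-> exists i, r = (p A).1.2 i.
Hypothesis L0 : (0 < L)%N.
Hypothesis PL : forall y r, P y -> pairing y (v r) - lambda r < L%:R.

Let WR A : 'M[R]_m := map_mx intr (p A).2.
Let localize A f : 'rV[R]_m -> R := fun x => cutoff v lambda A x * f x.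

Definition expansion_operator j f : 'rV[R]_m -> R :=
  fun x => \sum_(A | vertex_set v lambda A) em_operator (WR A) j (localize A f) x.

Lemma differential_operator_expansion j : differential_operator (expansion_operator j).
Proof.
apply: diffop_differential_operator; apply: diffop_sum => A.
apply: diffop_em_operator; apply: diffop_mull; exact: smooth_cutoff.
Qed.

Variable f : 'rV[R]_m -> R.
Hypothesis sf : smooth f.
Hypothesis cf : compactly_supported f.

Lemma bounded_smooth_localize A : bounded_smooth (fun x => cutoff v lambda A x * f x).
Proof.
apply: (@bounded_smooth_compact _ _ (closure [set x | f x != 0]) _ cf); first exact: closed_closure.
- move=> x fx; have [->|fx0] := eqVneq (f x) 0; first by rewrite mulr0.
  by exfalso; apply: fx; exact: subset_closure.
- exact: (smoothM (smooth_cutoff hP A) sf).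
Qed.

Let bg A : bounded_smooth (localize A f) := bounded_smooth_localize A.

Let bE A j : bounded_smooth (em_operator (WR A) j (localize A f)).
Proof. exact: em_operator_bounded_smooth. Qed.

(** Each summand is integrated in the frame of its vertex. *)
Lemma integral_frames j : \int[lebesgue_rV m]_(x in P) expansion_operator j f x =
  \sum_(A | vertex_set v lambda A)
    parallelepiped_integral (WR A) L%:R (em_operator (WR A) j (localize A f)) (p A).1.1.
Proof.
transitivity (\sum_(A | vertex_set v lambda A)
    \int[lebesgue_rV m]_(x in P) em_operator (WR A) j (localize A f) x).
  rewrite /expansion_operator; under eq_Rintegral do rewrite -big_filter.
  rewrite Rintegral_sum ?big_filter//; first exact: measurable_polytope.
  by move=> A; apply: polytope_integrable; [exact: (delzant_bounded hP)|exact: bE].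
apply: eq_bigr => A vA; have [fW rhoA] := fp vA.
rewrite (frame_integral fW rhoA PL)//.
- by apply: continuous_measurable_rV; apply: smooth_continuous; case: (bE A j).
- exact: vanishes_off_em_operator (@closed_away _ _ _ v lambda A) (@cutoff_vanishes _ _ _ v lambda A f).
Qed.

Lemma integral_expansion_zero :
  \int[lebesgue_rV m]_(x in P) expansion_operator 0 f x = \int[lebesgue_rV m]_(x in P) f x.
Proof.
apply: eq_Rintegral => x /set_mem Px; rewrite /expansion_operator.
under eq_bigr do rewrite em_operator_zero.
by rewrite -mulr_suml sum_cutoff// mul1r.
Qed.

(** The contributions of the vertices are bounded separately by [euler_maclaurin], with t = 1/N. *)
Lemma expansion_bound K : exists C : R, forall N, (0 < N)%N ->
  `|riemann_sum P f N - \sum_(j < K.+1) (\int[lebesgue_rV m]_(x in P) expansion_operator j f x) *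
      N%:R ^ (m%:Z - j%:Z)| <= C * N%:R ^ (m%:Z - K%:Z - 1).
Proof.
have /choice[C HC] : forall A, exists C : R, forall N, (0 < N)%N ->
    `|lattice_mean (WR A) N%:R^-1 (L * N) (localize A f) (p A).1.1 -
      \sum_(j < K.+1) N%:R^-1 ^+ j * parallelepiped_integral (WR A) L%:R
        (em_operator (WR A) j (localize A f)) (p A).1.1| <= C * N%:R^-1 ^+ K.+1.
  by move=> A; have [C HC] := euler_maclaurin (WR A) K L0 (bg A); exists C => N N0; exact: HC.
exists (\sum_(A | vertex_set v lambda A) C A) => N N0.
have N0' : N%:R != 0 :> R by rewrite pnatr_eq0 -lt0n.
have powE (j : nat) : N%:R ^ (m%:Z - j%:Z) = N%:R ^+ m * N%:R^-1 ^+ j :> R.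
  by rewrite expfzDr// -exprnN -exprVn.
rewrite (_ : m%:Z - K%:Z - 1 = m%:Z - K.+1%:Z) ?powE; last by rewrite -addn1 PoszD opprD addrA.
under eq_bigr do rewrite integral_frames powE mulr_suml.
rewrite exchange_big /= (riemann_sum_cutoff hP f N0) -sumrB mulr_suml.
apply: le_trans (ler_norm_sum _ _ _) _; apply: ler_sum => A vA.
have [fW rhoA] := fp vA.
rewrite (riemann_sum_frame fW rhoA PL N0); last exact: cutoff_vanishes.
rewrite mulrCA; apply: le_trans (ler_wpM2l _ (HC A N N0)); last exact: exprn_ge0.
rewrite -[X in X * `|_|]ger0_norm ?exprn_ge0// -normrM mulrBr mulr_sumr.
rewrite le_eqVlt; apply/orP; left; apply/eqP; congr (`|_ - _|).
by apply: eq_bigr => j _; rewrite [RHS]mulrA [RHS]mulrC.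
Qed.

End expansion.

Section boundary_term.
Context {R : realType} {d : nat}.

(** For each vertex, both sides are half the sum of the integrals of the localized function over the
    faces u_i = 0 of its frame. *)
Lemma integral_expansion_one m (v : 'I_d -> 'rV[int]_m) (lambda : 'I_d -> R)
    (p : {set 'I_d} -> 'rV[R]_m * ('I_m -> 'I_d) * 'M[int]_m) (L : nat) (f : 'rV[R]_m -> R) :
  delzant v lambda ->
  (forall A, vertex_set v lambda A -> frame v lambda (p A).1.1 (p A).1.2 (p A).2 /\
      forall r, (r \in A) <-> exists i, r = (p A).1.2 i) -> (0 < L)%N ->
  (forall y r, polytope v lambda y -> pairing y (v r) - lambda r < L%:R) ->
  smooth f -> compactly_supported f ->
  \int[lebesgue_rV m]_(x in polytope v lambda) expansion_operator v lambda p 1 f x =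
  2^-1 * \int[leray v lambda]_(x in closure (polytope v lambda) `\` (polytope v lambda)°) f x.
Proof.
case: m v p f => [|n] v p f hP fp L0 PL sf cf.
  (* in dimension 0 no normal is primitive, hence there are no facets *)
  have noI (r : 'I_d) : False.
    by have := delzant_primitive hP r; rewrite /primitive big_ord0.
  rewrite [RHS](_ : _ = 0); last first.
    rewrite /Rintegral (eq_measure_integral mzero) ?integral_measure_zero ?mulr0//.
    by move=> B _ _; rewrite /= /leray big1// => r; case: (noI r).
  under eq_Rintegral do [rewrite /expansion_operator big1//].
  by rewrite /Rintegral integral0.
have bg A : bounded_smooth (fun x => cutoff v lambda A x * f x) by exact: bounded_smooth_localize.
have bD A i : bounded_smooth ('D_(row i (map_mx intr (p A).2)) (fun x => cutoff v lambda A x * f x)).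
  exact: bounded_smooth_derive.
have iD A i : (lebesgue_rV n.+1).-integrable (polytope v lambda)
    (EFin \o 'D_(row i (map_mx intr (p A).2)) (fun x => cutoff v lambda A x * f x)).
  by apply: polytope_integrable; [exact: (delzant_bounded hP)|exact: bD].
have mP := @measurable_polytope _ _ _ v lambda.
rewrite (leray_integral_frames hP fp PL); last first.
  move=> A; have := bounded_smooth_measurable 1%:M 0 (bg A).
  by under eq_fun do rewrite mulmx1 add0r.
transitivity (\int[lebesgue_rV n.+1]_(x in polytope v lambda)
    (- 2^-1 * \sum_(A | vertex_set v lambda A) \sum_i
       'D_(row i (map_mx intr (p A).2)) (fun x => cutoff v lambda A x * f x) x)).
  apply: eq_Rintegral => x _; rewrite /expansion_operator mulr_sumr.
  by apply: eq_bigr => A _; rewrite em_operator_one.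
under eq_Rintegral do rewrite -big_filter.
have iS A : (lebesgue_rV n.+1).-integrable (polytope v lambda) (EFin \o (fun x => \sum_i
    'D_(row i (map_mx intr (p A).2)) (fun x => cutoff v lambda A x * f x) x)).
  by apply: integrable_sum_fin => // i; exact: iD.
rewrite RintegralZl//; last by apply: integrable_sum_fin => // A; exact: iS.
rewrite Rintegral_sum// big_filter !mulr_sumr; apply: eq_bigr => A vA.
have [fW rhoA] := fp A vA.
rewrite Rintegral_sum//.
rewrite !mulr_sumr; apply: eq_bigr => i _.
rewrite (divergence_facet L0 fW rhoA PL _ (bg A)) ?mulrNN//.
exact: cutoff_vanishes.
Qed.

End boundary_term.

Theorem corollary1 (R : realType) (m d : nat)
    (v : 'I_d -> 'rV[int]_m) (lambda : 'I_d -> R)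
    (hP : delzant v lambda) :
  exists E : nat -> ('rV[R]_m -> R) -> ('rV[R]_m -> R),
    (forall j, (2 <= j)%N -> differential_operator (E j)) /\
    forall f : 'rV[R]_m -> R, smooth f -> compactly_supported f ->
      let P := polytope v lambda in
      asymptotic_expansion m (riemann_sum P f)
        (fun j => match j with
                  | 0 => \int[lebesgue_rV m]_(x in P) f x
                  | 1 => 2^-1 * \int[leray v lambda]_(x in closure P `\` P°) f x
                  | _ => \int[lebesgue_rV m]_(x in P) E j f x
                  end).
Proof.
have [p fp] := vertex_frames hP; have [L L0 PL] := polytope_coordinate_bound hP.
exists (expansion_operator v lambda p); split.
  by move=> j _; exact: differential_operator_expansion.
move=> f sf cf P; set c := (fun _ : nat => _).
have cE j : c j = \int[lebesgue_rV m]_(x in P) expansion_operator v lambda p j f x.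
  case: j => [|[|j]]; rewrite /c//.
  - exact/esym/integral_expansion_zero.
  - by rewrite (integral_expansion_one hP fp L0 PL sf cf).
move=> K; have [C HC] := expansion_bound hP fp L0 PL sf cf K.
apply/eqO_exP; exists (Num.max C 1); first by rewrite lt_max ltr01 orbT.
exists 1%N => // N /= N0; under eq_bigr do rewrite cE.
apply: le_trans (HC N N0) _.
rewrite [X in _ <= _ * X](_ : _ = N%:R ^ (m%:Z - K%:Z - 1)); last exact: (ger0_norm (exprz_ge0 _ _)).
by rewrite ler_wpM2r ?exprz_ge0// le_max lexx.
Qed.
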